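(* Let $G$ be a graph on $n$ vertices with odd-girth at least $7$. If the minimum degree satisfies $\delta(G)>\frac n5$, then $G$ is not $\left(\frac12,\frac1{98}\right)$-dense.
   Context: All graphs are finite and simple. An $n$-vertex graph $G$ is called $(\alpha,\beta)$-dense if every subset of $\lfloor \alpha n\rfloor$ vertices of $G$ spans (induces) more than $\beta n^2$ edges. A graph has odd-girth at least $2k+1$ if it contains no odd cycle of length at most $2k-1$; in particular, odd-girth at least $7$ means that there are no cycles of length $3$ or $5$. *)

(* Defs.v *)
From mathcomp Require Import all_boot all_order all_algebra.

Set Implicit Arguments.
Unset Strict Implicit.
Unset Printing Implicit Defensive.

Import Order.TTheory GRing.Theory Num.Theory.
Local Open Scope ring_scope.

Definition simple_graph (T : finType) (e : rel T) : Prop :=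
  symmetric e /\ irreflexive e.

Definition degree (T : finType) (e : rel T) (x : T) : nat :=
  #|[set y | e x y]|.

(* The default value #|T| is never attained when T is nonempty and e is
   irreflexive, since then every degree is at most #|T| - 1; the graph without
   vertices gets minimum degree 0. *)
Definition min_degree (T : finType) (e : rel T) : nat :=
  \big[minn/#|T|]_(x : T) degree e x.

Definition edges (T : finType) (e : rel T) : {set {set T}} :=
  [set [set x; y] | x in T, y in T & e x y].

Definition edges_in (T : finType) (e : rel T) (A : {set T}) : {set {set T}} :=
  [set E in edges e | E \subset A].

(* ucycle alone would also accept the empty sequence and, in a symmetric
   relation, a single edge traversed back and forth. *)
Definition graph_cycle (T : finType) (e : rel T) (c : seq T) : Prop :=
  ucycle e c /\ (3 <= size c)%N.

Definition odd_girth_at_least (T : finType) (e : rel T) (g : nat) : Prop :=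
  ~ exists c : seq T, [/\ graph_cycle e c, odd (size c) & (size c < g)%N].

Definition dense_graph (R : archiRealFieldType) (T : finType) (e : rel T)
    (alpha beta : R) : Prop :=
  forall A : {set T},
    #|A|%:Z = Num.floor (alpha * #|T|%:R) ->
    beta * #|T|%:R ^+ 2 < #|edges_in e A|%:R.

(* Main.v *)
(** Add edges as long as no closed walk of length 3 or 5 appears: then nonadjacent vertices
    are joined by a walk of length 4, degrees only grow, and a sparse half of the new graph is
    sparse in the old one.

    In such a maximal graph the neighbourhoods of three neighbours of a vertex never contain
    each a vertex outside the two others (a "spider"), and a few further small configurations
    are impossible.  Each of these exclusions is a finite case tree.  Its leaves are weightings of
    the vertices found so far for which every vertex of the graph sees at most a fifth of the
    total weight, contradicting [5 * deg x > n].

    Consequently every neighbourhood is covered by those of two of its "ends", and following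
    ends from one vertex splits the graph into five blocks around a circle, edges joining only
    blocks at distance two and forming nested bipartite graphs.  So the vertices have a
    circular order in which two nonadjacent vertices always bound an independent arc.  If all
    half-circles span more than n^2/98 edges, a cycle-lemma argument along the half-circle
    windows gives more than n^2/7 edges, hence an edge uv with deg u + deg v >= 4n/7.  The
    neighbourhoods and second neighbourhoods of u and v then cut the graph into eight classes,
    adjacent only at cyclic distance at least three, and some half of the vertices,
    a union of classes up to one class, is sparse. *)

Require Import Defs.
From mathcomp Require Import all_boot all_order all_algebra.
From mathcomp Require Import zify ring lra.

Set Implicit Arguments.
Unset Strict Implicit.
Unset Printing Implicit Defensive.

(** The balanced blow-up of the seven-cycle is extremal and the source of the constants: it has
    [n ^ 2 / 7] edges, every edge has degree sum [4 n / 7], and its sparsest halves, three pairwise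
    nonadjacent classes with half of a class that meets only one of them, span [n ^ 2 / 98] edges.
    The counting therefore has to be exact at this graph.

    The picture behind the structural part is a circle on which only nearly antipodal points are
    adjacent, so that each neighbourhood is an arc. The circle is not given, and [5 * deg x > n]
    only says that five neighbourhoods are never pairwise disjoint, together with weighted forms of
    this. Maximality makes this usable: each missing edge yields a walk of length 4, hence new
    vertices to put weights on. The ends of a neighbourhood stand for the extreme points of its arc,
    a spider is a triple none of which lies between the other two, and following ends recovers the
    circle. *)

Section Walks.
Variables (T : finType) (e : rel T).

Definition nb (x : T) : {set T} := [set y | e x y].
Definition walk2 x y := [exists z, e x z && e z y].
Definition walk3 x y := [exists z, e x z && walk2 z y].
Definition walk4 x y := [exists z, walk2 x z && walk2 z y].

Lemma walk2I x z y : e x z -> e z y -> walk2 x y.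
Proof. by move=> xz zy; apply/existsP; exists z; rewrite xz. Qed.

Lemma walk3I x a b y : e x a -> e a b -> e b y -> walk3 x y.
Proof. by move=> xa ab b_y; apply/existsP; exists a; rewrite xa (walk2I ab b_y). Qed.

Lemma walk4I x a b c y : e x a -> e a b -> e b c -> e c y -> walk4 x y.
Proof.
by move=> xa ab bc cy; apply/existsP; exists b; rewrite (walk2I xa ab) (walk2I bc cy).
Qed.

(** Forbidding closed walks instead of cycles means that no distinctness of vertices has to be
    tracked. The field [walk4_nonadj] is what edge-maximality leaves: a further edge would close a
    walk of length 5. *)
Record dense_c3c5_free : Prop := DenseFree {
  adjC : symmetric e;
  no_c3 : forall x y, e x y -> walk2 x y -> False;
  no_c5 : forall x y, e x y -> walk4 x y -> False;
  walk4_nonadj : forall x y, ~~ e x y -> walk4 x y;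
  deg_gt : forall x, #|T| < 5 * #|nb x| }.

Hypothesis G : dense_c3c5_free.

Lemma walk2C : symmetric walk2.
Proof.
by move=> x y; apply/existsP/existsP => -[z /andP[a b]]; exists z;
  rewrite (adjC G) b (adjC G) a.
Qed.

Lemma walk3P x y : reflect (exists a b, [/\ e x a, e a b & e b y]) (walk3 x y).
Proof.
apply: (iffP existsP) => [[a /andP[xa /existsP[b /andP[ab b_y]]]]|[a [b [xa ab b_y]]]].
  by exists a, b.
by exists a; rewrite xa (walk2I ab b_y).
Qed.

Lemma walk4P x y :
  reflect (exists a b c, [/\ e x a, e a b, e b c & e c y]) (walk4 x y).
Proof.
apply: (iffP existsP) => [[b /andP[/existsP[a /andP[xa ab]] /existsP[c /andP[bc cy]]]]|].
  by exists a, b, c.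
by move=> [a [b [c [xa ab bc cy]]]]; exists b; rewrite (walk2I xa ab) (walk2I bc cy).
Qed.

Lemma walk3C : symmetric walk3.
Proof.
have sym := adjC G.
by move=> x y; apply/walk3P/walk3P => -[a [b [xa ab b_y]]]; exists b, a;
  rewrite sym b_y sym ab sym xa.
Qed.

Lemma no_c5_23 x y : walk2 x y -> walk3 x y -> False.
Proof.
move=> /existsP[z /andP[xz zy]] /walk3P[a [b [xa ab b_y]]].
apply: (no_c5 G xz); rewrite (adjC G) in zy.
by apply/existsP; exists b; rewrite (walk2I xa ab) (walk2I b_y) // (adjC G).
Qed.

End Walks.

(** * Certificates *)

(* Partial information about a relation on the vertices of a pattern: [at2 m i j]
   asserts that the relation holds between [i] and [j]. *)
Definition at2 (m : seq bitseq) i j := nth false (nth [::] m i) j.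

Fixpoint or_seq (r s : bitseq) : bitseq :=
  match r, s with
  | [::], _ => s
  | _, [::] => r
  | a :: r', b :: s' => (a || b) :: or_seq r' s'
  end.

Fixpoint or_mx (r s : seq bitseq) : seq bitseq :=
  match r, s with
  | [::], _ => s
  | _, [::] => r
  | a :: r', b :: s' => or_seq a b :: or_mx r' s'
  end.

Fixpoint or_rows (r : bitseq) (m : seq bitseq) : bitseq :=
  match r, m with
  | a :: r', s :: m' => if a then or_seq s (or_rows r' m') else or_rows r' m'
  | _, _ => [::]
  end.

Definition mul_mx (r s : seq bitseq) : seq bitseq := [seq or_rows a s | a <- r].

Definition mark i j (m : seq bitseq) : seq bitseq :=
  set_nth [::] m i (set_nth false (nth [::] m i) j true).

Definition mark2 i j m := mark i j (mark j i m).

Definition marks (s : seq (nat * nat)) : seq bitseq :=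
  foldr (fun q m => mark2 q.1 q.2 m) [::] s.

(** The matrices [nonD], [nonA], [nonS] hold negative facts: no common neighbour, no edge, no walk
    of length 3. Pairs recorded nowhere are undecided. *)
Record pattern := Pattern {
  order : nat; adj : seq bitseq; nonD : seq bitseq; nonA : seq bitseq;
  nonS : seq bitseq; claw : option (nat * nat * nat * nat) }.

Definition mk_pattern n E D A S cl :=
  Pattern n (marks E) (marks D) (marks A) (marks S) cl.

Definition fits n (m : seq bitseq) := (size m <= n) && all (fun r => size r <= n) m.

(** New vertices are numbered from [order p]; well-formedness guarantees that no earlier fact
    mentions such a number. *)
Definition wf p :=
  let n := order p in
  [&& fits n (adj p), fits n (nonD p), fits n (nonA p), fits n (nonS p) &
      if claw p is Some (h, x, y, z) then [&& h < n, x < n, y < n & z < n] else true].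

(** Beyond the recorded pairs: those whose common neighbour would close a walk of length 3 or 5, or
    create a walk of length 3 excluded by [nonS]. *)
Definition no2 p :=
  let a := adj p in let s := nonS p in
  or_mx (nonD p) (or_mx a (or_mx (mul_mx (mul_mx a a) a)
    (or_mx (mul_mx a s) (mul_mx s a)))).

(** Beyond the recorded pairs: those whose edge would close a walk of length 5 or contradict [nonD]
    or [nonS]. The term [s] enters alone because an edge walked back and forth is a walk of length
    3. *)
Definition no1 p :=
  let a := adj p in let s := nonS p in let d := nonD p in let a2 := mul_mx a a in
  or_mx (nonA p) (or_mx (mul_mx a2 a2) (or_mx (mul_mx a d) (or_mx (mul_mx d a)
    (or_mx s (or_mx (mul_mx a (mul_mx s a)) (or_mx (mul_mx a2 s) (mul_mx s a2))))))).

(* In [(i, j, k, p2, p4)], a vertex adjacent to [i] and [j] is adjacent to [k] because of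
   the closed 6-walk it forms with [i, p2, k, p4, j]. *)
Definition implication := (nat * nat * nat * nat * nat)%type.

Definition imp_ok p n1 (q : implication) :=
  let: (i, j, k, p2, p4) := q in
  [&& at2 (adj p) i p2, at2 (adj p) p2 k, at2 (adj p) k p4, at2 (adj p) p4 j,
      at2 n1 i p4 & at2 n1 p2 j].

Definition violated (imps : seq implication) (ins outs : bitseq) :=
  has (fun q : implication => let: (i, j, k, _, _) := q in
    [&& nth false ins i, nth false ins j & nth false outs k]) imps.

Fixpoint meets (r s : bitseq) :=
  match r, s with a :: r', b :: s' => a && b || meets r' s' | _, _ => false end.

Definition put (v : nat) (s : bitseq) : bitseq := set_nth false s v true.

(* Branch and bound on the part of [ws] inside the neighbourhood of one vertex; [ins] and
   [outs] are the choices made, [acc] and [rem] the weights inside and undecided. *)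
Fixpoint max_weight n2 imps (ws : seq (nat * nat)) ins outs acc rem bound :=
  if acc + rem <= bound then true else
  if ws is (v, w) :: ws' then
    (meets (nth [::] n2 v) ins || violated imps (put v ins) outs ||
      max_weight n2 imps ws' (put v ins) outs (acc + w) (rem - w) bound) &&
    (violated imps ins (put v outs) ||
      max_weight n2 imps ws' ins (put v outs) acc (rem - w) bound)
  else false.

(** Rounding the bound down loses nothing, the weight seen by a vertex being an integer. Entries of
    weight 0 only make the search branch on further vertices, so that implications can apply. *)
Definition leaf_ok p (ws : seq (nat * nat)) (imps : seq implication) :=
  let total := sumn (map snd ws) in
  [&& 0 < total, nilp imps || (let n1 := no1 p in all (imp_ok p n1) imps) &
      max_weight (no2 p) imps ws [::] [::] 0 total (total %/ 5)].

(* Steps refuting a pattern.  [Contra] and [Leaf] end a branch; [SplitD i j] distinguishes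
   whether [i] and [j] have a common neighbour, [SplitA i j] whether they are adjacent or
   joined by a walk of length 4, which [Walk i j] adds to a pair known to be nonadjacent.
   [Hexa] adds the third diagonal of a hexagon, [Helly i j k] a common neighbour of three
   vertices having common neighbours pairwise, and [Claw w] the edge given by [claw].  New
   vertices get the numbers [order p], [order p + 1], [order p + 2]. *)
Inductive cert :=
| Contra of nat & nat
| Leaf of seq (nat * nat) & seq implication
| SplitD of nat & nat & cert & cert
| SplitA of nat & nat & cert & cert
| Walk of nat & nat & cert
| Hexa of nat & nat & nat & nat & nat & nat & cert
| Helly of nat & nat & nat & cert
| Claw of nat & cert.

Definition add_edge i j p :=
  Pattern (order p) (mark2 i j (adj p)) (nonD p) (nonA p) (nonS p) (claw p).

Definition add_vertices k p :=
  Pattern (k + order p) (adj p) (nonD p) (nonA p) (nonS p) (claw p).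

Definition add_nonD i j p :=
  Pattern (order p) (adj p) (mark2 i j (nonD p)) (nonA p) (nonS p) (claw p).

Definition add_walk4 i j p :=
  let n := order p in
  add_edge i n (add_edge n n.+1 (add_edge n.+1 n.+2 (add_edge n.+2 j (add_vertices 3 p)))).

(** The flag [hx] unlocks the steps that rest on the closure of hexagons; that closure is itself
    certified with the flag off. *)
Fixpoint check (hx : bool) p c :=
  let n := order p in
  wf p &&
  match c with
  | Contra i j =>
      at2 (adj p) i j && at2 (no1 p) i j || at2 (mul_mx (adj p) (adj p)) i j && at2 (no2 p) i j
  | Leaf ws imps => (hx || nilp imps) && leaf_ok p ws imps
  | SplitD i j c1 c2 => [&& i < n, j < n,
      check hx (add_edge i n (add_edge j n (add_vertices 1 p))) c1 &
      check hx (add_nonD i j p) c2]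
  | SplitA i j c1 c2 => [&& i < n, j < n,
      check hx (add_edge i j p) c1 & check hx (add_walk4 i j p) c2]
  | Walk i j c1 => [&& i < n, j < n, at2 (no1 p) i j & check hx (add_walk4 i j p) c1]
  | Hexa p0 p1 p2 p3 p4 p5 c1 =>
      let a := at2 (adj p) in let n1 := no1 p in
      [&& hx, a p0 p1, a p1 p2, a p2 p3, a p3 p4, a p4 p5, a p5 p0,
          at2 n1 p0 p3, at2 n1 p1 p4 & check hx (add_edge p2 p5 p) c1]
  | Helly i j k c1 =>
      let a2 := mul_mx (adj p) (adj p) in
      [&& hx, i < n, j < n, k < n, at2 a2 i j, at2 a2 i k, at2 a2 j k &
        check hx (add_edge i n (add_edge j n (add_edge k n (add_vertices 1 p)))) c1]
  | Claw w c1 =>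
      if claw p is Some (h, x, y, z) then
        let n2 := no2 p in
        [&& at2 n2 w x, at2 n2 w y, at2 n2 w z & check hx (add_edge w h p) c1]
      else false
  end.

(** * Boolean matrices *)

Lemma nth_or_seq r s j : nth false (or_seq r s) j = nth false r j || nth false s j.
Proof.
elim: r s j => [|a r IH] [|b s] j //=; rewrite ?nth_nil ?orbF //.
by case: j => [|j] //=.
Qed.

Lemma at2_or r s i j : at2 (or_mx r s) i j = at2 r i j || at2 s i j.
Proof.
rewrite /at2; elim: r s i => [|a r IH] [|b s] i; rewrite /= ?nth_nil ?orbF //.
by case: i => [|i] /=; rewrite ?nth_or_seq ?IH.
Qed.

Lemma or_rowsP r m j : nth false (or_rows r m) j -> exists2 k, nth false r k & at2 m k j.
Proof.
elim: r m => [|a r IH] [|s m] /=; rewrite ?nth_nil //.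
case: ifPn => a1; rewrite ?nth_or_seq; last by move=> /IH[k rk mk]; exists k.+1.
by case/orP => [sj|/IH[k rk mk]]; [exists 0|exists k.+1].
Qed.

Lemma at2_mul r s i j : at2 (mul_mx r s) i j -> exists2 k, at2 r i k & at2 s k j.
Proof.
rewrite {1}/at2 /mul_mx; have [lt_i|ge_i] := ltnP i (size r).
  by rewrite (nth_map [::]) //; apply: or_rowsP.
by rewrite (nth_default [::]) ?size_map // nth_nil.
Qed.

Lemma at2_mark m i j a b : at2 (mark i j m) a b = (a == i) && (b == j) || at2 m a b.
Proof.
rewrite /at2 /mark nth_set_nth /=; case: eqP => [->|] //=.
by rewrite nth_set_nth /=; case: eqP.
Qed.

Lemma at2_fits n m i j : fits n m -> at2 m i j -> (i < n) && (j < n).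
Proof.
case/andP => sz /allP szr; rewrite /at2.
have [lt_i|ge_i] := ltnP i (size m); last by rewrite (nth_default [::]) // nth_nil.
have [lt_j _|ge_j] := ltnP j (size (nth [::] m i)); last by rewrite nth_default.
by rewrite (leq_trans lt_i sz) (leq_trans lt_j) // szr ?mem_nth.
Qed.

Lemma nth_put v s u : nth false (put v s) u = (u == v) || nth false s u.
Proof. by rewrite /put nth_set_nth /=; case: eqP. Qed.

Lemma meetsP r s : meets r s -> exists2 k, nth false r k & nth false s k.
Proof.
elim: r s => [|a r IH] [|b s] //= /orP[/andP[a1 b1]|/IH[k rk sk]]; first by exists 0.
by exists k.+1.
Qed.

(** * Soundness of the certificate checker *)

Section Soundness.
Variables (T : finType) (e : rel T).
Hypothesis G : dense_c3c5_free e.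

Let eC := adjC G.
Let D := walk2 e.
Let S := walk3 e.

Definition covers (R : rel T) (f : nat -> T) m := forall i j, at2 m i j -> R (f i) (f j).

Definition no (R : rel T) : rel T := fun x y => ~~ R x y.

(* The rule recorded by the field [claw]; it holds when [x], [y] and [z] have pairwise
   disjoint neighbourhoods, all meeting that of [h]. *)
Definition claw_rule h x y z := forall w, ~~ D w x -> ~~ D w y -> ~~ D w z -> e w h.

(** Injectivity is not demanded, so a refuted pattern is refuted together with all its degenerate
    copies. *)
Definition realizes f p :=
  [/\ covers e f (adj p), covers (no D) f (nonD p), covers (no e) f (nonA p),
      covers (no S) f (nonS p) &
      if claw p is Some (h, x, y, z) then claw_rule (f h) (f x) (f y) (f z) else True].

Lemma covers_mul (R1 R2 R : rel T) f m1 m2 :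
    (forall x y z, R1 x y -> R2 y z -> R x z) ->
  covers R1 f m1 -> covers R2 f m2 -> covers R f (mul_mx m1 m2).
Proof. by move=> R12 c1 c2 i j /at2_mul[k /c1 ik /c2 kj]; apply: R12 ik kj. Qed.

Lemma covers_or R f m1 m2 : covers R f m1 -> covers R f m2 -> covers R f (or_mx m1 m2).
Proof. by move=> c1 c2 i j; rewrite at2_or => /orP[/c1|/c2]. Qed.

Lemma covers_mark2 R f i j m :
  symmetric R -> R (f i) (f j) -> covers R f m -> covers R f (mark2 i j m).
Proof.
move=> Rs Rij c a b; rewrite !at2_mark.
by case/or3P => [/andP[/eqP-> /eqP->]|/andP[/eqP-> /eqP->]|/c] //; rewrite Rs.
Qed.

Lemma covers_marks R f s :
  symmetric R -> all (fun q => R (f q.1) (f q.2)) s -> covers R f (marks s).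
Proof.
move=> Rs; elim: s => [|q s IH] /=; first by move=> _ i j; rewrite /at2 !nth_nil.
by case/andP => Rq /IH; apply: covers_mark2.
Qed.

Lemma no2_sound f p : realizes f p -> covers (no D) f (no2 p).
Proof.
case=> cA cD _ cS _; rewrite /no2.
have adj_no : forall x y, e x y -> no D x y.
  by move=> x y xy; apply/negP => /(no_c3 G xy).
do ![apply: covers_or] => //.
- by move=> i j /cA /adj_no.
- have c2 : covers D f (mul_mx (adj p) (adj p)).
    by apply: (covers_mul _ cA cA); apply: walk2I.
  apply: (covers_mul _ c2 cA) => x y z /existsP[a /andP[xa ay]] yz; apply/negP => xz.
  by apply: (no_c5_23 G xz); exact: walk3I xa ay yz.
- apply: (covers_mul _ cA cS) => x y z xy; apply: contra => /existsP[a /andP[xa az]].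
  by apply: (walk3I _ xa az); rewrite eC.
- apply: (covers_mul _ cS cA) => x y z + yz; apply: contra => /existsP[a /andP[xa az]].
  by apply: (walk3I xa az); rewrite eC.
Qed.

Lemma no1_sound f p : realizes f p -> covers (no e) f (no1 p).
Proof.
case=> cA cD cN cS _; rewrite /no1.
have c2 : covers D f (mul_mx (adj p) (adj p)).
  by apply: (covers_mul _ cA cA); apply: walk2I.
do ![apply: covers_or] => //.
- apply: (covers_mul _ c2 c2) => x y z xy yz; apply/negP => /(no_c5 G); apply.
  by apply/existsP; exists y; apply/andP.
- apply: (covers_mul _ cA cD) => x y z xy; apply: contra.
  by apply: walk2I; rewrite eC.
- apply: (covers_mul _ cD cA) => x y z + yz; apply: contra => xz.
  by apply: (walk2I xz); rewrite eC.
- move=> i j /cS; apply: contra => ij; apply: (walk3I ij _ ij); by rewrite eC.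
- move=> i j /at2_mul[k /cA ik /at2_mul[l /cS kl /cA lj]]; apply: contra kl => ij.
  by apply: (walk3I _ ij); rewrite eC.
- apply: (covers_mul _ c2 cS) => x y z /existsP[a /andP[xa ay]]; apply: contra => xz.
  by rewrite eC in xa; rewrite eC in ay; apply: walk3I ay xa xz.
- apply: (covers_mul _ cS c2) => x y z + /existsP[a /andP[ya az]]; apply: contra => xz.
  by rewrite eC in ya; rewrite eC in az; apply: walk3I xz az ya.
Qed.

Definition hexagon_closed := forall p0 p1 p2 p3 p4 p5,
  e p0 p1 -> e p1 p2 -> e p2 p3 -> e p3 p4 -> e p4 p5 -> e p5 p0 ->
  ~~ e p0 p3 -> ~~ e p1 p4 -> e p2 p5.

Definition helly_walk2 := forall x y z,
  D x y -> D x z -> D y z -> exists2 s, e s x & e s y && e s z.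

(** One branch of the search agrees with adjacency to [t]. It is never cut: two neighbours of [t]
    have a common neighbour, so they are not listed in [n2], and the implications hold at [t]. *)
Lemma max_weight_sound n2 imps ws ins outs acc bound (t : T) f :
    covers (no D) f n2 ->
    (forall i j k p q, (i, j, k, p, q) \in imps -> e t (f i) -> e t (f j) -> e t (f k)) ->
    (forall u, nth false ins u -> e t (f u)) ->
    (forall u, nth false outs u -> ~~ e t (f u)) ->
    max_weight n2 imps ws ins outs acc (sumn (map snd ws)) bound ->
  acc + \sum_(q <- ws) q.2 * e t (f q.1) <= bound.
Proof.
move=> cD cimp.
have sum_le ws' : \sum_(q <- ws') q.2 * e t (f q.1) <= sumn (map snd ws').
  by rewrite sumnE big_map leq_sum // => q _; case: (e _ _); rewrite ?muln1 ?muln0.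
have ok ins' outs' : (forall u, nth false ins' u -> e t (f u)) ->
    (forall u, nth false outs' u -> ~~ e t (f u)) -> violated imps ins' outs' = false.
  move=> hin hout; apply/hasP => -[[[[[i j] k] p] q] qin] /and3P[/hin ti /hin tj /hout].
  by rewrite (cimp _ _ _ _ _ qin).
elim: ws ins outs acc => [|[v w] ws IH] ins outs acc hin hout /=.
  by rewrite big_nil; case: ifP.
case: ifPn => [le _|_].
  by apply: leq_trans le; rewrite leq_add2l (sum_le ((v, w) :: ws)).
rewrite big_cons /= -[w + _ - w]/(w + _ - w) addKn; case: (boolP (e t (f v))) => tv.
  have hin' u : nth false (put v ins) u -> e t (f u).
    by rewrite nth_put => /orP[/eqP->|/hin].
  rewrite muln1 addnA ok // orbF => /andP[/orP mw _].
  case: mw => [/meetsP[u /cD /negP n /hin tu]|/IH-> //].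
  by case: n; apply: walk2I tu; rewrite eC.
have hout' u : nth false (put v outs) u -> ~~ e t (f u).
  by rewrite nth_put => /orP[/eqP->|/hout].
by rewrite muln0 add0n (ok ins (put v outs)) //= => /andP[_ /IH->].
Qed.

(** The pairs of a vertex [t] and a pattern vertex adjacent to it are counted by weight in two ways:
    at most [tot %/ 5] for each [t], but more than [#|T| / 5] for each unit of weight. *)
Lemma leaf_sound (hx : bool) f p ws imps :
    (hx -> hexagon_closed) -> realizes f p -> hx || nilp imps -> leaf_ok p ws imps -> False.
Proof.
move=> hex rp hximp /and3P[tot_gt0 imps_ok mw].
have n2ok := no2_sound rp; have n1ok := no1_sound rp; have [cA _ _ _ _] := rp.
have cimp (t : T) i j k p2 p4 : (i, j, k, p2, p4) \in imps ->
    e t (f i) -> e t (f j) -> e t (f k).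
  move=> imp_in; have ne : nilp imps = false by case: (imps) imp_in.
  rewrite ne /= ?orbF in imps_ok hximp; have hexc := hex hximp.
  have /and5P[/cA a1 /cA a2 /cA a3 /cA a4 /andP[/n1ok b1 /n1ok b2]] := allP imps_ok _ imp_in.
  by move=> ti tj; rewrite eC; apply: (hexc _ _ _ _ _ _ a1 a2 a3 a4 _ ti b1 b2); rewrite eC.
set tot := sumn _ in tot_gt0 mw.
have le_t t : \sum_(q <- ws) q.2 * e t (f q.1) <= tot %/ 5.
  rewrite -[X in X <= _]add0n.
  by apply: (max_weight_sound n2ok (cimp t)) mw => u; rewrite nth_nil.
have deg x : \sum_t e t x = #|nb e x|.
  rewrite -sum1_card [RHS]big_mkcond /=; apply: eq_bigr => t _.
  by rewrite inE eC; case: (e _ _).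
have: \sum_t \sum_(q <- ws) q.2 * e t (f q.1) <= #|T| * (tot %/ 5).
  by rewrite -sum_nat_const; apply: leq_sum => t _.
rewrite exchange_big /=.
under eq_bigr => q _ do rewrite -big_distrr /= deg.
have: tot * #|T|.+1 <= \sum_(q <- ws) q.2 * (5 * #|nb e (f q.1)|).
  rewrite /tot sumnE big_map big_distrl /=.
  by apply: leq_sum => q _; rewrite leq_mul2l (deg_gt G) orbT.
under eq_bigr => q _ do rewrite mulnCA.
rewrite -big_distrr /= => lt le.
have := leq_divM tot 5; nia.
Qed.

Definition extend (f : nat -> T) n (v : T) k := if k == n then v else f k.

Lemma realizes_edge f p i j : e (f i) (f j) -> realizes f p -> realizes f (add_edge i j p).
Proof.
by move=> eij [cA cD cN cS cl]; split=> //; apply: covers_mark2.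
Qed.

Lemma realizes_nonD f p i j : ~~ D (f i) (f j) -> realizes f p -> realizes f (add_nonD i j p).
Proof.
move=> nij [cA cD cN cS cl]; split=> //; apply: covers_mark2 => // x y.
by rewrite /no [D _ _](walk2C G).
Qed.

Lemma realizes_extend f g p k : wf p -> (forall i, i < order p -> g i = f i) ->
  realizes f p -> realizes g (add_vertices k p).
Proof.
move=> /and5P[fA fD fN fS fc] gf [cA cD cN cS cl].
have cov R m : fits (order p) m -> covers R f m -> covers R g m.
  by move=> fm c i j mij; case/andP: (at2_fits fm mij) => ip jp; rewrite !gf // c.
split; [exact: cov cA|exact: cov cD|exact: cov cN|exact: cov cS|].
by rewrite /=; case: (claw p) fc cl => [[[[h x] y] z]|] //= /and4P[hp xp yp zp]; rewrite !gf.
Qed.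

Lemma realizes_walk4 f p i j : wf p -> i < order p -> j < order p ->
  walk4 e (f i) (f j) -> realizes f p -> exists g, realizes g (add_walk4 i j p).
Proof.
move=> wfp ip jp /(walk4P e)[a [b [c [xa ab bc cy]]]] rf.
pose n := order p; pose g k := if k == n then a else if k == n.+1 then b else
  if k == n.+2 then c else f k.
have gf k : k < n -> g k = f k by rewrite /g => kn; do !case: eqP => [?|_]; try lia.
exists g; rewrite /add_walk4 -/n.
have gn : g n = a by rewrite /g eqxx.
have gn1 : g n.+1 = b by rewrite /g eqxx; case: eqP => //; lia.
have gn2 : g n.+2 = c by rewrite /g eqxx; do 2!(case: eqP => //; first by lia).
do 4?apply: realizes_edge; rewrite ?gn ?gn1 ?gn2 ?gf //.
exact: realizes_extend rf.
Qed.

Theorem check_sound (hx : bool) p c f :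
  (hx -> hexagon_closed) -> (hx -> helly_walk2) -> check hx p c -> realizes f p -> False.
Proof.
move=> hex helly; elim: c p f => [i j|ws imps|i j c1 IH1 c2 IH2|i j c1 IH1 c2 IH2|i j c1 IH1
    |p0 p1 p2 p3 p4 p5 c1 IH1|i j k c1 IH1|w c1 IH1] p f /= /andP[wfp] ok rf.
- have [cA _ _ _ _] := rf.
  case/orP: ok => /andP[].
    by move=> /cA eij /(no1_sound rf); rewrite /no eij.
  by move=> /(covers_mul (@walk2I _ e) cA cA) Dij /(no2_sound rf); rewrite /no [D _ _]Dij.
- by case/andP: ok; apply: leaf_sound rf.
- case/and4P: ok => ip jp ok1 ok2; case: (boolP (D (f i) (f j))) => [|nij]; last first.
    exact: IH2 ok2 (realizes_nonD nij rf).
  case/existsP => z /andP[iz zj]; pose g := extend f (order p) z.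
  have gf k : k < order p -> g k = f k by rewrite /g /extend; case: eqP => // ->; rewrite ltnn.
  have gn : g (order p) = z by rewrite /g /extend eqxx.
  apply: (IH1 _ g ok1); do 2?apply: realizes_edge; rewrite ?gn ?gf //; first by rewrite eC.
  exact: realizes_extend rf.
- case/and4P: ok => ip jp ok1 ok2; case: (boolP (e (f i) (f j))) => [eij|/(walk4_nonadj G) w].
    exact: IH1 ok1 (realizes_edge eij rf).
  by have [g /IH2] := realizes_walk4 wfp ip jp w rf; apply.
- case/and4P: ok => ip jp /(no1_sound rf)/(walk4_nonadj G) w ok1.
  by have [g /IH1] := realizes_walk4 wfp ip jp w rf; apply.
- have [cA _ _ _ _] := rf; have n1 := no1_sound rf.
  case/andP: ok => /hex hexc /and5P[/cA a1 /cA a2 /cA a3 /cA a4].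
  case/and5P => [/cA a5 /cA a6 /n1 b1 /n1 b2 ok1].
  exact: IH1 ok1 (realizes_edge (hexc _ _ _ _ _ _ a1 a2 a3 a4 a5 a6 b1 b2) rf).
- have [cA _ _ _ _] := rf; have c2 := covers_mul (@walk2I _ e) cA cA.
  case/andP: ok => /helly hel /and5P[ip jp kp /c2 ij /and3P[/c2 ik /c2 jk ok1]].
  have [z zi /andP[zj zk]] := hel _ _ _ ij ik jk.
  pose g := extend f (order p) z.
  have gf l : l < order p -> g l = f l by rewrite /g /extend; case: eqP => // ->; rewrite ltnn.
  have gn : g (order p) = z by rewrite /g /extend eqxx.
  apply: (IH1 _ g ok1); do 3?apply: realizes_edge; rewrite ?gn ?gf // 1?eC //.
  exact: realizes_extend rf.
- have [_ _ _ _ cl] := rf; have n2 := no2_sound rf.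
  case: (claw p) ok cl => [[[[h x] y] z]|] // /and4P[/n2 wx /n2 wy /n2 wz ok1] cl.
  exact: IH1 ok1 (realizes_edge (cl _ wx wy wz) rf).
Qed.

End Soundness.

(** * Certified configurations *)

(* The case trees and weights were found by a search guided by linear programming. *)

Definition pat_hexagon := mk_pattern 6
  [::(0, 1); (1, 2); (2, 3); (3, 4); (4, 5); (5, 0)]
  [::]
  [::(0, 3); (1, 4); (2, 5)]
  [::]
  None.

Definition cert_hexagon :=
  (Walk 2 5 (Walk 1 4 (SplitD 7 10 (Leaf [::(1,1); (2,1); (4,1); (5,1); (6,1); (7,1); (8,1);
  (9,1); (10,1); (11,1)] [::]) (SplitD 6 11 (SplitD 8 9 (Leaf [::(1,1); (2,1); (4,1); (5,1);
  (6,1); (7,1); (8,1); (9,1); (10,1); (11,1)] [::]) (Leaf [::(0,1); (1,1); (5,1); (6,1); (7,1);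
  (8,1); (9,1); (10,1); (11,1); (12,1)] [::])) (SplitD 8 9 (Leaf [::(2,1); (3,1); (4,1); (6,1);
  (7,1); (8,1); (9,1); (10,1); (11,1); (12,1)] [::]) (Walk 0 3 (SplitD 10 13 (Leaf [::(0,1);
  (1,1); (3,1); (4,1); (9,1); (10,1); (11,1); (12,1); (13,1); (14,1)] [::]) (SplitD 7 13 (Leaf
  [::(0,1); (2,1); (3,1); (5,1); (6,1); (7,1); (8,1); (12,1); (13,1); (14,1)] [::]) (SplitD 11 12
  (SplitD 9 14 (Leaf [::(0,1); (1,1); (3,1); (4,1); (9,1); (10,1); (11,1); (12,1); (13,1); (14,1)]
  [::]) (Leaf [::(1,1); (2,1); (3,1); (9,1); (10,1); (11,1); (12,1); (13,1); (14,1); (15,1)]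
  [::])) (SplitD 9 14 (Leaf [::(0,1); (4,1); (5,1); (9,1); (10,1); (11,1); (12,1); (13,1); (14,1);
  (15,1)] [::]) (SplitD 8 14 (SplitD 7 12 (Leaf [::(0,1); (1,1); (2,1); (6,1); (7,1); (8,1);
  (12,1); (13,1); (14,1); (15,1)] [::]) (SplitD 6 13 (Leaf [::(0,1); (1,1); (2,1); (6,1); (7,1);
  (8,1); (12,1); (13,1); (14,1); (15,1)] [::]) (Leaf [::(0,1); (2,1); (3,1); (5,1); (6,1); (7,1);
  (8,1); (12,1); (13,1); (14,1)] [::]))) (SplitD 7 12 (Leaf [::(0,1); (1,1); (2,1); (3,1); (4,1);
  (5,1); (6,1); (7,1); (8,1); (9,1); (10,1); (11,1); (12,1); (13,1); (14,1)] [::]) (SplitD 6 13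
  (Leaf [::(0,1); (1,1); (2,1); (3,1); (4,1); (5,1); (6,1); (7,1); (8,1); (9,1); (10,1); (11,1);
  (12,1); (13,1); (14,1)] [::]) (Leaf [::(3,1); (4,1); (5,1); (6,1); (7,1); (8,1); (9,1); (12,1);
  (13,1); (14,1)] [::])))))))))))))).

Lemma check_hexagon : check false pat_hexagon cert_hexagon.
Proof. by lazy. Qed.

Definition pat_claw_rule := mk_pattern 11
  [::(0, 1); (1, 2); (2, 3); (3, 4); (4, 8); (8, 5); (4, 9); (9, 6); (4, 10); (10, 7)]
  [::(0, 5); (0, 6); (0, 7); (5, 6); (5, 7); (6, 7)]
  [::]
  [::]
  None.

Definition cert_claw_rule :=
  (Leaf [::(0,1); (3,1); (5,1); (6,1); (7,1)] [::]).

Lemma check_claw_rule : check true pat_claw_rule cert_claw_rule.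
Proof. by lazy. Qed.

Definition pat_cross := mk_pattern 9
  [::(0, 1); (0, 2); (0, 3); (0, 4); (5, 1); (5, 2); (6, 2); (6, 3); (7, 3); (7, 4); (8, 4); (8,
    1)]
  [::]
  [::(5, 3); (5, 4); (6, 1); (6, 4); (7, 1); (7, 2); (8, 2); (8, 3)]
  [::]
  None.

Definition cert_cross :=
  (Walk 4 6 (Walk 3 5 (Walk 2 7 (SplitD 10 16 (Leaf [::(2,1); (4,1); (6,1); (7,1); (9,1); (10,1);
  (11,1); (15,1); (16,1); (17,1)] [::]) (SplitD 5 17 (SplitD 11 17 (Leaf [::(2,1); (4,1); (5,1);
  (6,1); (7,1); (8,1); (10,1); (11,1); (17,1); (18,1); (0,0)] [::(6,8,7,3,4); (6,8,5,2,1);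
  (5,6,0,1,3)]) (SplitD 8 11 (Leaf [::(1,1); (3,1); (5,1); (6,1); (7,1); (8,1); (10,1); (11,1);
  (16,1); (17,1); (0,0)] [::(8,16,7,4,17); (7,8,0,3,1); (5,10,6,2,11); (5,6,0,1,3)]) (Leaf
  [::(1,1); (6,1); (8,1); (11,1); (17,1); (3,0); (4,0); (5,0); (7,0)] [::(6,8,7,3,4); (6,8,5,2,1);
  (1,11,3,0,6); (1,3,4,8,7)]))) (SplitD 11 16 (Leaf [::(1,1); (5,1); (11,1); (12,1); (17,1);
  (2,0); (3,0); (4,0)] [::(1,17,3,0,7); (1,11,3,0,6); (1,3,4,8,7); (1,3,2,5,6)]) (SplitD 10 17
  (Leaf [::(1,1); (5,1); (11,1); (12,1); (17,1); (2,0); (3,0); (4,0)] [::(1,17,3,0,7);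
  (1,11,3,0,6); (1,3,4,8,7); (1,3,2,5,6)]) (SplitD 7 14 (Leaf [::(2,1); (4,1); (5,1); (6,1);
  (7,1); (8,1); (10,1); (11,1); (16,1); (17,1); (0,0)] [::(7,8,0,3,1); (6,8,7,3,4); (6,8,5,2,1);
  (5,6,0,1,3)]) (SplitD 5 10 (Leaf [::(1,1); (4,1); (5,1); (7,1); (10,1); (11,1); (12,1); (14,1);
  (15,1); (17,1); (0,0); (2,0); (3,0); (6,0)] [::(12,15,0,3,2); (11,17,3,6,7); (10,15,6,11,2);
  (5,6,0,1,3); (4,14,2,0,5); (2,4,3,6,7); (1,17,3,0,7); (1,11,3,0,6); (1,3,2,5,6)]) (SplitD 4 13
  (Leaf [::(2,1); (5,1); (10,1); (17,1); (18,1)] [::]) (Leaf [::(4,2); (2,1); (5,1); (6,1); (7,1);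
  (9,1); (10,1); (11,1); (12,1); (13,1); (14,1); (15,1); (16,1); (17,1); (0,0); (3,0)]
  [::(12,15,0,3,2); (9,12,0,4,3); (5,9,0,2,4); (4,14,2,0,5); (2,4,3,6,7)]))))))))))).

Lemma check_cross : check true pat_cross cert_cross.
Proof. by lazy. Qed.

Definition pat_spider_D3 := mk_pattern 8
  [::(0, 1); (0, 2); (0, 3); (1, 4); (2, 5); (3, 6); (7, 0); (7, 4); (7, 5); (7, 6)]
  [::]
  [::(4, 2); (4, 3); (5, 1); (5, 3); (6, 1); (6, 2)]
  [::]
  None.

Definition cert_spider_D3 :=
  (Walk 3 5 (Walk 1 6 (Walk 2 4 (SplitD 10 16 (SplitD 9 12 (Leaf [::(2,1); (6,1); (9,1); (11,1);
  (16,1)] [::]) (SplitD 1 9 (Leaf [::(2,1); (6,1); (9,1); (11,1); (16,1)] [::]) (SplitD 11 14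
  (SplitD 6 14 (Hexa 7 6 19 14 2 5 (Leaf [::(1,1); (2,1); (3,1); (4,1); (5,1); (6,1); (8,1);
  (9,1); (10,1); (11,1); (12,1); (13,1); (14,1); (15,1); (16,1); (0,0); (7,0); (19,0)]
  [::(13,15,19,6,14); (12,16,1,11,4); (5,11,0,7,1); (2,3,7,5,6); (1,10,2,0,5); (1,2,7,4,5)]))
  (SplitD 9 15 (Leaf [::(2,1); (3,1); (5,1); (6,1); (9,1); (10,1); (11,1); (14,1); (15,1); (16,1);
  (0,0); (4,0); (7,0)] [::(5,11,4,7,1); (4,5,0,1,2); (3,15,2,0,14); (2,3,7,5,6)]) (SplitD 8 16
  (Leaf [::(6,2); (15,2); (1,1); (3,1); (9,1); (10,1); (11,1); (14,1); (16,1); (0,0); (2,0);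
  (4,0); (5,0); (7,0)] [::(9,14,5,10,2); (6,15,4,7,16); (5,11,0,7,1); (4,6,0,1,3); (3,15,2,0,14);
  (2,3,7,5,6); (1,10,2,0,5)]) (SplitD 8 14 (Leaf [::(15,12); (9,11); (10,10); (14,10); (16,8);
  (3,7); (5,7); (8,7); (4,6); (2,5); (6,5); (1,3); (11,1); (12,1); (0,0); (7,0)]
  [::(12,16,1,11,4); (5,11,0,7,1); (4,6,0,1,3); (4,5,0,1,2); (3,15,2,0,14); (2,3,7,5,6);
  (1,10,2,0,5); (1,2,7,4,5)]) (SplitD 6 17 (Leaf [::(0,1); (2,1); (3,1); (8,1); (9,1); (10,1);
  (14,1); (15,1); (16,1); (17,1); (7,0)] [::(2,3,7,5,6)]) (Leaf [::(6,2); (15,2); (1,1); (3,1);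
  (9,1); (10,1); (11,1); (14,1); (16,1); (0,0); (2,0); (4,0); (5,0); (7,0)] [::(9,14,5,10,2);
  (7,16,10,5,17); (6,15,4,7,16); (5,11,0,7,1); (4,6,0,1,3); (3,15,2,0,14); (2,3,7,5,6);
  (1,10,2,0,5); (1,3,7,4,6)])))))) (SplitD 12 15 (Leaf [::(0,1); (2,1); (9,1); (12,1); (16,1);
  (1,0); (7,0)] [::(2,12,1,0,11); (1,2,7,4,5)]) (SplitD 9 14 (Leaf [::(0,1); (7,1); (9,1); (12,1);
  (15,1)] [::]) (SplitD 1 10 (Helly 1 10 16 (Leaf [::(3,1); (6,1); (10,1); (11,1); (14,1); (0,0);
  (5,0); (19,0)] [::(6,14,5,7,2); (5,6,0,2,3); (0,5,19,1,10)])) (Leaf [::(1,1); (4,1); (9,1);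
  (10,1); (14,1); (0,0); (5,0)] [::(4,9,5,7,10); (4,5,0,1,2)]))))))) (SplitD 8 16 (SplitD 10 11
  (Leaf [::(2,1); (6,1); (9,1); (11,1); (16,1)] [::]) (Leaf [::(3,1); (6,1); (10,1); (11,1);
  (16,1)] [::])) (SplitD 10 12 (SplitD 3 15 (Leaf [::(3,1); (6,1); (10,1); (11,1); (16,1)] [::])
  (SplitD 9 15 (Leaf [::(2,1); (3,1); (4,1); (5,1); (8,1); (9,1); (10,1); (14,1); (15,1); (16,1);
  (0,0)] [::(4,9,5,7,10); (4,5,0,1,2)]) (SplitD 12 16 (Leaf [::(0,1); (7,1); (9,1); (12,1);
  (15,1)] [::]) (SplitD 11 15 (Leaf [::(0,1); (7,1); (9,1); (12,1); (15,1)] [::]) (SplitD 2 12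
  (Helly 1 2 12 (Leaf [::(3,1); (6,1); (10,1); (16,1); (19,1); (1,0); (2,0); (7,0)]
  [::(3,16,1,0,4); (1,7,2,19,5); (1,3,7,4,6)])) (SplitD 6 14 (Leaf [::(1,1); (2,1); (4,1); (6,1);
  (11,1); (12,1); (13,1); (14,1); (15,1); (16,1); (5,0); (7,0)] [::(6,14,5,7,2); (2,13,7,0,6)])
  (SplitD 11 14 (Hexa 1 11 18 14 2 0 (Leaf [::(1,3); (13,3); (14,3); (4,2); (6,2); (12,2); (15,2);
  (2,1); (3,1); (5,1); (8,1); (9,1); (10,1); (11,1); (16,1); (0,0); (7,0); (18,0)]
  [::(13,14,11,12,18); (12,15,18,11,14); (11,14,0,1,2); (4,6,0,1,3); (3,16,1,0,4); (2,13,3,0,6);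
  (1,10,2,0,5); (1,3,7,4,6)])) (Leaf [::(3,1); (6,1); (10,1); (11,1); (14,1)] [::])))))))) (SplitD
  13 14 (Leaf [::(3,1); (4,1); (10,1); (12,1); (14,1)] [::]) (SplitD 12 15 (Leaf [::(3,1); (4,1);
  (10,1); (12,1); (14,1)] [::]) (SplitD 11 14 (Leaf [::(3,1); (4,1); (10,1); (12,1); (14,1)] [::])
  (SplitD 13 16 (SplitD 8 12 (Leaf [::(1,1); (2,1); (3,1); (4,1); (5,1); (6,1); (8,1); (9,1);
  (10,1); (11,1); (12,1); (13,1); (14,1); (15,1); (16,1); (0,0); (7,0)] [::(6,14,0,7,2);
  (4,9,5,7,10); (4,6,0,1,3); (4,5,0,1,2); (3,16,1,0,4); (1,3,7,4,6)]) (SplitD 6 15 (Leaf [::(0,1);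
  (1,1); (2,1); (6,1); (11,1); (12,1); (13,1); (14,1); (15,1); (16,1); (7,0)] [::(1,2,7,4,5)])
  (Leaf [::(1,1); (2,1); (6,1); (8,1); (11,1); (12,1); (13,1); (14,1); (15,1); (16,1); (0,0);
  (4,0); (5,0); (7,0)] [::(11,15,4,1,16); (6,14,5,7,2); (5,6,0,2,3); (4,8,0,7,3); (1,2,7,4,5)])))
  (SplitD 2 13 (Hexa 0 2 17 13 6 3 (SplitD 1 10 (Hexa 0 1 18 10 5 2 (Leaf [::(3,1); (6,1); (10,1);
  (11,1); (16,1); (1,0); (2,0)] [::(3,16,1,0,4); (1,3,2,18,17)])) (SplitD 10 13 (Helly 2 10 13
  (Hexa 0 2 19 13 6 3 (Contra 3 8))) (Leaf [::(1,1); (4,1); (10,1); (13,1); (14,1)] [::])))) (Leaf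
  [::(2,1); (5,1); (8,1); (13,1); (16,1)] [::])))))))))))).

Lemma check_spider_D3 : check true pat_spider_D3 cert_spider_D3.
Proof. by lazy. Qed.

Definition pat_spider_D2 := mk_pattern 9
  [::(0, 1); (0, 2); (0, 3); (1, 4); (2, 5); (3, 6); (7, 0); (7, 4); (7, 5); (8, 0); (8, 5); (8,
    6)]
  [::(4, 6)]
  [::(4, 2); (4, 3); (5, 1); (5, 3); (6, 1); (6, 2)]
  [::]
  None.

Definition cert_spider_D2 :=
  (Walk 3 5 (Walk 6 7 (Walk 1 5 (SplitD 12 15 (SplitD 3 16 (Leaf [::(3,1); (4,1); (5,1); (6,1);
  (7,1); (12,1); (16,1); (17,1); (18,1); (19,1); (0,0)] [::(5,18,6,8,12); (5,6,0,2,3)]) (SplitD 14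
  16 (Leaf [::(0,1); (1,1); (3,1); (6,1); (11,1); (12,1); (13,1); (14,1); (15,1); (16,1); (8,0)]
  [::(11,12,8,5,6); (1,11,8,0,5)]) (SplitD 13 17 (Leaf [::(3,1); (4,1); (6,1); (11,1); (16,1);
  (0,0); (5,0)] [::(6,16,5,8,17); (5,6,0,2,3)]) (SplitD 9 17 (Leaf [::(3,1); (6,1); (14,1);
  (16,1); (17,1); (0,0); (5,0)] [::(6,16,5,8,17); (5,6,0,2,3)]) (SplitD 10 15 (Leaf [::(0,1);
  (1,1); (3,1); (5,1); (9,1); (10,1); (11,1); (15,1); (16,1); (17,1)] [::]) (SplitD 1 11 (Leaf
  [::(1,1); (3,1); (4,1); (5,1); (6,1); (10,1); (11,1); (15,1); (17,1); (18,1); (0,0); (8,0)]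
  [::(5,18,6,8,12); (5,6,0,2,3); (4,5,0,1,2); (1,11,8,0,5)]) (SplitD 9 16 (Leaf [::(0,1); (1,1);
  (5,1); (7,1); (9,1); (10,1); (11,1); (12,1); (15,1); (16,1); (8,0)] [::(11,12,8,5,6)]) (SplitD 9
  13 (Leaf [::(0,1); (1,1); (2,1); (3,1); (5,1); (6,1); (9,1); (10,1); (11,1); (12,1); (13,1);
  (14,1); (15,1); (16,1); (17,1); (7,0); (8,0)] [::(11,12,8,5,6); (3,17,7,0,5); (2,12,3,0,6)])
  (SplitD 11 12 (Leaf [::(3,1); (4,1); (5,1); (6,1); (7,1); (9,1); (10,1); (11,1); (12,1); (13,1);
  (0,0)] [::(4,5,0,1,2)]) (Leaf [::(1,1); (3,1); (5,1); (6,1); (9,1); (11,1); (12,1); (14,1);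
  (16,1); (17,1); (0,0); (7,0)] [::(5,6,0,2,3); (3,17,7,0,5)])))))))))) (SplitD 10 15 (Leaf
  [::(1,1); (5,1); (9,1); (12,1); (15,1); (7,0); (8,0)] [::(1,12,8,0,6); (1,8,7,4,5)]) (SplitD 9
  16 (Leaf [::(5,1); (7,1); (9,1); (12,1); (15,1)] [::]) (SplitD 11 12 (Leaf [::(3,1); (4,1);
  (5,1); (6,1); (7,1); (10,1); (11,1); (12,1); (13,1); (15,1); (0,0)] [::(6,15,0,8,1);
  (4,5,0,1,2)]) (SplitD 3 17 (Leaf [::(1,1); (3,1); (4,1); (5,1); (6,1); (9,1); (11,1); (12,1);
  (16,1); (17,1); (0,0); (7,0); (8,0)] [::(5,6,0,2,3); (3,17,7,0,5); (1,12,8,0,6); (1,8,7,4,5)])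
  (SplitD 13 16 (Leaf [::(3,1); (5,1); (6,1); (7,1); (12,1); (13,1); (14,1); (15,1); (16,1);
  (17,1); (0,0)] [::(6,16,5,8,17); (5,6,0,2,3)]) (SplitD 12 17 (Leaf [::(3,1); (4,1); (5,1);
  (6,1); (7,1); (12,1); (13,1); (15,1); (16,1); (17,1); (0,0)] [::(6,15,0,8,1); (5,6,0,2,3)])
  (SplitD 1 13 (Leaf [::(1,1); (4,1); (5,1); (6,1); (8,1); (12,1); (13,1); (15,1); (16,1); (17,1);
  (0,0)] [::(5,6,0,2,3)]) (SplitD 4 12 (Hexa 4 7 14 13 12 18 (Leaf [::(1,1); (4,1); (5,1); (6,1);
  (8,1); (12,1); (15,1); (16,1); (17,1); (18,1); (0,0); (7,0)] [::(6,16,5,8,17); (5,6,0,2,3);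
  (1,18,7,0,14)])) (Leaf [::(1,1); (4,1); (6,1); (12,1); (17,1); (7,0); (8,0)] [::(1,12,8,0,6);
  (1,8,7,4,5)]))))))))))))).

Lemma check_spider_D2 : check true pat_spider_D2 cert_spider_D2.
Proof. by lazy. Qed.

Definition pat_spider_D1 := mk_pattern 8
  [::(0, 1); (0, 2); (0, 3); (0, 4); (5, 1); (5, 3); (6, 2); (6, 3); (7, 4)]
  [::(7, 5); (7, 6)]
  [::(5, 2); (6, 1); (5, 4); (6, 4)]
  [::]
  None.

Definition cert_spider_D1 :=
  (Walk 4 6 (Walk 2 5 (Walk 4 5 (Walk 1 6 (SplitD 12 18 (Leaf [::(1,1); (2,1); (5,1); (6,1);
  (11,1); (12,1); (13,1); (17,1); (18,1); (19,1)] [::]) (SplitD 9 17 (SplitD 8 18 (Leaf [::(0,1);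
  (1,1); (4,1); (6,1); (8,1); (9,1); (10,1); (17,1); (18,1); (19,1)] [::]) (SplitD 4 19 (Leaf
  [::(0,1); (1,1); (4,1); (6,1); (8,1); (9,1); (10,1); (17,1); (18,1); (19,1)] [::]) (Leaf
  [::(0,1); (2,1); (4,1); (6,1); (8,1); (9,1); (13,1); (17,1); (18,1); (19,1); (3,0)]
  [::(13,19,3,5,6); (4,13,3,0,5)]))) (SplitD 9 16 (SplitD 10 14 (Leaf [::(0,1); (3,1); (4,1);
  (6,1); (9,1); (10,1); (14,1); (15,1); (16,1); (20,1)] [::]) (Leaf [::(3,1); (4,1); (5,1); (6,1);
  (8,1); (9,1); (10,1); (14,1); (15,1); (16,1); (0,0)] [::(5,6,0,1,2)])) (SplitD 2 16 (Hexa 0 2 20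
  16 5 1 (SplitD 13 19 (Leaf [::(0,1); (1,1); (2,1); (12,1); (13,1); (14,1); (15,1); (18,1);
  (19,1); (20,1); (3,0)] [::(13,19,3,5,6)]) (SplitD 12 14 (Leaf [::(0,1); (2,1); (4,1); (5,1);
  (11,1); (12,1); (13,1); (14,1); (15,1); (16,1)] [::]) (SplitD 11 17 (Leaf [::(3,1); (5,1);
  (6,1); (11,1); (12,1); (13,1); (17,1); (18,1); (19,1); (21,1)] [::]) (SplitD 11 15 (Leaf
  [::(0,1); (1,1); (3,1); (5,1); (11,1); (12,1); (14,1); (15,1); (18,1); (19,1); (20,0)]
  [::(11,15,20,2,16)]) (SplitD 10 15 (Leaf [::(4,1); (5,1); (10,1); (11,1); (16,1)] [::]) (SplitD
  4 18 (Leaf [::(3,1); (12,1); (14,1); (18,1); (20,1)] [::]) (SplitD 14 19 (Leaf [::(3,1); (12,1);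
  (14,1); (18,1); (20,1)] [::]) (SplitD 7 12 (Leaf [::(4,2); (0,1); (1,1); (2,1); (5,1); (6,1);
  (7,1); (9,1); (10,1); (11,1); (12,1); (13,1); (14,1); (15,1); (16,1); (17,1); (18,1); (19,1);
  (20,1); (3,0)] [::(7,17,0,4,1); (5,6,0,1,2); (4,13,3,0,5)]) (SplitD 7 19 (Leaf [::(1,1); (3,1);
  (5,1); (7,1); (12,1); (14,1); (18,1); (19,1); (20,1); (21,1); (0,0); (4,0); (6,0)]
  [::(5,21,6,3,19); (5,6,0,1,2); (1,21,4,0,7)]) (SplitD 1 9 (Leaf [::(0,1); (1,1); (2,1); (4,1);
  (5,1); (6,1); (7,1); (9,1); (10,1); (11,1); (13,1); (15,1); (16,1); (17,1); (19,1); (3,0)]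
  [::(10,13,3,6,5); (4,13,3,0,5); (2,16,1,0,5)]) (SplitD 10 12 (Leaf [::(1,1); (5,1); (9,1);
  (14,1); (19,1); (0,0); (6,0)] [::(5,9,6,3,10); (5,6,0,1,2)]) (SplitD 9 12 (Leaf [::(1,1); (4,1);
  (5,1); (6,1); (7,1); (9,1); (11,1); (16,1); (17,1); (19,1); (0,0)] [::(5,6,0,1,2)]) (Leaf
  [::(0,1); (1,1); (4,1); (5,1); (9,1); (10,1); (12,1); (14,1); (18,1); (19,1); (3,0)]
  [::(4,19,3,0,6)])))))))))))))) (SplitD 10 15 (SplitD 8 16 (Leaf [::(0,1); (3,1); (4,1); (5,1);
  (8,1); (9,1); (10,1); (15,1); (16,1); (20,1)] [::]) (Leaf [::(3,1); (4,1); (5,1); (6,1); (8,1);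
  (9,1); (10,1); (14,1); (15,1); (16,1); (0,0)] [::(5,6,0,1,2)])) (SplitD 16 19 (Hexa 5 16 20 19 6
  3 (SplitD 11 17 (Leaf [::(1,1); (2,1); (5,1); (6,1); (11,1); (12,1); (16,1); (17,1); (18,1);
  (19,1); (3,0)] [::(2,19,3,0,20)]) (SplitD 11 16 (Leaf [::(0,1); (1,1); (2,1); (11,1); (12,1);
  (16,1); (17,1); (18,1); (19,1); (20,1); (3,0)] [::(12,19,2,11,6); (2,19,3,0,20)]) (Leaf
  [::(4,1); (11,1); (16,1); (17,1); (20,1); (0,0); (5,0)] [::(11,20,0,2,3); (0,20,5,1,16)]))))
  (SplitD 1 10 (Hexa 0 1 20 10 6 2 (SplitD 10 12 (Leaf [::(4,1); (6,1); (10,1); (16,1); (17,1);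
  (1,0); (2,0)] [::(10,16,1,20,5); (1,10,2,0,6)]) (SplitD 9 12 (Leaf [::(1,1); (4,1); (5,1);
  (6,1); (9,1); (10,1); (11,1); (16,1); (17,1); (19,1); (0,0); (2,0)] [::(5,6,0,1,2);
  (1,10,2,0,6)]) (Leaf [::(0,1); (1,1); (4,1); (5,1); (9,1); (10,1); (11,1); (12,1); (16,1);
  (19,1); (2,0); (3,0)] [::(4,19,3,0,6); (1,10,2,0,6)])))) (SplitD 7 16 (SplitD 17 20 (Leaf
  [::(0,1); (1,1); (2,1); (6,1); (7,1); (9,1); (10,1); (15,1); (16,1); (17,1); (3,0); (5,0)]
  [::(10,16,3,6,5); (6,15,5,3,16); (5,6,0,1,2)]) (SplitD 11 20 (Leaf [::(2,1); (6,1); (13,1);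
  (17,1); (20,1); (0,0); (5,0)] [::(6,20,5,3,16); (5,6,0,1,2)]) (SplitD 8 11 (Leaf [::(1,1);
  (2,1); (5,1); (6,1); (9,1); (11,1); (16,1); (17,1); (19,1); (20,1); (0,0); (3,0); (4,0)]
  [::(6,20,5,3,16); (5,9,6,3,10); (5,6,0,1,2); (4,19,3,0,6); (2,20,4,0,7)]) (SplitD 6 14 (Leaf
  [::(1,1); (2,1); (5,1); (6,1); (9,1); (10,1); (14,1); (16,1); (17,1); (20,1); (0,0); (4,0)]
  [::(6,20,5,3,16); (5,9,6,3,10); (5,6,0,1,2); (2,20,4,0,7)]) (SplitD 11 14 (Hexa 2 11 21 14 4 0
  (Leaf [::(1,1); (2,1); (5,1); (6,1); (9,1); (11,1); (14,1); (16,1); (19,1); (20,1); (0,0);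
  (3,0); (4,0)] [::(11,14,0,2,4); (6,20,5,3,16); (6,11,0,3,21); (5,9,6,3,10); (5,6,0,1,2);
  (4,19,3,0,6); (2,20,4,0,7)])) (Leaf [::(0,1); (1,1); (2,1); (5,1); (9,1); (11,1); (14,1);
  (16,1); (19,1); (20,1); (3,0); (4,0); (6,0)] [::(5,9,6,3,10); (5,6,0,1,2); (4,19,3,0,6);
  (2,20,4,0,7)])))))) (Leaf [::(2,1); (5,1); (7,1); (9,1); (16,1); (0,0); (6,0)] [::(5,9,6,3,10);
  (5,6,0,1,2)]))))))))))))).

Lemma check_spider_D1 : check true pat_spider_D1 cert_spider_D1.
Proof. by lazy. Qed.

Definition pat_spider_t := mk_pattern 10
  [::(0, 1); (0, 2); (0, 3); (1, 4); (2, 5); (3, 6); (4, 7); (7, 8); (8, 5); (8, 9); (9, 6)]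
  [::(4, 5); (4, 6); (5, 6)]
  [::(4, 2); (4, 3); (5, 1); (5, 3); (6, 1); (6, 2)]
  [::]
  (Some (0, 4, 5, 6)).

Definition cert_spider_t :=
  (Walk 6 7 (SplitD 2 11 (Leaf [::(0,1); (2,1); (3,1); (4,1); (5,1); (6,1); (7,1); (8,1); (10,1);
  (11,1)] [::]) (Walk 4 9 (SplitD 11 13 (SplitD 5 10 (SplitD 4 10 (Leaf [::(0,1); (2,1); (3,1);
  (4,1); (5,1); (6,1); (7,1); (8,1); (10,1); (18,1)] [::]) (Leaf [::(2,1); (4,1); (6,1); (7,1);
  (10,1)] [::])) (SplitD 1 11 (Leaf [::(0,1); (1,1); (2,1); (4,1); (5,1); (6,1); (8,1); (9,1);
  (10,1); (11,1)] [::]) (Helly 4 12 16 (Helly 7 11 13 (SplitD 0 18 (Leaf [::(0,1); (2,1); (5,1);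
  (6,1); (8,1); (9,1); (10,1); (11,1); (18,1); (19,1)] [::]) (SplitD 2 13 (Hexa 0 2 19 13 4 1
  (SplitD 9 19 (Leaf [::(0,1); (1,1); (3,1); (7,1); (8,1); (9,1); (11,1); (18,1); (19,1); (20,1)]
  [::(3,7,9,6,8); (3,7,1,0,4)]) (Leaf [::(1,1); (8,1); (9,1); (11,1); (19,1); (7,0); (13,0)]
  [::(1,9,7,4,8); (1,7,13,19,18)]))) (SplitD 4 10 (Leaf [::(0,1); (1,1); (2,1); (4,1); (5,1);
  (6,1); (8,1); (9,1); (10,1); (13,1)] [::]) (SplitD 0 14 (Claw 10 (Leaf [::(0,1); (1,1); (7,1);
  (8,1); (9,1); (10,1); (11,1); (14,1); (15,1); (18,1)] [::(1,9,7,4,8); (1,9,10,0,6)])) (SplitD 5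
  14 (Leaf [::(0,1); (2,1); (4,1); (5,1); (6,1); (7,1); (8,1); (10,1); (13,1); (14,1)] [::]) (Leaf
  [::(0,1); (1,1); (2,1); (4,1); (5,1); (6,1); (8,1); (9,1); (13,1); (14,1)] [::]))))))))))
  (SplitD 0 12 (Leaf [::(0,1); (8,1); (9,1); (11,1); (13,1)] [::]) (Walk 12 13 (SplitD 2 13
  (SplitD 6 13 (Leaf [::(0,1); (2,1); (3,1); (4,1); (5,1); (6,1); (7,1); (8,1); (13,1); (20,1)]
  [::]) (Claw 13 (SplitD 12 14 (Leaf [::(0,1); (3,1); (7,1); (8,1); (9,1); (11,1); (12,1); (13,1);
  (14,1); (15,1)] [::(3,7,9,6,8); (3,7,13,0,4)]) (SplitD 11 15 (Leaf [::(0,1); (3,1); (7,1);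
  (8,1); (9,1); (11,1); (12,1); (13,1); (14,1); (15,1)] [::(3,7,9,6,8); (3,7,13,0,4)]) (Leaf
  [::(3,1); (4,1); (6,1); (7,1); (9,1); (11,1); (12,1); (13,1); (14,1); (15,1)] [::(3,7,9,6,8);
  (3,7,13,0,4)]))))) (Leaf [::(2,1); (4,1); (9,1); (11,1); (13,1)] [::])))))))).

Lemma check_spider_t : check true pat_spider_t cert_spider_t.
Proof. by lazy. Qed.

Definition pat_spider_D0 := mk_pattern 11
  [::(0, 1); (0, 2); (0, 3); (1, 4); (2, 5); (3, 6); (4, 7); (7, 8); (8, 5); (5, 9); (9, 10); (10,
    6)]
  [::(4, 5); (4, 6); (5, 6); (8, 6); (9, 4)]
  [::(4, 2); (4, 3); (5, 1); (5, 3); (6, 1); (6, 2)]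
  [::]
  (Some (0, 4, 5, 6)).

Definition cert_spider_D0 :=
  (Walk 8 10 (Walk 4 10 (SplitD 7 10 (Hexa 7 8 5 9 10 17 (SplitD 3 11 (Leaf [::(2,1); (4,1);
  (6,1); (10,1); (11,1)] [::]) (SplitD 1 11 (Leaf [::(0,1); (1,1); (3,1); (4,1); (5,1); (6,1);
  (8,1); (9,1); (10,1); (11,1); (7,0)] [::(7,10,5,8,9); (1,10,7,4,17)]) (SplitD 1 9 (Leaf
  [::(1,1); (3,1); (4,1); (7,1); (8,1); (9,1); (10,1); (11,1); (13,1); (18,1); (2,0); (17,0)]
  [::(3,7,10,6,17); (3,7,1,0,4); (2,13,17,5,10); (1,9,2,0,5)]) (Leaf [::(1,1); (4,1); (9,1);
  (10,1); (11,1); (5,0); (7,0)] [::(7,10,5,8,9); (1,10,7,4,17)]))))) (SplitD 4 13 (SplitD 6 7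
  (Leaf [::(0,1); (2,1); (4,1); (5,1); (6,1); (7,1); (9,1); (10,1); (17,1); (18,1)]
  [::(5,17,10,9,13); (5,17,7,8,4)]) (Leaf [::(2,1); (4,1); (6,1); (7,1); (10,1)] [::])) (SplitD 7
  13 (Helly 8 12 17 (SplitD 3 18 (SplitD 4 10 (Leaf [::(0,1); (2,1); (3,1); (4,1); (5,1); (6,1);
  (8,1); (10,1); (18,1); (20,1)] [::]) (Leaf [::(2,1); (4,1); (6,1); (10,1); (18,1)] [::]))
  (SplitD 0 17 (Leaf [::(0,1); (3,1); (5,1); (6,1); (8,1); (9,1); (10,1); (17,1); (18,1); (19,1)]
  [::]) (SplitD 1 10 (Leaf [::(0,1); (1,1); (2,1); (4,1); (5,1); (6,1); (7,1); (9,1); (10,1);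
  (17,1)] [::]) (SplitD 0 13 (Leaf [::(0,1); (1,1); (4,1); (5,1); (7,1); (8,1); (9,1); (10,1);
  (13,1); (19,1)] [::]) (SplitD 6 7 (Leaf [::(0,1); (1,1); (3,1); (4,1); (5,1); (6,1); (7,1);
  (8,1); (9,1); (10,1)] [::]) (SplitD 3 8 (Leaf [::(0,1); (1,1); (3,1); (4,1); (5,1); (6,1);
  (7,1); (8,1); (9,1); (10,1)] [::]) (Leaf [::(0,1); (2,1); (3,1); (4,1); (5,1); (6,1); (7,1);
  (8,1); (10,1); (13,1)] [::])))))))) (SplitD 2 13 (Leaf [::(0,1); (7,1); (8,1); (10,1); (13,1)]
  [::]) (SplitD 1 10 (Leaf [::(2,1); (4,1); (7,1); (10,1); (13,1)] [::]) (SplitD 3 8 (Leaf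
  [::(0,1); (1,1); (3,1); (4,1); (5,1); (7,1); (8,1); (9,1); (10,1); (13,1); (2,0)]
  [::(1,9,2,0,5)]) (SplitD 4 10 (Leaf [::(0,1); (2,1); (3,1); (4,1); (5,1); (7,1); (8,1); (10,1);
  (13,1); (17,1)] [::]) (Leaf [::(2,1); (4,1); (7,1); (10,1); (13,1)] [::])))))))))).

Lemma check_spider_D0 : check true pat_spider_D0 cert_spider_D0.
Proof. by lazy. Qed.

Definition pat_far_vertex8 := mk_pattern 8
  [::(0, 1); (1, 2); (2, 3); (3, 4); (4, 5); (5, 6); (6, 7); (7, 0)]
  [::(0, 4); (2, 6)]
  [::(2, 7); (6, 1); (2, 5); (6, 3); (4, 0)]
  [::(0, 4)]
  None.

Definition cert_far_vertex8 :=
  (Walk 4 7 (Walk 3 6 (Walk 2 5 (Walk 0 5 (SplitD 15 17 (Leaf [::(0,1); (4,1); (5,1); (14,1);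
  (17,1)] [::]) (SplitD 9 18 (Leaf [::(0,1); (4,1); (5,1); (7,1); (8,1); (9,1); (10,1); (17,1);
  (18,1); (19,1)] [::]) (SplitD 8 17 (SplitD 10 19 (Leaf [::(0,1); (4,1); (5,1); (7,1); (8,1);
  (9,1); (10,1); (17,1); (18,1); (19,1)] [::]) (Leaf [::(5,1); (6,1); (7,1); (8,1); (9,1); (10,1);
  (17,1); (18,1); (19,1); (20,1)] [::])) (SplitD 13 14 (SplitD 12 15 (Leaf [::(2,1); (3,1); (5,1);
  (6,1); (11,1); (12,1); (13,1); (14,1); (15,1); (16,1)] [::]) (SplitD 11 16 (Leaf [::(2,1);
  (3,1); (5,1); (6,1); (11,1); (12,1); (13,1); (14,1); (15,1); (16,1)] [::]) (Leaf [::(3,1);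
  (4,1); (5,1); (11,1); (12,1); (13,1); (14,1); (15,1); (16,1); (20,1)] [::]))) (SplitD 12 15
  (Leaf [::(2,1); (3,1); (4,1); (5,1); (6,1); (12,1); (13,1); (14,1); (15,1); (20,1)] [::])
  (SplitD 8 14 (SplitD 7 15 (Leaf [::(0,1); (4,1); (8,1); (15,1); (17,1)] [::]) (SplitD 0 16 (Leaf
  [::(0,1); (4,1); (8,1); (15,1); (17,1)] [::]) (SplitD 8 13 (Leaf [::(4,1); (7,1); (8,1); (12,1);
  (15,1)] [::]) (SplitD 12 17 (Leaf [::(0,1); (4,1); (8,1); (13,1); (17,1)] [::]) (SplitD 1 12
  (Leaf [::(0,1); (4,1); (5,1); (12,1); (17,1)] [::]) (SplitD 0 11 (Leaf [::(0,1); (4,1); (5,1);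
  (12,1); (17,1)] [::]) (SplitD 11 16 (Hexa 3 11 21 16 5 4 (Leaf [::(0,1); (4,1); (13,1); (14,1);
  (21,1)] [::])) (SplitD 7 11 (Leaf [::(0,1); (1,1); (4,1); (5,1); (7,1); (8,1); (11,1); (12,1);
  (15,1); (16,1); (3,0)] [::(1,5,3,2,4); (1,5,7,0,6)]) (Leaf [::(0,1); (4,1); (5,1); (7,1); (8,1);
  (11,1); (12,1); (15,1); (16,1); (17,1)] [::]))))))))) (SplitD 10 16 (Leaf [::(0,1); (4,1);
  (8,1); (14,1); (20,1)] [::]) (SplitD 8 12 (Leaf [::(0,1); (4,1); (8,1); (13,1); (14,1)] [::])
  (SplitD 7 15 (Leaf [::(0,1); (4,1); (7,1); (8,1); (14,1)] [::]) (SplitD 1 12 (Leaf [::(0,1);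
  (4,1); (7,1); (8,1); (12,1)] [::]) (SplitD 12 17 (Leaf [::(0,1); (4,1); (7,1); (8,1); (12,1)]
  [::]) (SplitD 11 16 (Leaf [::(2,1); (7,1); (8,1); (12,1); (16,1)] [::]) (SplitD 10 11 (Leaf
  [::(4,1); (5,1); (10,1); (12,1); (17,1)] [::]) (SplitD 9 15 (Leaf [::(4,1); (8,1); (12,1);
  (15,1); (17,1)] [::]) (SplitD 3 7 (Leaf [::(0,1); (3,1); (4,1); (7,1); (8,1); (10,1); (11,1);
  (13,1); (14,1); (16,1); (5,0)] [::(3,7,5,4,6)]) (SplitD 2 9 (Leaf [::(1,1); (2,1); (3,1); (5,1);
  (6,1); (7,1); (9,1); (10,1); (15,1); (16,1)] [::(1,5,3,2,4); (1,5,7,0,6)]) (Leaf [::(1,1);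
  (3,1); (4,1); (5,1); (7,1); (10,1); (11,1); (12,1); (15,1); (16,1); (8,0)] [::(3,10,8,4,9);
  (1,5,3,2,4); (1,5,7,0,6)]))))))))))))))))))))).

Lemma check_far_vertex8 : check true pat_far_vertex8 cert_far_vertex8.
Proof. by lazy. Qed.

Definition pat_far_vertex9 := mk_pattern 12
  [::(0, 1); (1, 2); (2, 3); (3, 4); (4, 5); (5, 6); (6, 7); (7, 8); (8, 0); (9, 2); (10, 9); (11,
    10); (11, 5)]
  [::(0, 4); (0, 5); (5, 2); (4, 7); (10, 0)]
  [::(9, 7); (2, 8); (7, 1); (4, 0); (5, 0)]
  [::(0, 4); (0, 5)]
  None.

Definition cert_far_vertex9 :=
  (SplitD 8 10 (Leaf [::(0,1); (4,1); (5,1); (8,1); (9,1)] [::]) (Walk 2 8 (Leaf [::(0,1); (4,1);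
  (8,1); (10,1); (12,1)] [::]))).

Lemma check_far_vertex9 : check true pat_far_vertex9 cert_far_vertex9.
Proof. by lazy. Qed.

(** * Configurations excluded by the certificates *)

Section Local.
Variables (T : finType) (e : rel T).
Hypothesis G : dense_c3c5_free e.

Let eC := adjC G.
Local Notation D := (walk2 e).
Local Notation S := (walk3 e).
Local Notation N := (nb e).

Lemma refute (hx : bool) n E nD nA nS cl c (x0 : T) xs :
  let f := nth x0 xs in
  check hx (mk_pattern n E nD nA nS cl) c ->
  (hx -> hexagon_closed e) -> (hx -> helly_walk2 e) ->
  all (fun q => e (f q.1) (f q.2)) E ->
  all (fun q => ~~ D (f q.1) (f q.2)) nD ->
  all (fun q => ~~ e (f q.1) (f q.2)) nA ->
  all (fun q => ~~ S (f q.1) (f q.2)) nS ->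
  (if cl is Some (h, x, y, z) then claw_rule e (f h) (f x) (f y) (f z) else True) -> False.
Proof.
move=> f ok hex hel okE okD okA okS okcl; apply: (check_sound G hex hel ok (f := f)).
split=> //; apply: covers_marks => // x y; rewrite /no ?[D x y](walk2C G) ?[S x y](walk3C G) //.
by rewrite eC.
Qed.

Lemma no_induced_hexagon : hexagon_closed e.
Proof.
move=> p0 p1 p2 p3 p4 p5 e1 e2 e3 e4 e5 e6 n1 n2; apply: contraT => n3; exfalso.
by apply: (@refute _ _ _ _ _ _ _ _ p0 [:: p0; p1; p2; p3; p4; p5] check_hexagon) => //=;
  rewrite ?e1 ?e2 ?e3 ?e4 ?e5 ?e6 ?n1 ?n2 ?n3.
Qed.

(** The three common neighbours alternate with [x], [y], [z] on a hexagon. One of its long diagonals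
    is an edge, and each of them makes one of the common neighbours adjacent to all three. *)
Lemma helly : helly_walk2 e.
Proof.
move=> x y z /existsP[a /andP[xa ay]] /existsP[c /andP[xc cz]] /existsP[b /andP[yb bz]].
have [xb|nxb] := boolP (e x b); first by exists b; rewrite eC // yb.
have [az|naz] := boolP (e a z); first by exists a; rewrite ?ay // eC.
have yc : e y c.
  by apply: (no_induced_hexagon xa ay yb bz _ _ nxb naz); rewrite eC.
by exists c; rewrite eC // yc cz.
Qed.

(** If [w] missed [h], the last inner vertex of a 4-walk from [w] to [h] would form with [w], [x],
    [y], [z] five vertices whose neighbourhoods are pairwise disjoint. *)
Lemma claw_ruleP h x y z : D h x -> D h y -> D h z -> ~~ D x y -> ~~ D x z -> ~~ D y z ->
  claw_rule e h x y z.
Proof.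
move=> /existsP[a /andP[ha ax]] /existsP[b /andP[hb b_y]] /existsP[c /andP[hc cz]].
move=> nxy nxz nyz w nwx nwy nwz; apply: contraT => /(walk4_nonadj G)/(walk4P e).
move=> -[p [q [r [wp pq qr rh]]]]; exfalso.
apply: (@refute _ _ _ _ _ _ _ _ w [:: w; p; q; r; h; x; y; z; a; b; c] check_claw_rule) => //=.
- by move=> _; apply: no_induced_hexagon.
- by move=> _; apply: helly.
- by rewrite wp pq qr rh ha ax hb b_y hc cz.
- by rewrite nwx nwy nwz nxy nxz nyz.
Qed.

Lemma refute_true n E nD nA nS cl c (x0 : T) xs :
  let f := nth x0 xs in
  check true (mk_pattern n E nD nA nS cl) c ->
  all (fun q => e (f q.1) (f q.2)) E ->
  all (fun q => ~~ D (f q.1) (f q.2)) nD ->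
  all (fun q => ~~ e (f q.1) (f q.2)) nA ->
  all (fun q => ~~ S (f q.1) (f q.2)) nS ->
  (if cl is Some (h, x, y, z) then claw_rule e (f h) (f x) (f y) (f z) else True) -> False.
Proof.
move=> f ok; apply: refute ok _ _ => _; [exact: no_induced_hexagon|exact: helly].
Qed.

(** The neighbours [a], [y], [b], [y'] of the hub [v] alternate with [x], [r], [r'], [x'] on an
    8-cycle: the neighbourhood of [v] would close up to a cycle instead of being an arc. *)
Lemma cross v a y b y' x x' r r' :
  e v a -> e v y -> e v b -> e v y' -> e x a -> e x y -> e r y -> e r b -> e r' b -> e r' y' ->
  e x' y' -> e x' a -> ~~ e x b -> ~~ e x y' -> ~~ e r a -> ~~ e r y' -> ~~ e r' a ->
  ~~ e r' y -> ~~ e x' y -> ~~ e x' b -> False.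
Proof.
move=> *.
apply: (@refute_true _ _ _ _ _ _ _ v [:: v; a; y; b; y'; x; r; r'; x'] check_cross) => //=;
by do !(apply/andP; split).
Qed.

(* Three neighbours [a], [b], [c] of [h] with private neighbours [x], [y], [z]; the cases
   below are named after the number of pairs of [x], [y], [z] having a common neighbour. *)
Definition spider h a b c x y z :=
  [/\ [/\ e h a, e h b & e h c], [/\ e a x, e b y & e c z],
      [/\ ~~ e x b, ~~ e x c & ~~ e y a] & [/\ ~~ e y c, ~~ e z a & ~~ e z b]].

Lemma spider12 h a b c x y z : spider h a b c x y z -> spider h b a c y x z.
Proof. by case=> [] [? ? ?] [? ? ?] [? ? ?] [? ? ?]. Qed.

Lemma spider23 h a b c x y z : spider h a b c x y z -> spider h a c b x z y.
Proof. by case=> [] [? ? ?] [? ? ?] [? ? ?] [? ? ?]. Qed.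

(** In the hexagon [a], [x], [s], [y], [b], [h] two long diagonals are missing by privacy of [x] and
    [y], so the third is an edge. This supplies the additional edges at the hub in the patterns
    below. *)
Lemma spider_hub h a b c x y z s : spider h a b c x y z -> e s x -> e s y -> e s h.
Proof.
case=> [] [ha hb hc] [ax b_y cz] [xb xc ya] [yc za zb] sx sy.
by apply: (@no_induced_hexagon a x s y b h) => //; rewrite eC.
Qed.

Lemma spider_D3 h a b c x y z :
  spider h a b c x y z -> D x y -> D x z -> D y z -> False.
Proof.
move=> sp xy xz yz; have [s sx /andP[sy sz]] := helly xy xz yz.
have sh := spider_hub sp sx sy.
case: sp => [] [ha hb hc] [ax b_y cz] [xb xc ya] [yc za zb].
apply: (@refute_true _ _ _ _ _ _ _ h [:: h; a; b; c; x; y; z; s] check_spider_D3) => //=;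
by do !(apply/andP; split).
Qed.

Lemma spider_D2 h a b c x y z : spider h a b c x y z -> D x y -> D y z -> ~~ D x z -> False.
Proof.
move=> sp /existsP[s /andP[xs sy]] /existsP[t /andP[yt tz]] nxz; rewrite eC in xs; rewrite eC in yt.
have sh := spider_hub sp xs sy; have th := spider_hub (spider23 (spider12 sp)) yt tz.
case: sp => [] [ha hb hc] [ax b_y cz] [xb xc ya] [yc za zb].
apply: (@refute_true _ _ _ _ _ _ _ h [:: h; a; b; c; x; y; z; s; t] check_spider_D2) => //=;
by do !(apply/andP; split).
Qed.

Lemma spider_D1 h a b c x y z : spider h a b c x y z -> D x y -> ~~ D z x -> ~~ D z y -> False.
Proof.
move=> sp /existsP[s /andP[xs sy]] nzx nzy; rewrite eC in xs.
have sh := spider_hub sp xs sy.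
case: sp => [] [ha hb hc] [ax b_y cz] [xb xc ya] [yc za zb].
apply: (@refute_true _ _ _ _ _ _ _ h [:: h; a; b; s; c; x; y; z] check_spider_D1) => //=;
do !(apply/andP; split) => //; by rewrite eC.
Qed.

Lemma spider_claw h a b c x y z : spider h a b c x y z ->
  ~~ D x y -> ~~ D x z -> ~~ D y z -> claw_rule e h x y z.
Proof.
case=> [] [ha hb hc] [ax b_y cz] _ _; apply: claw_ruleP.
- exact: walk2I ha ax.
- exact: walk2I hb b_y.
- exact: walk2I hc cz.
Qed.

(** The first inner vertex [p] of a 4-walk from [x] to [b] is not adjacent to [h], as this would
    close a walk of length 5. By the claw rule it then shares a neighbour with [y] or [z]. *)
Lemma spider_S h a b c x y z : spider h a b c x y z ->
  ~~ D x y -> ~~ D x z -> ~~ D y z -> S x y || S x z.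
Proof.
move=> sp nxy nxz nyz; have cl := spider_claw sp nxy nxz nyz.
case: sp => [] [ha hb hc] [ax b_y cz] [xb xc ya] [yc za zb].
have /(walk4P e)[p [q [s [xp pq qs sb]]]] := walk4_nonadj G xb.
have px : ~~ D p x by apply/negP => /(no_c3 G); apply; rewrite eC.
have ph : ~~ e p h.
  by apply/negP => ph; apply: (no_c5 G ph); apply: (walk4I pq qs sb); rewrite eC.
have [py|npy] := boolP (D p y).
  by case/existsP: py => t /andP[pt ty]; rewrite (walk3I xp pt ty).
have [pz|npz] := boolP (D p z).
  by case/existsP: pz => t /andP[pt tz]; rewrite (walk3I xp pt tz) orbT.
by rewrite cl in ph.
Qed.

Lemma spider_t h a b c x y z p t : spider h a b c x y z ->
  ~~ D x y -> ~~ D x z -> ~~ D y z -> e x p -> e p t -> e t y -> D t z -> False.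
Proof.
move=> sp nxy nxz nyz xp pt ty /existsP[q /andP[tq qz]].
have cl := spider_claw sp nxy nxz nyz.
case: sp => [] [ha hb hc] [ax b_y cz] [xb xc ya] [yc za zb].
apply: (@refute_true _ _ _ _ _ _ _ h [:: h; a; b; c; x; y; z; p; t; q] check_spider_t) => //=;
by do !(apply/andP; split).
Qed.

(* With no common neighbours, [h] is joined by the claw rule to everything that shares no
   neighbour with [x], [y], [z], and [y] is the centre of the 3-walks between them. *)
Lemma spider_D0 h a b c x y z : spider h a b c x y z ->
  ~~ D x y -> ~~ D x z -> ~~ D y z -> S x y -> S y z -> False.
Proof.
move=> sp nxy nxz nyz /(walk3P e)[p [t [xp pt ty]]] /(walk3P e)[u [q [yu uq qz]]].
have [tz|ntz] := boolP (D t z); first exact: spider_t sp nxy nxz nyz xp pt ty tz.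
have sp' := spider12 (spider23 (spider12 sp)).
have [ux|nux] := boolP (D u x).
  by apply: (@spider_t _ _ _ _ z y x q u sp') ux; rewrite 1?(walk2C G) // eC.
have cl := spider_claw sp nxy nxz nyz.
case: sp {sp'} => [] [ha hb hc] [ax b_y cz] [xb xc ya] [yc za zb].
apply: (@refute_true _ _ _ _ _ _ _ h [:: h; a; b; c; x; y; z; p; t; u; q] check_spider_D0) => //=;
by do !(apply/andP; split).
Qed.

Lemma no_spider h a b c x y z : ~ spider h a b c x y z.
Proof.
have DC := walk2C G; have SC := walk3C G => sp.
have s12 := spider12 sp; have s23 := spider23 sp.
have s231 := spider23 s12; have s312 := spider12 s23.
have [xy|nxy] := boolP (D x y); have [xz|nxz] := boolP (D x z);
  have [yz|nyz] := boolP (D y z).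
- exact: spider_D3 sp xy xz yz.
- by apply: (spider_D2 s12) => //; rewrite DC.
- exact: spider_D2 sp xy yz nxz.
- by apply: (spider_D1 sp) => //; rewrite DC.
- by apply: (spider_D2 s23) => //; rewrite DC.
- by apply: (spider_D1 s23) => //; rewrite DC.
- by apply: (spider_D1 s231) => //; rewrite DC.
have nyx : ~~ D y x by rewrite DC.
have nzx : ~~ D z x by rewrite DC.
have nzy : ~~ D z y by rewrite DC.
(* Each of [x], [y], [z] has a walk of length 3 to one of the other two, so one of them has such
   walks to both and can serve as the centre. *)
have hx := spider_S sp nxy nxz nyz; have hy := spider_S s12 nyx nyz nxz.
have hz := spider_S (spider12 s23) nzx nzy nxy.
have [xy|nSxy] := boolP (S x y); have [yz|nSyz] := boolP (S y z).
- exact: spider_D0 sp nxy nxz nyz xy yz.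
- rewrite (SC z y) (negbTE nSyz) orbF in hz.
  by apply: (spider_D0 s312 nzx nzy nxy hz xy).
- rewrite (negbTE nSxy) /= in hx.
  by apply: (spider_D0 s23 nxz nxy nzy hx); rewrite SC.
- by rewrite SC (negbTE nSxy) (negbTE nSyz) in hy.
Qed.

Lemma spider_cover h a b c : e h a -> e h b -> e h c ->
  [\/ N a \subset N b :|: N c, N b \subset N a :|: N c | N c \subset N a :|: N b].
Proof.
move=> ha hb hc.
have [sub|/subsetPn[x + nx]] := boolP (N a \subset N b :|: N c); first by constructor 1.
have [sub|/subsetPn[y + ny]] := boolP (N b \subset N a :|: N c); first by constructor 2.
have [sub|/subsetPn[z + nz]] := boolP (N c \subset N a :|: N b); first by constructor 3.
rewrite !inE !negb_or in nx ny nz * => cz b_y ax; exfalso.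
case/andP: nx => xb xc; case/andP: ny => ya yc; case/andP: nz => za zb.
by apply: (@no_spider h a b c x y z); split=> //; split; rewrite // eC.
Qed.

Lemma far_vertex8 u a b w1 w3 z1 z3 y :
  e u a -> e a w1 -> e w1 z1 -> e z1 y -> e y z3 -> e z3 w3 -> e w3 b -> e b u ->
  ~~ D u y -> ~~ D w1 w3 -> ~~ S u y -> ~~ e w1 b -> ~~ e w3 a -> ~~ e w1 z3 -> ~~ e w3 z1 ->
  ~~ e y u -> False.
Proof.
move=> *.
apply: (@refute_true _ _ _ _ _ _ _ u [:: u; a; w1; z1; y; z3; w3; b] check_far_vertex8) => //=;
by do !(apply/andP; split).
Qed.

Lemma far_vertex9 u a b w1 w3 z1 z3 y0 y n1 n2 n3 :
  e u a -> e a w1 -> e w1 z1 -> e z1 y0 -> e y0 y -> e y z3 -> e z3 w3 -> e w3 b -> e b u ->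
  e n1 w1 -> e n2 n1 -> e n3 n2 -> e n3 y ->
  ~~ D u y0 -> ~~ D u y -> ~~ D y w1 -> ~~ D y0 w3 -> ~~ D n2 u -> ~~ S u y0 -> ~~ S u y ->
  ~~ e n1 w3 -> ~~ e w1 b -> ~~ e w3 a -> ~~ e y0 u -> ~~ e y u -> False.
Proof.
move=> *; apply: (@refute_true _ _ _ _ _ _ _ u [:: u; a; w1; z1; y0; y; z3; w3; b; n1; n2; n3]
  check_far_vertex9) => //=; by do !(apply/andP; split).
Qed.

End Local.

(** * Five blocks around a circle *)

Section Structure.
Variables (T : finType) (e : rel T).
Hypothesis G : dense_c3c5_free e.

Let eC := adjC G.
Local Notation D := (walk2 e).
Local Notation S := (walk3 e).
Local Notation N := (nb e).

Lemma no_triangle x y z : e x y -> e y z -> e x z -> False.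
Proof. by move=> xy yz xz; apply: (no_c3 G xz); apply: walk2I xy yz. Qed.

Lemma no_pentagon x y z t w : e x y -> e y z -> e z t -> e t w -> e w x -> False.
Proof. by rewrite [e w x]eC => xy yz zt tw xw; apply: (no_c5 G xw); apply: walk4I xy yz zt tw. Qed.

Lemma nb_coverP a b c x : N c \subset N a :|: N b -> e c x -> e a x \/ e b x.
Proof. by move=> /subsetP/(_ x); rewrite !inE => sub /sub/orP. Qed.

(** Duality from maximality: if [x] missed [c], the last inner vertex of a 4-walk from [x] to [c]
    would lie in [N a] or [N b] and close a walk of length 5 through [x]. *)
Lemma nb_dual a b c x : N c \subset N a :|: N b -> e x a -> e x b -> e x c.
Proof.
move=> sub xa xb; apply: contraT => /(walk4_nonadj G)/(walk4P e)[p [q [r [xp pq qr rc]]]].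
exfalso; have [ar|br] : e a r \/ e b r by apply: nb_coverP sub _; rewrite eC.
  by apply: (no_c5 G xa); apply: (walk4I xp pq qr); rewrite eC.
by apply: (no_c5 G xb); apply: (walk4I xp pq qr); rewrite eC.
Qed.

(** Duality with [a = b]. Neighbourhoods thus form an antichain, so a vertex that sees something new
    must also miss something; this produces most of the witnesses below. *)
Lemma nb_sub_eq x y : N x \subset N y -> N x = N y.
Proof.
move=> sub; apply/eqP; rewrite eqEsubset sub; apply/subsetP => t; rewrite !inE => yt.
have sub' : N x \subset N y :|: N y by rewrite setUid.
by rewrite eC; apply: (nb_dual sub'); rewrite eC.
Qed.

Lemma nb_nonempty x : exists y, e x y.
Proof.
have := deg_gt G x; case: (set_0Vmem (N x)) => [->|[y]]; first by rewrite cards0.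
by rewrite inE; exists y.
Qed.

(** The extreme neighbours of [v] on the circle still to be found. *)
Definition ends v a b := [/\ e v a, e v b & forall c, e v c -> N c \subset N a :|: N b].

(** No induced matching of two edges between [N v] and [N a]: the traces on [N a] of the
    neighbourhoods of vertices in [N v] form a chain. *)
Definition nested v a := forall x x' y y',
  e v x -> e v x' -> e a y -> e a y' -> e x y -> e x' y' -> e x y' || e x' y.

Lemma ends_sym v a b : ends v a b -> ends v b a.
Proof. by case=> va vb h; split=> // c /h; rewrite setUC. Qed.

Lemma nested_sym v a : nested v a -> nested a v.
Proof.
move=> h x x' y y' ax ax' vy vy' xy xy'.
by rewrite orbC eC [e x _]eC; apply: h => //; rewrite eC.
Qed.

(** A pair with the largest joint neighbourhood works: among three neighbours one is covered by the
    other two, and if it is not [c], exchanging it for [c] keeps the union maximal. *)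
Lemma ends_exist v : exists a b, ends v a b.
Proof.
have [a0 va0] := nb_nonempty v.
pose P q := e v q.1 && e v q.2; pose F q := #|N q.1 :|: N q.2|.
have [|[a b] /andP[/= va vb] mx] := @arg_maxnP _ (a0, a0) P F; first by rewrite /P /= va0.
exists a, b; split=> // c vc.
have small (x : T) : e v x -> N a :|: N b \subset N x :|: N c -> N c \subset N a :|: N b.
  move=> vx sub; have /eqP -> : N a :|: N b == N x :|: N c.
    by rewrite eqEcard sub (mx (x, c)) // /P /= vx.
  exact: subsetUr.
have [sub|sub|//] := spider_cover G va vb vc.
  by apply: (small b vb); rewrite subUset sub subsetUl.
by apply: (small a va); rewrite subUset sub subsetUl.
Qed.

(** With [a] prescribed, maximality of the union says nothing when [N a] is covered by [N b] and
    [N c]. In that case the antichain property gives [r] and [r'] in [N a], missed by [b] and [c]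
    respectively, and these form a matching against [nested v a]. *)
Lemma nested_ends v a : e v a -> nested v a -> exists b, ends v a b.
Proof.
move=> va nest; have [b /= vb mx] := @arg_maxnP _ a (e v) (fun b => #|N a :|: N b|) va.
exists b; split=> // c vc.
have max_c : N b \subset N a :|: N c -> N c \subset N a :|: N b.
  move=> sub; have /eqP -> : N a :|: N b == N a :|: N c; last exact: subsetUr.
  by rewrite eqEcard subUset sub subsetUl mx.
have [sub|/max_c//|//] := spider_cover G va vb vc.
apply: contraT => /subsetPn[y cy nay].
have [/max_c/subsetP/(_ y cy)|] := boolP (N b \subset N a :|: N c).
  by rewrite (negbTE nay).
case/subsetPn=> y' b_y' nay'.
rewrite !inE !negb_or in cy nay b_y' nay'.
case/andP: nay => ay b_y; case/andP: nay' => ay' cy'.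
have strict x z : e x z -> ~~ e a z -> exists2 r, e a r & ~~ e x r.
  move=> xz naz; have [/nb_sub_eq eqN|/subsetPn[r]] := boolP (N a \subset N x).
    by move/setP/(_ z): eqN; rewrite !inE xz (negbTE naz).
  by rewrite !inE; exists r.
have [r ar nbr'] := strict b y' b_y' ay'; have [r' ar' ncr'] := strict c y cy ay.
have [br|cr] := nb_coverP sub ar; first by rewrite br in nbr'.
have [br'|cr'] := nb_coverP sub ar'; last by rewrite cr' in ncr'.
by have := nest b c r' r vb vc ar' ar br' cr; rewrite (negbTE nbr') (negbTE ncr').
Qed.

Lemma ends_twin v a b x y : ends v a b -> e a x -> e b x -> e v y -> e x y.
Proof. by case=> _ _ h ax bx /h/nb_dual; apply; rewrite eC. Qed.

(** A bad matching [y p], [y' p'] forces [N a] to be covered by [N y] and [N y']. Then [y] and [y']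
    see vertices [r], [r'] outside [N a], hence in [N b], which complete the 8-cycle excluded by
    [cross]. *)
Lemma ends_nested v a b : ends v a b -> nested v a.
Proof.
move=> en y y' p p' vy vy' ap ap' yp yp'; have [va vb cov] := en.
apply: contraT; rewrite negb_or => /andP[nyp' ny'p]; exfalso.
have dual (c d x : T) : N c \subset N a :|: N d -> e a x -> e d x -> e c x.
  by move=> sub ax dx; rewrite eC; apply: (nb_dual sub); rewrite eC.
have [sub|sub|sub] := spider_cover G va vy vy'; last 2 first.
- by rewrite (dual _ _ _ sub ap' yp') in nyp'.
- by rewrite (dual _ _ _ sub ap yp) in ny'p.
have priv z q : e v z -> e a q -> ~~ e z q -> exists r, [/\ e r z, e r b & ~~ e r a].
  move=> vz aq nzq; have [/nb_sub_eq eqN|/subsetPn[r]] := boolP (N z \subset N a).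
    by move/setP/(_ q): eqN; rewrite !inE aq (negbTE nzq).
  rewrite !inE => zr nar; exists r; rewrite eC zr [e r a]eC nar; split=> //.
  by case: (nb_coverP (cov _ vz) zr) => [ar|]; [rewrite ar in nar|rewrite eC].
have [r [ry rb nra]] := priv _ _ vy ap' nyp'; have [r' [ry' rb' nra']] := priv _ _ vy' ap ny'p.
have two s : e s y -> e s y' -> e s a by move=> sy sy'; apply: (nb_dual sub).
have nb_b q z : e a q -> e v z -> ~~ e z q -> ~~ e q b.
  move=> aq vz; apply: contra; rewrite eC => bq.
  by rewrite eC; apply: (ends_twin en aq bq).
apply: (@cross _ _ G v a y b y' p p' r r') => //; rewrite 1?eC //.
- by rewrite eC; apply: nb_b ap vy' ny'p.
- by apply/negP => ry2; rewrite two // eC in nra.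
- by apply/negP => ry2; rewrite two // eC in nra'.
- by rewrite eC; apply: nb_b ap' vy nyp'.
Qed.

(* The path [z1, w1, a, u, b, w3, z3], each inner vertex of which has its two neighbours on
   the path as ends. *)
Record frame u a b w1 w3 z1 z3 : Prop := Frame {
  ends_u : ends u a b; ends_a : ends a u w1; ends_b : ends b u w3;
  ends_w1 : ends w1 a z1; ends_w3 : ends w3 b z3 }.

Lemma frame_sym u a b w1 w3 z1 z3 : frame u a b w1 w3 z1 z3 -> frame u b a w3 w1 z3 z1.
Proof. by case=> /ends_sym. Qed.

(** If [c] is an end of [v], then [v] and [c] are nested, a symmetric relation, so [v] can be
    prescribed as an end of [c]. This extends the path from [u] outwards. *)
Lemma frame_exists (u : T) : exists a b w1 w3 z1 z3, frame u a b w1 w3 z1 z3.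
Proof.
have next v c d : ends v c d -> exists w, ends c v w.
  move=> en; have [vc _ _] := en; apply: nested_ends; first by rewrite eC.
  exact: nested_sym (ends_nested en).
have [a [b en]] := ends_exist u; have [w1 en1] := next _ _ _ en.
have [w3 en3] := next _ _ _ (ends_sym en).
have [z1 enz1] := next _ _ _ (ends_sym en1).
have [z3 enz3] := next _ _ _ (ends_sym en3).
by exists a, b, w1, w3, z1, z3.
Qed.

(** What the neighbourhoods of [u], [a], [b] leave over; it has to split between [N w1] and
    [N w3]. *)
Definition rest u a b y := [&& ~~ e u y, ~~ e a y & ~~ e b y].

Section Frame.
Variables u a b w1 w3 z1 z3 : T.
Hypothesis F : frame u a b w1 w3 z1 z3.
Local Notation R := (rest u a b).

Let Eu := ends_u F.
Let Ea := ends_a F.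
Let E1 := ends_w1 F.

Let aw1 : e a w1. Proof. by case: Ea. Qed.

Let ends_adj v c d x y : ends v c d -> e v x -> e x y -> ~~ e c y -> e d y.
Proof.
by case=> _ _ cov vx xy ncy; case: (nb_coverP (cov _ vx) xy) => // cy; rewrite cy in ncy.
Qed.

Lemma rest_adj x y : R y -> e a x -> e x y -> e w1 y.
Proof. by case/and3P => uy _ _ ax xy; apply: ends_adj Ea ax xy uy. Qed.

Lemma rest_no2 y : R y -> ~~ D u y.
Proof.
case/and3P => _ ay b_y; apply/negP => /existsP[x /andP[ux xy]].
by rewrite (ends_adj Eu ux xy ay) in b_y.
Qed.

(** If [w1] saw both ends of [u], it would be a twin of [u], which misses [y]. *)
Lemma rest_w1 y : R y -> e w1 y -> ~~ e w1 b.
Proof.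
move=> /and3P[uy _ _] w1y; apply: contra uy => w1b.
suff /nb_sub_eq/setP/(_ y) : N u \subset N w1 by rewrite !inE w1y.
apply/subsetP => x; rewrite !inE => ux; apply: (ends_twin Eu) => //.
by rewrite eC.
Qed.

Lemma rest_D_w1 y : R y -> D w1 y -> e z1 y /\ ~~ e w1 b.
Proof.
move=> Ry /existsP[p /andP[w1p py]]; have [uy ay b_y] := and3P Ry.
split; first exact: ends_adj E1 w1p py ay.
apply: contra (rest_no2 Ry) => w1b.
suff eqN : N u = N w1.
  by move/setP/(_ p): eqN; rewrite !inE w1p => up; apply: walk2I up py.
apply: nb_sub_eq; apply/subsetP => x; rewrite !inE => ux; apply: (ends_twin Eu) => //.
by rewrite eC.
Qed.

End Frame.

Lemma rest_sym u a b y : rest u a b y = rest u b a y.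
Proof. by rewrite /rest [X in _ && X]andbC. Qed.

Section Rest.
Variables u a b w1 w3 z1 z3 : T.
Hypothesis F : frame u a b w1 w3 z1 z3.
Local Notation R := (rest u a b).
Let F' := frame_sym F.

Let Eu := ends_u F.
Let Ea := ends_a F.
Let Eb := ends_b F.
Let E1 := ends_w1 F.
Let E3 := ends_w3 F.

Let ua : e u a. Proof. by case: Eu. Qed.
Let ub : e u b. Proof. by case: Eu. Qed.
Let aw1 : e a w1. Proof. by case: Ea. Qed.
Let bw3 : e b w3. Proof. by case: Eb. Qed.
Let w1z1 : e w1 z1. Proof. by case: E1. Qed.
Let w3z3 : e w3 z3. Proof. by case: E3. Qed.

Let R' y : R y -> rest u b a y. Proof. by rewrite rest_sym. Qed.

Lemma rest_not_both y : R y -> e w1 y -> e w3 y -> False.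
Proof.
move=> Ry w1y w3y; have w1b := rest_w1 F Ry w1y; have w3a := rest_w1 F' (R' Ry) w3y.
have [uy _ _] := and3P Ry; case/negP: uy.
by apply: (@no_induced_hexagon _ _ G w1 a u b w3 y) => //; rewrite eC.
Qed.

(** Vertices that would fit into none of the five blocks; the aim is to show that there are none. *)
Definition far y := [&& R y, ~~ e w1 y & ~~ e w3 y].

Lemma far_rest y : far y -> R y.
Proof. by case/and3P. Qed.

Lemma far_nb y x : far y -> e y x -> R x.
Proof.
move=> fy yx; have [Ry n1 n3] := and3P fy; have [uy ay b_y] := and3P Ry.
rewrite eC in yx; apply/and3P; split.
- by apply: contra (rest_no2 F Ry) => ux; apply: walk2I ux yx.
- by apply: contra n1 => ax; apply: rest_adj F _ _ Ry ax yx.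
- by apply: contra n3 => bx; apply: rest_adj F' _ _ (R' Ry) bx yx.
Qed.

Lemma far_no3 y : far y -> ~~ S u y.
Proof.
move=> fy; apply/negP => /(walk3P e)[p [x [up px xy]]]; rewrite eC in xy.
have Rx := far_nb fy xy; case/negP: (rest_no2 F Rx); exact: walk2I up px.
Qed.

(** A 4-walk from [u] to [y] is pushed along the frame: its second inner vertex is seen by an end of
    [u], and its third one then by [w1] or [w3], as [u] does not see it. *)
Lemma far_D y : far y -> D w1 y || D w3 y.
Proof.
move=> fy; have Ry := far_rest fy; have [uy ay b_y] := and3P Ry.
have /(walk4P e)[r [q [p [ur rq qp py]]]] := walk4_nonadj G uy.
have nup : ~~ e u p by have /and3P[] : R p by apply: (far_nb fy); rewrite eC.
have [_ _ cov] := Eu; have [aq|bq] := nb_coverP (cov _ ur) rq.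
  have w1p : e w1 p.
    by case: Ea => _ _ /(_ _ aq) sub; case: (nb_coverP sub qp) => // up; rewrite up in nup.
  by rewrite (walk2I w1p py).
have w3p : e w3 p.
  by case: Eb => _ _ /(_ _ bq) sub; case: (nb_coverP sub qp) => // up; rewrite up in nup.
by rewrite (walk2I w3p py) orbT.
Qed.

(** The frame closes up to an 8-cycle through [y]. An edge from [w1] to [z3] or from [w3] to [z1]
    would, by a hexagon, give [u] and [y] a common neighbour. *)
Lemma far_not_both y : far y -> D w1 y -> D w3 y -> False.
Proof.
move=> fy D1 D3; have Ry := far_rest fy; have [uy ay b_y] := and3P Ry.
have [z1y w1b] := rest_D_w1 F Ry D1; have [z3y w3a] := rest_D_w1 F' (R' Ry) D3.
have nuz x : e x y -> ~~ e u x.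
  by move=> xy; apply: contra (rest_no2 F Ry) => ux; apply: walk2I ux xy.
have w1z3 : ~~ e w1 z3.
  apply: contra (nuz _ z3y) => w1z3; rewrite eC.
  by apply: (@no_induced_hexagon _ _ G a w1 z3 w3 b u) => //; rewrite eC.
have w3z1 : ~~ e w3 z1.
  apply: contra (nuz _ z1y) => w3z1; rewrite eC.
  by apply: (@no_induced_hexagon _ _ G b w3 z1 w1 a u) => //; rewrite eC.
have nD : ~~ D w1 w3.
  apply/negP => /existsP[m /andP[w1m mw3]]; have [_ _ /(_ _ w1m) sub] := E1.
  case: (nb_coverP sub mw3) => [aw3|z1w3]; [move: w3a|move: w3z1]; rewrite eC.
    by rewrite aw3.
  by rewrite z1w3.
have nDy := rest_no2 F Ry; have nS := far_no3 fy.
by apply: (@far_vertex8 _ _ G u a b w1 w3 z1 z3 y); rewrite // 1?eC.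
Qed.

(** A neighbour [y0] of [y] missed by [w3] is far as well, on the side of [w1], so the frame closes
    up to a 9-cycle through [y0] and [y]. A 4-walk from [w1] to [y], whose inner vertices all lie in
    the rest, completes the pattern of [far_vertex9]. *)
Lemma far_one_side y : far y -> D w3 y -> ~~ D w1 y -> False.
Proof.
move=> fy D3 nD1; have Ry := far_rest fy; have [uy ay b_y] := and3P Ry.
have [_ nw1 nw3] := and3P fy.
have [z3y w3a] := rest_D_w1 F' (R' Ry) D3.
have [y0 yy0 w3y0] : exists2 y0, e y y0 & ~~ e w3 y0.
  have [/nb_sub_eq/setP/(_ b)|/subsetPn[y0]] := boolP (N y \subset N w3).
    by rewrite !inE [e y b]eC (negbTE b_y) eC bw3.
  by rewrite !inE; exists y0.
have Ry0 := far_nb fy yy0.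
have w1y0 : ~~ e w1 y0 by apply: contra nD1 => w1y0; apply: walk2I w1y0 _; rewrite eC.
have fy0 : far y0 by rewrite /far Ry0 w1y0.
have nD3 : ~~ D w3 y0.
  apply/negP => /existsP[m /andP[w3m my0]]; case/existsP: D3 => m' /andP[w3m' m'y].
  by apply: (@no_pentagon w3 m' y y0 m) => //; rewrite eC.
have D1 : D w1 y0 by have := far_D fy0; rewrite (negbTE nD3) orbF.
have [z1y0 w1b] := rest_D_w1 F Ry0 D1.
have /(walk4P e)[n1 [n2 [n3 [w1n1 n12 n23 n3y]]]] := walk4_nonadj G nw1.
have Rn3 : R n3 by apply: (far_nb fy); rewrite eC.
have un2 : ~~ e u n2 by apply: contra (far_no3 fy) => un2; apply: walk3I un2 n23 n3y.
have an2 : ~~ e a n2.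
  by apply: contra nD1 => an2; apply: walk2I (rest_adj F Rn3 an2 n23) n3y.
have uw1 : ~~ e u w1 by apply/negP => uw1; apply: (no_triangle ua aw1 uw1).
have an1 : ~~ e a n1 by apply/negP => an1; apply: (no_triangle aw1 w1n1 an1).
have bn2 : ~~ e b n2.
  apply/negP => bn2; have [_ _ /(_ _ bn2) sub] := Eb.
  have un1 : e u n1.
    apply: contraT => nun1; have w3n1 : e w3 n1.
      have n21 : e n2 n1 by rewrite eC.
      by case: (nb_coverP sub n21) => // un1; rewrite un1 in nun1.
    have [bn1|nbn1] := boolP (e b n1); first by case: (no_triangle bn1 n12 bn2).
    by case: (@rest_not_both n1) => //; apply/and3P.
  have sN : N a \subset N n1.
    apply/subsetP => x; rewrite !inE => ax; exact: ends_twin Ea un1 w1n1 ax.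
  by move/setP/(_ n2): (nb_sub_eq sN); rewrite !inE n12 (negbTE an2).
have Rn2 : R n2 by apply/and3P.
have un1 : ~~ e u n1 by apply: contra (rest_no2 F Rn2) => un1; apply: walk2I un1 n12.
have bn1 : ~~ e b n1.
  apply/negP => bn1; have [_ _ /(_ _ bn1) sub] := Eb.
  have n1w1 : e n1 w1 by rewrite eC.
  case: (nb_coverP sub n1w1) => [uw|w3w1]; first by rewrite uw in uw1.
  by apply: (@no_pentagon u a w1 w3 b) => //; rewrite eC.
have n1w3 : ~~ e w3 n1.
  by apply/negP => w3n1; apply: (@rest_not_both n1) => //; apply/and3P.
have [[nD0 nD] nD2] := (rest_no2 F Ry0, rest_no2 F Ry, rest_no2 F Rn2).
have [nS0 nS] := (far_no3 fy0, far_no3 fy); have [uy0 _ _] := and3P Ry0.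
by apply: (@far_vertex9 _ _ G u a b w1 w3 z1 z3 y0 y n1 n2 n3);
  rewrite // 1?eC // 1?(walk2C G).
Qed.

End Rest.

Lemma no_far u a b w1 w3 z1 z3 y : frame u a b w1 w3 z1 z3 -> rest u a b y -> e w1 y || e w3 y.
Proof.
move=> F Ry; apply: contraT; rewrite negb_or => n13.
have fy : far u a b w1 w3 y by rewrite /far Ry.
have fy' : far u b a w3 w1 y by rewrite /far -rest_sym Ry [X in _ && X]andbC.
have [D1|nD1] := boolP (D w1 y); have [D3|nD3] := boolP (D w3 y).
- by case: (far_not_both F fy D1 D3).
- by case: (far_one_side (frame_sym F) fy' D1 nD3).
- by case: (far_one_side F fy D3 nD1).
- by have := far_D F fy; rewrite (negbTE nD1) (negbTE nD3).
Qed.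

End Structure.

(* Ordering each block by [kap], neighbourhoods move monotonically along the circle. *)
Record cyclic_order (T : finType) (e : rel T) (blk kap : T -> nat) : Prop := CyclicOrder {
  blk_lt : forall x, blk x < 5;
  blk_adj : forall x y, e x y -> blk y = (blk x + 2) %% 5 \/ blk x = (blk y + 2) %% 5;
  kap_adj2 : forall x x' y, blk x = blk x' -> kap x <= kap x' ->
    blk y = (blk x + 2) %% 5 -> e x' y -> e x y;
  kap_adj3 : forall x x' y, blk x = blk x' -> kap x <= kap x' ->
    blk y = (blk x + 3) %% 5 -> e x y -> e x' y }.

(** * Numbering the blocks and ordering each of them *)

Section Blocks.
Variables (T : finType) (e : rel T).
Hypothesis G : dense_c3c5_free e.

Let eC := adjC G.
Local Notation N := (nb e).

(** Otherwise nestedness at both ends would put [N x'] inside [N x], properly because of [y],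
    against the antichain property. So what is lost towards one end is gained towards the other. *)
Lemma ends_compat w e1 e2 x x' y z : ends e w e1 e2 -> e w x -> e w x' ->
  e e1 y -> e e2 z -> e x y -> e x z -> e x' y || e x' z.
Proof.
move=> en wx wx' e1y e2z xy xz; apply: contraT; rewrite negb_or => /andP[nx'y nx'z].
suff /(nb_sub_eq G)/setP/(_ y) : N x' \subset N x by rewrite !inE xy (negbTE nx'y).
have [_ _ /(_ _ wx') sub] := en; apply/subsetP => t; rewrite !inE => x't.
case: (nb_coverP sub x't) => [e1t|e2t].
  by have := ends_nested G en wx wx' e1y e1t xy x't; rewrite (negbTE nx'y) orbF.
by have := ends_nested G (ends_sym en) wx wx' e2z e2t xz x't; rewrite (negbTE nx'z) orbF.
Qed.

Section Frame.
Variables u a b w1 w3 z1 z3 : T.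
Hypothesis F : frame e u a b w1 w3 z1 z3.
Local Notation R := (rest e u a b).
Let F' := frame_sym F.

Let Eu := ends_u F.
Let Ea := ends_a F.
Let Eb := ends_b F.
Let E1 := ends_w1 F.
Let E3 := ends_w3 F.

(** Along the path [w1], [a], [u], [b], [w3] the neighbourhoods get the numbers 1, 4, 2, 0, 3,
    decreasing by two modulo 5. Twins of [u], seen by both [a] and [b], go with [N a]. *)
Definition block x :=
  if e u x then 2 else if e a x then 4 else if e b x then 0 else if e w1 x then 1 else 3.

Variant block_spec x : nat -> Prop :=
  | Block0 of e b x & ~~ e a x : block_spec x 0
  | Block1 of R x & e w1 x & ~~ e w3 x : block_spec x 1
  | Block2 of e u x : block_spec x 2
  | Block3 of R x & e w3 x & ~~ e w1 x : block_spec x 3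
  | Block4 of e a x : block_spec x 4.

Lemma blockP x : block_spec x (block x).
Proof.
rewrite /block; case: ifPn => ux; first by constructor.
case: ifPn => ax; first by constructor.
case: ifPn => bx; first by constructor.
have Rx : R x by apply/and3P.
case: ifPn => w1x; constructor => //.
  by apply/negP => /(rest_not_both G F Rx w1x).
by have := no_far G F Rx; rewrite (negbTE w1x).
Qed.

Let ends_adj v c d x y : ends e v c d -> e v x -> e x y -> ~~ e c y -> e d y.
Proof.
by case=> _ _ cov vx xy ncy; case: (nb_coverP (cov _ vx) xy) => // cy; rewrite cy in ncy.
Qed.

Lemma block_adj x y : e x y ->
  block y = (block x + 2) %% 5 \/ block x = (block y + 2) %% 5.
Proof.
suff main x' y' : e x' y' -> block x' <= block y' ->
    block y' = (block x' + 2) %% 5 \/ block x' = (block y' + 2) %% 5.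
  move=> xy; have [le|lt] := leqP (block x) (block y); first exact: main.
  by rewrite eC in xy; case: (main _ _ xy (ltnW lt)); [right|left].
move: x' y' => {}x {}y xy.
have [ua ub _] := Eu; have [au aw1 _] := Ea; have [bu bw3 _] := Eb.
have same v : e v x -> e v y -> False by move=> vx; apply: (no_triangle G vx xy).
case: (blockP x) => [bx nax|Rx w1x w3x|ux|Rx w3x w1x|ax];
  case: (blockP y) => [b_y nay|Ry w1y w3y|uy|Ry w3y w1y|ay] // _;
  try by [left | right]; exfalso.
- exact: same bx b_y.
- by rewrite rest_sym in Ry; rewrite (rest_adj F' Ry bx xy) in w3y.
- by apply: (@no_pentagon _ _ G u b x y a) => //; rewrite eC.
- exact: same w1x w1y.
- by case/negP: (rest_no2 F Rx); apply: walk2I uy _; rewrite eC.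
- exact: same ux uy.
- by case/negP: (rest_no2 F Ry); apply: walk2I ux _.
- exact: same w3x w3y.
- by rewrite eC in xy; rewrite (rest_adj F Rx ay xy) in w1x.
- exact: same ax ay.
Qed.

Lemma block_nested x x' y y' : block x = block x' -> block y = (block x + 2) %% 5 ->
  block y' = (block x + 2) %% 5 -> e x y -> e x' y' -> e x y' || e x' y.
Proof.
have nua := ends_nested G Eu; have nub := ends_nested G (ends_sym Eu).
have naw := ends_nested G (ends_sym Ea); have nbw := ends_nested G (ends_sym Eb).
have nwz := ends_nested G (ends_sym E1).
case: (blockP x) => [bx nax|Rx w1x _|ux|Rx w3x _|ax];
  case: (blockP x') => [bx' nax'|Rx' w1x' _|ux'|Rx' w3x' _|ax'] // _;
  case: (blockP y) => [b_y nay|Ry w1y _|uy|Ry w3y _|ay] // _;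
  case: (blockP y') => [b_y' nay'|Ry' w1y' _|uy'|Ry' w3y' _|ay'] // _ xy xy'.
- exact: (nested_sym G nub) xy xy'.
- have [_ nay _] := and3P Ry; have [_ nay' _] := and3P Ry'.
  have z1y := ends_adj E1 w1x xy nay; have z1y' := ends_adj E1 w1x' xy' nay'.
  exact: nwz xy xy'.
- exact: nua xy xy'.
- exact: (nested_sym G nbw) xy xy'.
- exact: naw xy xy'.
Qed.

Lemma block_compat x x' y z : block x = block x' -> block y = (block x + 2) %% 5 ->
  block z = (block x + 3) %% 5 -> e x y -> e x z -> e x' y || e x' z.
Proof.
case: (blockP x) => [bx nax|Rx w1x _|ux|Rx w3x _|ax];
  case: (blockP x') => [bx' nax'|Rx' w1x' _|ux'|Rx' w3x' _|ax'] // _;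
  case: (blockP y) => [b_y nay|Ry w1y _|uy|Ry w3y _|ay] // _;
  case: (blockP z) => [bz naz|Rz w1z _|uz|Rz w3z _|az] // _ xy xz.
- exact: ends_compat Eb bx bx' uy w3z xy xz.
- have [_ nay _] := and3P Ry; have z1y := ends_adj E1 w1x xy nay.
  exact: ends_compat (ends_sym E1) w1x w1x' z1y az xy xz.
- exact: ends_compat Eu ux ux' ay bz xy xz.
- have [_ _ nbz] := and3P Rz; have z3z := ends_adj E3 w3x xz nbz.
  exact: ends_compat E3 w3x w3x' b_y z3z xy xz.
- exact: ends_compat (ends_sym Ea) ax ax' w1y uz xy xz.
Qed.

Definition side x k := [set y in N x | block y == (block x + k) %% 5].

(** Position inside the block: further on, neighbours in the block at offset 2 disappear and those
    at offset 3 appear. Both traces form chains, so their sizes measure this, and [block_compat]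
    makes the two measures agree. *)
Definition kappa x := #|side x 3| + (#|T| - #|side x 2|).

Lemma frame_order : cyclic_order e block kappa.
Proof.
split.
- by move=> x; case: blockP.
- exact: block_adj.
- move=> x x' y bx le by2 x'y; apply: contraT => nxy.
  have lt2 : #|side x 2| < #|side x' 2|.
    apply: proper_card; apply/properP; split; last first.
      by exists y; rewrite !inE ?x'y -?bx ?by2 ?eqxx // (negbTE nxy).
    apply/subsetP => t; rewrite !inE => /andP[xt /eqP bt]; rewrite -bx bt eqxx andbT.
    by have := block_nested bx bt by2 xt x'y; rewrite (negbTE nxy).
  (* Seeing less than [x'] at offset 2 without having larger [kappa], [x] must miss some [z] seen by
     [x'] at offset 3; missing both [y] and [z] contradicts [block_compat]. *)
  have [z] : exists z, z \in side x' 3 :\: side x 3.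
    apply/set0Pn; rewrite setD_eq0; apply: contraTN le => /subset_leq_card.
    by have := max_card (side x' 2); rewrite /kappa; lia.
  rewrite !inE negb_and -bx => /andP[+ /andP[x'z /eqP bz]]; rewrite bz eqxx orbF => nxz.
  by have := block_compat (esym bx) _ _ x'y x'z; rewrite -bx (negbTE nxy) (negbTE nxz); apply.
- move=> x x' y bx le by3 xy; apply: contraT => nx'y.
  have lt3 : #|side x' 3| < #|side x 3|.
    apply: proper_card; apply/properP; split; last first.
      by exists y; rewrite !inE ?xy -?bx ?by3 ?eqxx // (negbTE nx'y).
    apply/subsetP => t; rewrite !inE -bx => /andP[x't /eqP bt]; rewrite bt eqxx andbT.
    have : e y x' || e t x; last by rewrite eC (negbTE nx'y) /= eC.
    apply: block_nested; rewrite 1?eC // ?by3 ?bt // modnDml -?bx -addnA.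
      by rewrite modnDr modn_small //; case: blockP.
    by rewrite modnDr modn_small //; case: blockP.
  have [z] : exists z, z \in side x 2 :\: side x' 2.
    apply/set0Pn; rewrite setD_eq0; apply: contraTN le => /subset_leq_card.
    by have := max_card (side x' 2); rewrite /kappa; lia.
  rewrite !inE negb_and -bx => /andP[+ /andP[xz /eqP bz]]; rewrite bz eqxx orbF => nx'z.
  by have := block_compat bx bz by3 xz xy; rewrite (negbTE nx'z) (negbTE nx'y).
Qed.

End Frame.

Lemma cyclic_order_exists : exists blk kap, cyclic_order e blk kap.
Proof.
have [u _|T0] := pickP (fun _ : T => true).
  have [a [b [w1 [w3 [z1 [z3 F]]]]]] := frame_exists G u.
  by eexists; eexists; apply: frame_order F.
by exists (fun _ => 0), (fun _ => 0); split=> // x; have := T0 x.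
Qed.

End Blocks.

(** * The circular order of the vertices *)

Definition indep_between (T : Type) (e : rel T) (X : nat -> T) p q :=
  forall j k, p <= j -> j <= k -> k <= q -> ~~ e (X j) (X k).

Record circular (T : finType) (e : rel T) (X : nat -> T) : Prop := Circular {
  circ_period : forall i, X (i + #|T|) = X i;
  circ_perm : perm_eq [seq X i | i <- iota 0 #|T|] (enum T);
  circ_arc : forall i l, i < l -> l < i + #|T| -> ~~ e (X i) (X l) ->
    indep_between e X i l \/ indep_between e X l (i + #|T|) }.

Section Circle.
Variables (T : finType) (e : rel T) (blk kap : T -> nat).
Hypotheses (eC : symmetric e) (eI : irreflexive e) (O : cyclic_order e blk kap).

Definition before x y := (blk x < blk y) || (blk x == blk y) && (kap x <= kap y).

Lemma before_total : total before.
Proof. by move=> x y; rewrite /before; lia. Qed.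

Lemma before_trans : transitive before.
Proof. by move=> y x z; rewrite /before; lia. Qed.

Lemma arc_monotone x y z t : blk x = blk y -> blk z = blk t -> blk z = (blk x + 2) %% 5 ->
  before x y -> before z t -> e y z -> e x t.
Proof.
rewrite /before => bxy bzt bz2 xy zt yz.
have kxy : kap x <= kap y by lia.
have kzt : kap z <= kap t by lia.
have xz : e x z := kap_adj2 O bxy kxy bz2 yz.
have bx3 : blk x = (blk z + 3) %% 5.
  by rewrite bz2 modnDml -addnA modnDr modn_small ?(blk_lt O).
by rewrite eC; apply: (kap_adj3 O bzt kzt bx3); rewrite eC.
Qed.

Variable x0 : T.
Let n := #|T|.
Let s := sort before (enum T).
Definition circle i := nth x0 s (i %% n).
Local Notation X := circle.

Let size_s : size s = n. Proof. by rewrite size_sort -cardE. Qed.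
Let n_gt0 : 0 < n. Proof. by apply/card_gt0P; exists x0. Qed.

Lemma circle_period i : X (i + n) = X i.
Proof. by rewrite /circle modnDr. Qed.

Lemma circle_before i j : i <= j -> j < n -> before (X i) (X j).
Proof.
move=> ij jn; rewrite /circle !modn_small ?(leq_ltn_trans ij jn) //.
apply: (sorted_leq_nth before_trans) => //; rewrite ?inE ?size_s //.
- by move=> x; have := before_total x x; rewrite orbb.
- exact: (sort_sorted before_total).
- exact: leq_ltn_trans ij jn.
Qed.

(** If the ends of an arc are at most two blocks apart, an edge inside it can only join the blocks
    of the two ends, and [arc_monotone] carries it to the ends themselves. Otherwise the
    complementary arc, passing position 0, is the short one. *)
Lemma circle_arc0 p q : p < q -> q < n -> ~~ e (X p) (X q) ->
  indep_between e X p q \/ indep_between e X q (p + n).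
Proof.
move=> pq qn npq.
have [bp bq] := (blk_lt O (X p), blk_lt O (X q)).
have pq_le : before (X p) (X q) := circle_before (ltnW pq) qn.
have [small|large] := leqP (blk (X q)) (blk (X p) + 2); [left|right] => j k.
  move=> pj jk kq; apply: contra npq => ejk.
  have pj_le : before (X p) (X j) := circle_before pj (leq_ltn_trans (leq_trans jk kq) qn).
  have jk_le : before (X j) (X k) := circle_before jk (leq_ltn_trans kq qn).
  have kq_le : before (X k) (X q) := circle_before kq qn.
  rewrite /before in pq_le pj_le jk_le kq_le.
  have adj := blk_adj O ejk; have [bj bk] := (blk_lt O (X j), blk_lt O (X k)).
  by apply: (@arc_monotone _ (X j) (X k)) => //; rewrite /before; lia.
have wrap i : q <= i -> i <= p + n ->
    before (X q) (X i) /\ i < n \/ before (X i) (X p) /\ n <= i.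
  move=> qi ip; have [lt|ge] := ltnP i n; [left|right]; split=> //.
    exact: circle_before.
  by rewrite -(subnK ge) circle_period; apply: circle_before; lia.
move=> qj jk kp; apply: contra npq => ejk.
have adj := blk_adj O ejk; have [bj bk] := (blk_lt O (X j), blk_lt O (X k)).
rewrite eC; rewrite /before in pq_le.
case: (wrap j) => //; first lia; case: (wrap k) => //; rewrite ?(leq_trans qj jk) //;
  rewrite /before => -[w1 w2] -[w3 w4]; try by exfalso; lia.
by apply: (@arc_monotone _ (X j) (X k)) => //; rewrite /before; lia.
Qed.

Lemma circle_shift c i : X (c * n + i) = X i.
Proof. by rewrite /circle modnMDl. Qed.

Lemma circle_circular : circular e X.
Proof.
split; first exact: circle_period.
  rewrite -/n; have -> : [seq X i | i <- iota 0 n] = s; last by rewrite perm_sort.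
  rewrite -[RHS](mkseq_nth x0) /mkseq size_s; apply/eq_in_map => i.
  by rewrite mem_iota /= add0n => lt; rewrite /circle modn_small.
move=> i l il lin; rewrite -/n in lin *.
have shift c p q : indep_between e X p q -> indep_between e X (c * n + p) (c * n + q).
  move=> ind j k pj jk kq; rewrite -[j](@subnKC (c * n)); last by lia.
  by rewrite -[k](@subnKC (c * n)) ?circle_shift; [apply: ind; lia|lia].
have e_i := divn_eq i n; have r_i := ltn_pmod i n_gt0.
move: (i %/ n) (i %% n) e_i r_i => c r -> {i} rn in il lin *.
have e_l := subnKC (ltnW (leq_ltn_trans (leq_addr r _) il)).
move: (l - c * n) e_l => t e_l; rewrite -{}e_l {l} in il lin *.
rewrite !circle_shift -addnA => nrt.
have [tn|nt] := ltnP t n.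
  by case: (@circle_arc0 r t) => [||//|ind|ind]; [lia|lia|left|right]; apply: shift.
have nrt' : ~~ e (X (t - n)) (X r) by rewrite -(circle_period (t - n)) subnK // eC.
case: (@circle_arc0 (t - n) r) => [||//|ind|ind]; [lia|lia|right|left].
  rewrite -[t](subnK nt) ![_ + n]addnC ![c * n + (n + _)]addnA -mulSnr.
  exact: shift.
by rewrite subnK // in ind; apply: shift.
Qed.

End Circle.

(** * Sliding a half-circle window *)

Lemma sum_period (n : nat) (f : nat -> nat) m :
  (forall i, f (i + n) = f i) -> \sum_(i < n) f (m + i) = \sum_(i < n) f i.
Proof.
move=> per; elim: m => [//|m <-]; case: n per => [|n] per; first by rewrite !big_ord0.
rewrite big_ord_recr big_ord_recl /= addn0 addnC; congr (_ + _).
  by rewrite -(per m) addSnnS.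
by apply: eq_bigr => i _; rewrite addSnnS.
Qed.

(* Cycle-lemma argument: start at the largest value of [sum_(i < k) f i - c * k]. *)
Lemma tile (n c : nat) (f : nat -> nat) : 0 < n -> (forall i, f (i + n) = f i) ->
  (forall k, exists2 J, 0 < J <= n & c * J < \sum_(i < J) f (k + i)) ->
  c * n < \sum_(i < n) f i.
Proof.
move=> n0 per win; rewrite ltnNge; apply/negP => le.
(* The term [2 * n] keeps the truncated subtraction exact: [k + J] stays below [2 * n]. *)
pose P k := \sum_(i < k) f i; pose Q k := P k + c * (2 * n - k).
have PD k J : P (k + J) = P k + \sum_(i < J) f (k + i) by rewrite /P big_split_ord.
have [k _ mx] := @arg_maxnP _ (Ordinal n0) xpredT (fun i : 'I_n => Q i) isT.
have [J /andP[J0 Jn] gt] := win k; have ltk := ltn_ord k.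
have QJ : Q k < Q (k + J) by rewrite /Q PD; nia.
have [lt|ge] := ltnP (k + J) n.
  by have le' : Q (k + J) <= Q k := mx (Ordinal lt) isT; lia.
have lt : k + J - n < n by lia.
have le' : Q (k + J - n) <= Q k := mx (Ordinal lt) isT.
have eP : P (k + J) = P (k + J - n) + P n.
  by rewrite -{1}(subnK ge) PD sum_period.
rewrite /Q eP -/(P n) in le le' QJ *; nia.
Qed.

Lemma sum_square m (g : nat -> nat -> nat) :
  (forall i j, g i j = g j i) -> (forall i, g i i = 0) ->
  \sum_(i < m) \sum_(j < m) g i j = 2 * \sum_(a < m) \sum_(d < m.-1 - a) g a (a + d.+1).
Proof.
move=> gC g0; elim: m => [|m IH]; first by rewrite !big_ord0.
rewrite big_ord_recr /= [X in _ + X]big_ord_recr /= g0 addn0.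
under [X in _ + X]eq_bigr => j _ do rewrite gC.
under eq_bigr => i _ do rewrite big_ord_recr /=.
rewrite big_split /= IH -addnA addnn -mul2n -mulnDr; congr (_ * _).
rewrite [RHS]big_ord_recr /= subnn big_ord0 addn0 -big_split; apply: eq_bigr => i _ /=.
have lti := ltn_ord i; have -> : m - i = (m.-1 - i).+1 by lia.
by rewrite big_ord_recr /=; congr (_ + g _ _); lia.
Qed.

Section Chain.
Variables (T : finType) (e : rel T) (X : nat -> T).
Hypotheses (eC : symmetric e) (eI : irreflexive e) (C : circular e X).
Let n := #|T|.
Let h := n./2.

(** Ordered pairs are counted, hence every edge twice, and 98 becomes 49. *)
Definition cost (A : {set T}) := \sum_(x in A) \sum_(y in A) (e x y : nat).

Hypothesis half_cost : forall A : {set T}, #|A| = h -> n ^ 2 < 49 * cost A.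

Let per : forall i, X (i + n) = X i := circ_period C.

Lemma sum_circle (g : T -> nat) m : \sum_(y : T) g y = \sum_(i < n) g (X (m + i)).
Proof.
rewrite (@sum_period n (fun i => g (X i))) => [|i]; last by rewrite per.
rewrite -[LHS]big_enum /= -(perm_big _ (circ_perm C)) big_map /=.
by rewrite -/n -[X in iota _ X]subn0 -/(index_iota _ _) big_mkord.
Qed.

Lemma circle_inj m i j : i < n -> j < n -> X (m + i) = X (m + j) -> i = j.
Proof.
move=> lti ltj eqX; apply/eqP; apply: contraT => ne; exfalso.
have := sum_circle (fun y => y == X (m + i)) m.
rewrite (bigD1 (X (m + i))) //= eqxx big1 => [|y /negbTE->] //.
rewrite (bigD1 (Ordinal lti)) //= eqxx (bigD1 (Ordinal ltj)) /= ?eqX ?eqxx //.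
by apply: contra ne => /eqP[->].
Qed.

Definition window m k := [set X (m + i) | i : 'I_k].

Lemma window_inj m k : k <= n -> injective (fun i : 'I_k => X (m + i)).
Proof.
move=> kn i j /circle_inj eq; apply: val_inj; apply: eq; exact: leq_trans kn.
Qed.

Lemma card_window m k : k <= n -> #|window m k| = k.
Proof. by move=> kn; rewrite card_imset ?card_ord //; apply: window_inj. Qed.

Lemma sum_window m k (g : T -> nat) : k <= n ->
  \sum_(y in window m k) g y = \sum_(i < k) g (X (m + i)).
Proof. by move=> kn; rewrite big_imset //= => i j _ _; apply: window_inj. Qed.

Lemma cost_indep (A : {set T}) : {in A &, forall x y, ~~ e x y} -> #|A| < h.
Proof.
move=> ind; rewrite ltnNge; apply/negP => hA.
have [B subB cardB] : exists2 B : {set T}, B \subset A & #|B| = h.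
  have /card_gt0P[B] : 0 < #|[set B : {set T} | B \subset A & #|B| == h]|.
    by rewrite cards_draws bin_gt0.
  by rewrite inE => /andP[sB /eqP]; exists B.
have := half_cost cardB; rewrite /cost big1 ?muln0 // => x xB; rewrite big1 // => y yB.
by rewrite (negbTE (ind x y _ _)) // (subsetP subB).
Qed.

Lemma h_ge2 : 1 < h.
Proof.
have [x|T0] := pickP (fun _ : T => true); last first.
  have n0 : n = 0 by apply: eq_card0.
  have : #|set0 : {set T}| < h by apply: cost_indep => x; rewrite inE.
  by rewrite /h n0.
suff: #|[set x]| < h by rewrite cards1.
by apply: cost_indep => y z /set1P-> /set1P->; rewrite eI.
Qed.

Let h_le : h <= n. Proof. by rewrite /h; lia. Qed.

Lemma indep_between_window m k : indep_between e X m (m + k) -> k < n -> k.+1 < h.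
Proof.
move=> ind kn; rewrite -(@card_window m k.+1) //; apply: cost_indep => x y.
move=> /imsetP[i _ ->] /imsetP[j _ ->].
have [ij|/ltnW ji] := leqP i j; last rewrite eC.
  by apply: ind; have := ltn_ord j; lia.
by apply: ind; have := ltn_ord i; lia.
Qed.

(** If the edge were missing, one of the two arcs between [X i] and [X l] would be independent; but
    one contains the edge [X j X k] and the other has more than [h] vertices. *)
Lemma expand i j k l : i <= j -> j < k -> k <= l -> l < i + h -> e (X j) (X k) -> e (X i) (X l).
Proof.
move=> ij jk kl lih ejk; apply: contraT => nil.
have [||ind|ind] := circ_arc C _ _ nil; [lia|rewrite -/n; lia| |].
  by have := ind j k ij (ltnW jk) kl; rewrite ejk.
have := @indep_between_window l (i + n - l); rewrite subnKC; last by lia.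
by move=> /(_ ind); lia.
Qed.

(** Both arcs between the two vertices have more than [h] vertices, too many to be independent. *)
Lemma antipodal i : e (X i) (X (i + h)).
Proof.
have h2 := h_ge2; apply: contraT => nil.
have [||ind|ind] := circ_arc C _ _ nil; [lia|rewrite -/n; lia| |].
  by have := indep_between_window ind; lia.
have := @indep_between_window (i + h) (n - h); rewrite -addnA subnKC //.
by move=> /(_ ind); lia.
Qed.

Definition forward k := \sum_(d < h.-1) (e (X k) (X (k + d.+1)) : nat).

Lemma forward_period k : forward (k + n) = forward k.
Proof. by apply: eq_bigr => d _; rewrite per addnAC per. Qed.

Definition ahead k a := \sum_(d < h.-1 - a) (e (X (k + a)) (X (k + a + d.+1)) : nat).

(** By [expand], a vertex that sees the last vertex of the window sees everything beyond it within
    reach, exactly [a] vertices; one that does not sees nothing ahead in the window. *)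
Lemma ahead_forward k a : a < h ->
  (e (X (k + a)) (X (k + h.-1)) -> forward (k + a) = ahead k a + a) /\
  (~~ e (X (k + a)) (X (k + h.-1)) -> ahead k a = 0).
Proof.
move=> ah; split=> adj.
  have eh : h.-1 = (h.-1 - a) + a by rewrite subnK //; lia.
  rewrite /forward eh big_split_ord /=; congr (_ + _).
  transitivity (\sum_(i < a) 1); last by rewrite sum1_card card_ord.
  apply: eq_bigr => i _; apply/eqP; rewrite eqb1; have lti := ltn_ord i.
  have [ha|ha] := eqVneq (h.-1) a.
    by rewrite -ha eI in adj.
  by apply: (@expand _ (k + a) (k + h.-1)) adj; lia.
rewrite /ahead big1 // => d _; apply/eqP; rewrite eqb0; apply: contra adj => adj.
have ltd := ltn_ord d.
by apply: expand adj; lia.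
Qed.

Lemma cost_window k : cost (window k h) = 2 * \sum_(a < h) ahead k a.
Proof.
rewrite /cost sum_window //.
under eq_bigr => i _ do rewrite sum_window //.
rewrite (@sum_square _ (fun i j => nat_of_bool (e (X (k + i)) (X (k + j))))) => [|i j|i].
- by congr (_ * _); apply: eq_bigr => a _; apply: eq_bigr => d _; rewrite addnA.
- by rewrite eC.
- by rewrite eI.
Qed.

(* Here [14 * n * J <= n ^ 2 + 49 * J ^ 2] turns the quadratic bound on the cost of a
   window into a linear one. *)
Lemma forward_tile k :
  exists2 J, 0 < J <= n & (2 * n - 7) * J < \sum_(i < J) 14 * forward (k + i).
Proof.
have h2 := h_ge2; pose B a := e (X (k + a)) (X (k + h.-1)).
have exB : exists a, ~~ B a by exists h.-1; rewrite /B eI.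
(* The first [J] vertices of the window see its last vertex and, by [expand], no later one does, so
   only these have neighbours ahead in the window. *)
case: (ex_minnP exB) => J nBJ minJ.
have Jh : J < h by have := minJ h.-1; rewrite /B eI; lia.
have BJ a : a < J -> B a.
  by move=> aJ; apply: contraLR aJ; rewrite -leqNgt => /minJ.
have nB a : J <= a -> a < h -> ~~ B a.
  move=> Ja ah; apply: contra nBJ; rewrite /B => adj.
  have [ea|ne] := eqVneq a h.-1; first by rewrite ea eI in adj.
  by apply: (expand _ _ _ _ adj); lia.
have split_sum : \sum_(a < h) ahead k a = \sum_(a < J) ahead k a.
  rewrite -!(big_mkord xpredT (ahead k)) (big_cat_nat (leq0n J) (ltnW Jh)) /=.
  rewrite [X in _ + X]big_nat [X in _ + X]big1 ?addn0 // => i /andP[Ji ih].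
  by apply: (ahead_forward k ih).2; apply: nB.
have sum_id m : 2 * \sum_(i < m) i + m = m * m.
  elim: m => [|m]; first by rewrite big_ord0.
  by rewrite big_ord_recr /=; move: (\sum_(i < m) i) => t; nia.
have eqF : \sum_(a < J) forward (k + a) = \sum_(a < J) ahead k a + \sum_(a < J) a.
  rewrite -big_split; apply: eq_bigr => a _ /=.
  have lt := ltn_ord a; apply: (ahead_forward k _).1; [lia|exact: BJ].
have := half_cost (card_window k h_le); rewrite cost_window split_sum => gt.
exists J; first by case: (posnP J) gt => [->|J0 _]; rewrite ?big_ord0; lia.
rewrite -big_distrr /= eqF mulnBl; move: gt (sum_id J).
move: (\sum_(a < J) ahead k a) (\sum_(a < J) a) => A S.
have : 14 * (n * J) <= n * n + 49 * (J * J).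
  by have [le _] := nat_Cauchy n (7 * J); rewrite -!mulnn in le; lia.
rewrite !expnS expn0; lia.
Qed.

Lemma deg_sum x : degree e x = \sum_y (e x y : nat).
Proof.
rewrite /degree -sum1_card [LHS]big_mkcond /=; apply: eq_bigr => t _.
by rewrite inE; case: (e _ _).
Qed.

(** Neighbours in reach ahead and behind have the same sum around the circle. The term [n] comes
    from the antipodes and offsets exactly the [- 7] in [forward_tile]. *)
Lemma sum_deg : 2 * \sum_(k < n) forward k + n <= \sum_x degree e x.
Proof.
have h2 := h_ge2.
pose L k := forward k + 1 + \sum_(d < h.-1) (e (X k) (X (k + (n - d.+1))) : nat).
have lower k : L k <= degree e (X k).
  rewrite deg_sum (sum_circle _ k).
  (* Positions as seen from [X k]: itself and the [h - 1] vertices ahead, the antipode, one skipped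
     vertex for odd [n], and the [h - 1] vertices behind. *)
  have -> : n = (h.-1.+1 + (1 + (n - 2 * h + h.-1))) by rewrite /h; lia.
  rewrite big_split_ord big_ord_recl /= -[leqLHS]addnA leq_add //; first exact: leq_addl.
  rewrite big_split_ord big_ord_recl big_ord0 /= addn0 leq_add //.
    by rewrite addn0 prednK ?antipodal //; lia.
  rewrite big_split_ord /= (leq_trans _ (leq_addl _ _)) //.
  rewrite (reindex_inj rev_ord_inj) /=; apply: leq_sum => i _; have := ltn_ord i => lti.
  by apply: eq_leq; congr (nat_of_bool (e _ (X (_ + _)))); rewrite /h in lti *; lia.
rewrite (sum_circle _ 0); under [leqRHS]eq_bigr => k _ do rewrite add0n.
apply: (@leq_trans (\sum_(k < n) L k)); last by apply: leq_sum => k _; apply: lower.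
rewrite /L !big_split /= sum1_card card_ord mul2n -addnn addnAC leq_add2l.
rewrite exchange_big [leqRHS]exchange_big /=; apply: leq_sum => d _.
have dn : d.+1 <= n by have := ltn_ord d; rewrite /h; lia.
rewrite -[leqRHS](@sum_period n (fun k => (e (X k) (X (k + (n - d.+1))) : nat)) d.+1) => [|i].
  apply: leq_sum => k _; have -> : d.+1 + k + (n - d.+1) = k + n by lia.
  by rewrite per [d.+1 + k]addnC eC.
by rewrite per addnAC per.
Qed.

(** The average of [deg u + deg v] over the edges is at least twice the average degree, which
    exceeds [2 n / 7]. *)
Lemma dense_edge : exists u v, e u v /\ 4 * n <= 7 * (degree e u + degree e v).
Proof.
have n0 : 0 < n by have := h_ge2; rewrite /h; lia.
have Phi : (2 * n - 7) * n < \sum_(i < n) 14 * forward i.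
  by apply: (@tile n _ (fun i => 14 * forward i) n0 _ forward_tile) => i; rewrite forward_period.
have sd := sum_deg; rewrite -big_distrr /= in Phi.
have big : 2 * (n * n) < 7 * \sum_x degree e x.
  move: Phi sd; rewrite mulnBl; move: (\sum_(i < n) forward i) (\sum_x degree e x) => F s; lia.
have [|] := boolP [exists u, exists v, e u v && (4 * n <= 7 * (degree e u + degree e v))].
  by case/existsP=> u /existsP[v /andP[uv le]]; exists u, v.
rewrite negb_exists => /forallP small; exfalso.
have le1 x y : 7 * (e x y * (degree e x + degree e y)) <= 4 * n * e x y.
  have := small x; rewrite negb_exists => /forallP/(_ y); case: (e x y) => //=; lia.
have le2 : 7 * \sum_x \sum_y e x y * (degree e x + degree e y) <= 4 * n * \sum_x degree e x.
  rewrite !big_distrr /=; apply: leq_sum => x _; rewrite [X in _ <= _ * X]deg_sum !big_distrr /=.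
  by apply: leq_sum => y _; apply: le1.
have sum2 : \sum_x \sum_y e x y * (degree e x + degree e y) = 2 * \sum_x degree e x * degree e x.
  under eq_bigr => x _ do (under eq_bigr => y _ do rewrite mulnDr; rewrite big_split /=).
  rewrite big_split /= mul2n -addnn; congr (_ + _).
    by apply: eq_bigr => x _; rewrite -big_distrl -deg_sum.
  rewrite exchange_big; apply: eq_bigr => x _; rewrite -big_distrl {2}deg_sum.
  by congr (_ * _); apply: eq_bigr => y _; rewrite eC.
(* Cauchy-Schwarz in tangent form, exact for degree [2 n / 7]. *)
have amgm : 28 * n * \sum_x degree e x <= 49 * \sum_x degree e x * degree e x + 4 * n * n * n.
  have -> : 4 * n * n * n = \sum_(x : T) 4 * n * n by rewrite sum_nat_const [RHS]mulnC.
  rewrite !big_distrr -big_split /=; apply: leq_sum => x _.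
  have [le _] := nat_Cauchy (7 * degree e x) (2 * n); rewrite -!mulnn in le.
  by move: (degree e x) le => d; lia.
rewrite sum2 in le2; suff : n * (7 * \sum_x degree e x) <= n * (2 * (n * n)).
  by rewrite leq_pmul2l // leqNgt big.
move: le2 amgm; move: (\sum_x degree e x) (\sum_x degree e x * degree e x) => s q; lia.
Qed.

End Chain.

(** * Eight classes around an edge of large degree sum *)

Import Order.TTheory GRing.Theory Num.Theory.

(** * Inequalities between the shares of the classes *)

Section RealEstimates.
Local Open Scope ring_scope.
Variable F : realFieldType.

(* Writing [x2 = b + e5 + y2] and [x4 = b + e1 + y4] with [b = 1 / (98 c)], the last two
   densities add up to an expression that is linear in [y2 + y4]; its value is at most [1 / 49]
   at both ends of the range left by the total weight. *)
Lemma estimate_far (c d s1 s5 x0 x2 x4 x6 : F) :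
  0 <= x0 -> 0 <= x6 -> 0 <= d -> d <= s1 -> d <= s5 -> s1 + s5 = c + d ->
  1 / 98 < c * (s1 + x2 - c) -> 1 / 98 < c * (s5 + x4 - c) ->
  1 / 98 < x0 * d + (s1 - d) * (x2 + d) -> 1 / 98 < x6 * d + (s5 - d) * (x4 + d) ->
  x0 + x2 + x4 + x6 + c + d <= 3 / 7 -> False.
Proof.
move=> x0p x6p dp ds1 ds5 ssum h3 h4 h5 h6 h7.
have cp : 0 < c.
  have : 0 <= c by lra.
  by rewrite le0r => /orP[/eqP c0|//]; rewrite c0 mul0r in h3; lra.
pose b := (98 * c)^-1; have cb : c * b = 1 / 98 by rewrite /b; field; lra.
have bp : 0 < b by rewrite invr_gt0; lra.
pose e1 := s1 - d; pose e5 := s5 - d; pose m := c - d.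
have e1p : 0 <= e1 by rewrite /e1; lra.
have e5p : 0 <= e5 by rewrite /e5; lra.
have esum : e1 + e5 = m by rewrite /e1 /e5 /m; lra.
have k2 : 0 < x2 - b - e5.
  have : 0 < c * (x2 - b - e5).
    have -> : x2 - b - e5 = s1 + x2 - c - b by rewrite /e5; lra.
    lra.
  by rewrite pmulr_rgt0.
have k4 : 0 < x4 - b - e1.
  have : 0 < c * (x4 - b - e1).
    have -> : x4 - b - e1 = s5 + x4 - c - b by rewrite /e1; lra.
    lra.
  by rewrite pmulr_rgt0.
set y2 := x2 - b - e5 in k2; set y4 := x4 - b - e1 in k4.
pose Z := 3 / 7 - 2 * c - 2 * b; pose k := y2 + y4.
have kZ : x0 + x6 <= Z - k by rewrite /Z /k /y2 /y4 /e1 /e5; lra.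
have k0 : 0 < k by rewrite /k; lra.
have Zp : 0 < Z by lra.
have mp : 0 <= m by lra.
have mc : m <= c by rewrite /m; lra.
have big : 2 * (c * b) < d * (Z - k) + m * b + m ^+ 2 / 2 + m * k + m * d.
  have dk : d * (x0 + x6) <= d * (Z - k) by apply: ler_wpM2l.
  have ee : 2 * (e1 * e5) <= m ^+ 2 / 2 by rewrite -esum; have := sqr_ge0 (e1 - e5); lra.
  have ek : e1 * y2 + e5 * y4 <= m * k.
    rewrite -esum /k; have := mulr_ge0 e1p (ltW k4); have := mulr_ge0 e5p (ltW k2); lra.
  have eq : x0 * d + e1 * (x2 + d) + (x6 * d + e5 * (x4 + d)) =
      d * (x0 + x6) + m * b + 2 * (e1 * e5) + (e1 * y2 + e5 * y4) + m * d.
    by rewrite -esum /y2 /y4; ring.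
  rewrite -/e1 -/e5 in h5 h6; lra.
have dE : d = c - m by rewrite /m; lra.
(* The end [k = Z] of the range; equality needs [c = 1 / 7], the class size in the blow-up of the
   seven-cycle. The end [k = 0] is [f0]. *)
have f1 : m * Z + m * b + m ^+ 2 / 2 + m * d <= 2 * (c * b).
  have : 0 <= (c - m) * (3 / 7 - c - b - (c + m) / 2).
    by apply: mulr_ge0; [lra|rewrite /Z in Zp; lra].
  have := sqr_ge0 (c - 1 / 7); rewrite dE /Z; lra.
have f0 : d * Z + m * b + m ^+ 2 / 2 + m * d <= 2 * (c * b).
  have Zc : 0 <= c * Z by rewrite mulr_ge0 // ltW.
  have c7 : c <= 1 / 7.
    rewrite leNgt; apply/negP => c7; have : 0 < (c - 1 / 7) * (c - 1 / 14).
      by apply: mulr_gt0; lra.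
    by move: Zc; rewrite /Z; lra.
  (* The expression is a concave quadratic in [m] with vertex at [A]; the cases are [A] beyond [c],
     below 0, and in between. *)
  pose A := 3 * (b + c) - 3 / 7.
  have goal : 3 * c / 7 - 2 * c ^+ 2 + (A * m - m ^+ 2 / 2) <= 2 / 49.
    have c2 : 0 <= c * (1 / 7 - c) by apply: mulr_ge0; lra.
    have [cA|Ac] := lerP c A.
      have : 0 <= (c - m) * (A - (c + m) / 2) by apply: mulr_ge0; lra.
      by rewrite /A; lra.
    have [A0|A0] := lerP A 0.
      have : A * m <= 0 by rewrite mulr_le0_ge0.
      have := sqr_ge0 m; have := sqr_ge0 (c - 3 / 28); lra.
    have : A * m - m ^+ 2 / 2 <= A ^+ 2 / 2 by have := sqr_ge0 (A - m); lra.
    have : A ^+ 2 <= A * c by rewrite expr2 ler_pM2l // ltW.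
    by have := sqr_ge0 (c - 1 / 7); rewrite /A; lra.
  by move: goal; rewrite dE /A /Z; lra.
(* The bound in [big] is linear in [k] with slope [m - d], whose sign decides which end of the range
   matters. *)
have [dm|md] := lerP d m.
  have : (m - d) * k <= (m - d) * Z.
    by apply: ler_wpM2l; lra.
  lra.
have : 0 < (d - m) * k by apply: mulr_gt0; lra.
lra.
Qed.

(* By AM-GM [s + 1 / (98 s) >= 1 / 5], which leaves at most [1 / 35] for [x0], [x2], [c - s]
   and [d - s] together. *)
Lemma estimate_near (c d s x0 x2 x4 x6 : F) :
  0 <= x0 -> 0 <= x2 -> 0 <= s -> s < d -> d <= c ->
  1 / 98 < s * x6 -> 1 / 98 < s * x4 -> 1 / 98 < x0 * d + (c - s) * (x2 + d) ->
  x0 + x2 + x4 + x6 + c + d <= 3 / 7 -> False.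
Proof.
move=> x0p x2p s0 sd dc h6 h4 hK h7.
have sp : 0 < s by move: s0; rewrite le0r => /orP[/eqP s0|//]; rewrite s0 mul0r in h4; lra.
pose b := (98 * s)^-1; have sb : s * b = 1 / 98 by rewrite /b; field; lra.
have bp : 0 < b by rewrite invr_gt0; lra.
have xb y : 1 / 98 < s * y -> b < y by rewrite -sb ltr_pM2l.
have x6b := xb _ h6; have x4b := xb _ h4.
have s_b : 1 / 5 <= s + b.
  rewrite leNgt; apply/negP => lt; have := sqr_ge0 (s - b).
  have : (s + b) * (s + b) <= 1 / 5 * (1 / 5) by apply: ler_pM; lra.
  lra.
have psi : x0 + x2 + (c - s) + (d - s) <= 1 / 35 by lra.
have s3 : s <= 3 / 14 by lra.
have p1 : (x0 + (c - s)) * d <= 1 / 35 * (1 / 4) by apply: ler_pM; lra.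
have p2 : (c - s) * x2 <= 1 / 35 * (1 / 35) by apply: ler_pM; lra.
lra.
Qed.

Variables u0 u1 u2 u3 u4 u5 u6 u7 : F.
Hypothesis sum_u : u0 + u1 + u2 + u3 + u4 + u5 + u6 + u7 = 1.
Hypothesis large_u : 4 / 7 <= u1 + u5.

(** In [estimate_far], [c] and [d] are the shares of classes 7 and 3, and [s1], [s5] are what
    classes 0, 1, 2 and classes 4, 5, 6 leave of a half. *)
Lemma far_classes : 0 <= u0 -> 0 <= u3 -> 0 <= u6 ->
  u0 + u1 + u2 + u3 <= 1 / 2 -> u3 + u4 + u5 + u6 <= 1 / 2 ->
  1 / 98 < (1 / 2 - (u0 + u1 + u7)) * u7 -> 1 / 98 < (1 / 2 - (u5 + u6 + u7)) * u7 ->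
  1 / 98 < u0 * u3 + (1 / 2 - (u0 + u1 + u2 + u3)) * (u2 + u3) ->
  1 / 98 < u6 * u3 + (1 / 2 - (u3 + u4 + u5 + u6)) * (u4 + u3) -> False.
Proof.
move=> p0 p3 p6 g1 g5; have su := sum_u; have lu := large_u.
have d1 : u3 <= 1 / 2 - u0 - u1 - u2 by lra.
have d5 : u3 <= 1 / 2 - u4 - u5 - u6 by lra.
have ds : 1 / 2 - u0 - u1 - u2 + (1 / 2 - u4 - u5 - u6) = u7 + u3 by lra.
have le : u0 + u2 + u4 + u6 + u7 + u3 <= 3 / 7 by lra.
move=> h3 h4 h5 h6; apply: estimate_far p0 p6 p3 d1 d5 ds _ _ _ _ le.
- by rewrite (_ : u7 * _ = (1 / 2 - (u0 + u1 + u7)) * u7) //; ring.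
- by rewrite (_ : u7 * _ = (1 / 2 - (u5 + u6 + u7)) * u7) //; ring.
- by rewrite (_ : (_ - u3) * _ = (1 / 2 - (u0 + u1 + u2 + u3)) * (u2 + u3)) //; ring.
- by rewrite (_ : (_ - u3) * _ = (1 / 2 - (u3 + u4 + u5 + u6)) * (u4 + u3)) //; ring.
Qed.

Lemma near_classes : 0 <= u0 -> 0 <= u2 ->
  u4 + u5 + u6 <= 1 / 2 -> u0 + u1 + u2 + u7 < 1 / 2 -> u3 <= u7 ->
  1 / 98 < (1 / 2 - (u4 + u5 + u6)) * u4 -> 1 / 98 < (1 / 2 - (u4 + u5 + u6)) * u6 ->
  1 / 98 < u0 * u3 + (1 / 2 - (u0 + u1 + u2 + u3)) * (u2 + u3) -> False.
Proof.
move=> p0 p2 g3 g4 g37; have su := sum_u; have lu := large_u.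
have s0 : 0 <= 1 / 2 - (u4 + u5 + u6) by lra.
have lt : 1 / 2 - (u4 + u5 + u6) < u3 by lra.
have e : u7 - (1 / 2 - (u4 + u5 + u6)) = 1 / 2 - (u0 + u1 + u2 + u3) by lra.
have le : u0 + u2 + u4 + u6 + u7 + u3 <= 3 / 7 by lra.
move=> h4 h6; rewrite -e => h5; exact: estimate_near p0 p2 s0 lt g37 h6 h4 h5 le.
Qed.

End RealEstimates.

(* The number of edges between the classes of an eight-cycle of independent classes when
   [wi] vertices are taken in the [i]-th class and all pairs of classes at cyclic distance
   three or four are completely joined. *)
Definition class_edges w0 w1 w2 w3 w4 w5 w6 w7 :=
  w0 * (w3 + w4 + w5) + w1 * (w4 + w5 + w6) + w2 * (w5 + w6 + w7) + w3 * (w6 + w7) + w4 * w7.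

Definition half_dense x0 x1 x2 x3 x4 x5 x6 x7 :=
  let n := x0 + x1 + x2 + x3 + x4 + x5 + x6 + x7 in
  forall w0 w1 w2 w3 w4 w5 w6 w7, w0 <= x0 -> w1 <= x1 -> w2 <= x2 -> w3 <= x3 -> w4 <= x4 ->
    w5 <= x5 -> w6 <= x6 -> w7 <= x7 ->
    w0 + w1 + w2 + w3 + w4 + w5 + w6 + w7 = n./2 ->
    n ^ 2 < 98 * class_edges w0 w1 w2 w3 w4 w5 w6 w7.

(* The symmetries [i -> 2 - i] and [i -> 6 - i] of the cycle of classes. *)
Lemma half_dense_flip2 x0 x1 x2 x3 x4 x5 x6 x7 :
  half_dense x0 x1 x2 x3 x4 x5 x6 x7 -> half_dense x2 x1 x0 x7 x6 x5 x4 x3.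
Proof.
move=> H n w2 w1 w0 w7 w6 w5 w4 w3 l2 l1 l0 l7 l6 l5 l4 l3 eqh.
have en : n = x0 + x1 + x2 + x3 + x4 + x5 + x6 + x7 by rewrite /n; lia.
rewrite en in eqh *; have := H w0 w1 w2 w3 w4 w5 w6 w7 l0 l1 l2 l3 l4 l5 l6 l7.
rewrite /class_edges => /(_ _)/leq_trans; apply; lia.
Qed.

Lemma half_dense_flip6 x0 x1 x2 x3 x4 x5 x6 x7 :
  half_dense x0 x1 x2 x3 x4 x5 x6 x7 -> half_dense x6 x5 x4 x3 x2 x1 x0 x7.
Proof.
move=> H n w6 w5 w4 w3 w2 w1 w0 w7 l6 l5 l4 l3 l2 l1 l0 l7 eqh.
have en : n = x0 + x1 + x2 + x3 + x4 + x5 + x6 + x7 by rewrite /n; lia.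
rewrite en in eqh *; have := H w0 w1 w2 w3 w4 w5 w6 w7 l0 l1 l2 l3 l4 l5 l6 l7.
rewrite /class_edges => /(_ _)/leq_trans; apply; lia.
Qed.

(** Rounding the half down is harmless: [w] is at most [n / 2 - r], so replacing it only raises the
    right-hand side. *)
Lemma density_scale (n w p q r : nat) : 0 < n -> 2 * (w + r) <= n ->
  n ^ 2 < 98 * (p + w * q) ->
  (1 / 98 < p%:R / n%:R ^+ 2 + (1 / 2 - r%:R / n%:R) * (q%:R / n%:R) :> rat)%R.
Proof.
move=> n0; rewrite -(ler_nat rat) -(ltr_nat rat) natrX !natrM !natrD natrM => le lt.
have N0 : (0 < n%:R :> rat)%R by rewrite ltr0n.
have N2 : (0 < n%:R ^+ 2 :> rat)%R by rewrite exprn_gt0.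
rewrite -(ltr_pM2r N2); set N := n%:R%R in le lt N0 N2 *.
have -> : ((p%:R / N ^+ 2 + (1 / 2 - r%:R / N) * (q%:R / N)) * N ^+ 2 =
    p%:R + (N / 2 - r%:R) * q%:R :> rat)%R by field; rewrite gt_eqF.
have : (0 <= (N / 2 - r%:R - w%:R) * q%:R :> rat)%R.
  by apply: mulr_ge0; [lra|rewrite ler0n].
lra.
Qed.

(** * Sparse halves made of classes *)

Section Classes.
Variables x0 x1 x2 x3 x4 x5 x6 x7 n h : nat.
Hypothesis nE : n = x0 + x1 + x2 + x3 + x4 + x5 + x6 + x7.
Hypothesis hn : 2 * h <= n <= 2 * h + 1.
Hypothesis pick : forall w0 w1 w2 w3 w4 w5 w6 w7, w0 <= x0 -> w1 <= x1 -> w2 <= x2 ->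
  w3 <= x3 -> w4 <= x4 -> w5 <= x5 -> w6 <= x6 -> w7 <= x7 ->
  w0 + w1 + w2 + w3 + w4 + w5 + w6 + w7 = h ->
  n ^ 2 < 98 * class_edges w0 w1 w2 w3 w4 w5 w6 w7.
Hypothesis large : 4 * n <= 7 * (x1 + x5).
Hypothesis le37 : x3 <= x7.

Let n0 : 0 < n.
Proof.
rewrite lt0n; apply/eqP => e0.
have : n ^ 2 < 98 * class_edges 0 0 0 0 0 0 0 0 by apply: pick => //; lia.
by rewrite e0.
Qed.

Let no_edges w0 w1 w2 w3 w4 w5 w6 w7 : w0 <= x0 -> w1 <= x1 -> w2 <= x2 ->
  w3 <= x3 -> w4 <= x4 -> w5 <= x5 -> w6 <= x6 -> w7 <= x7 ->
  class_edges w0 w1 w2 w3 w4 w5 w6 w7 = 0 -> w0 + w1 + w2 + w3 + w4 + w5 + w6 + w7 <> h.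
Proof.
move=> l0 l1 l2 l3 l4 l5 l6 l7 e0 eqh.
by have := pick l0 l1 l2 l3 l4 l5 l6 l7 eqh; rewrite e0.
Qed.

Let three x y z : h <= x + y + z ->
  exists w w' w'', [/\ w <= x, w' <= y, w'' <= z & w + w' + w'' = h].
Proof.
move=> le; exists (minn x h), (minn y (h - minn x h)), (h - minn x h - minn y (h - minn x h)).
by split; lia.
Qed.

Let indep017 : x0 + x1 + x7 < h.
Proof.
rewrite ltnNge; apply/negP => /three[w [w' [w'' [l l' l'' eqh]]]].
by apply: (@no_edges w w' 0 0 0 0 0 w'') => //; rewrite /class_edges; lia.
Qed.

Let indep567 : x5 + x6 + x7 < h.
Proof.
rewrite ltnNge; apply/negP => /three[w [w' [w'' [l l' l'' eqh]]]].
by apply: (@no_edges 0 0 0 0 0 w w' w'') => //; rewrite /class_edges; lia.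
Qed.

Let indep456 : x4 + x5 + x6 < h.
Proof.
rewrite ltnNge; apply/negP => /three[w [w' [w'' [l l' l'' eqh]]]].
by apply: (@no_edges 0 0 0 0 w w' w'' 0) => //; rewrite /class_edges; lia.
Qed.

Let complement r : r <= h -> exists w, w + r = h.
Proof. by move=> le; exists (h - r); rewrite subnK. Qed.

(** This half and the five that follow consist of whole classes with few edges between them and [w]
    vertices of one further class, which is large enough because the classes left out hold at most
    half of the vertices. *)
Let far3_nat : x3 + x4 + x5 + x6 <= h ->
  exists2 w, w + (x0 + x1 + x7) = h & n ^ 2 < 98 * (0 + w * x7).
Proof.
move=> le; have [|w eqh] := @complement (x0 + x1 + x7); first by lia.
exists w => //; rewrite (_ : _ + _ = class_edges x0 x1 w 0 0 0 0 x7).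
  by apply: pick => //; lia.
by rewrite /class_edges; ring.
Qed.

Let far4_nat : x0 + x1 + x2 + x3 <= h ->
  exists2 w, w + (x5 + x6 + x7) = h & n ^ 2 < 98 * (0 + w * x7).
Proof.
move=> le; have [|w eqh] := @complement (x5 + x6 + x7); first by lia.
exists w => //; rewrite (_ : _ + _ = class_edges 0 0 0 0 w x5 x6 x7).
  by apply: pick => //; lia.
by rewrite /class_edges; ring.
Qed.

Let far5_nat : x0 + x1 + x2 + x3 <= h ->
  exists2 w, w + (x0 + x1 + x2 + x3) = h & n ^ 2 < 98 * ((x0 * x3) + w * (x2 + x3)).
Proof.
move=> le; have [|w eqh] := @complement (x0 + x1 + x2 + x3); first by lia.
exists w => //; rewrite (_ : _ + _ = class_edges x0 x1 x2 x3 0 0 0 w).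
  by apply: pick => //; lia.
by rewrite /class_edges; ring.
Qed.

Let far6_nat : x0 + x1 + x2 + x3 <= h -> x3 + x4 + x5 + x6 <= h ->
  exists2 w, w + (x3 + x4 + x5 + x6) = h & n ^ 2 < 98 * ((x6 * x3) + w * (x4 + x3)).
Proof.
move=> le le'; have [|w eqh] := @complement (x3 + x4 + x5 + x6); first by lia.
exists w => //; rewrite (_ : _ + _ = class_edges 0 0 0 x3 x4 x5 x6 w).
  by apply: pick => //; lia.
by rewrite /class_edges; ring.
Qed.

Let near6_nat : h < x3 + x4 + x5 + x6 ->
  exists2 w, w + (x4 + x5 + x6) = h & n ^ 2 < 98 * (0 + w * x6).
Proof.
move=> le; have [|w eqh] := @complement (x4 + x5 + x6); first by lia.
exists w => //; rewrite (_ : _ + _ = class_edges 0 0 0 w x4 x5 x6 0).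
  by apply: pick => //; lia.
by rewrite /class_edges; ring.
Qed.

Let near4_nat : h < x3 + x4 + x5 + x6 ->
  exists2 w, w + (x4 + x5 + x6) = h & n ^ 2 < 98 * (0 + w * x4).
Proof.
move=> le; have [|w eqh] := @complement (x4 + x5 + x6); first by lia.
exists w => //; rewrite (_ : _ + _ = class_edges 0 0 0 0 x4 x5 x6 w).
  by apply: pick => //; lia.
by rewrite /class_edges; ring.
Qed.

Local Notation "''u_' x" := (x%:R / n%:R : rat)%R (at level 8, x at level 2).

Let uD x y : ('u_(x + y) = 'u_x + 'u_y)%R.
Proof. by rewrite natrD mulrDl. Qed.

Let sum_u : ('u_x0 + 'u_x1 + 'u_x2 + 'u_x3 + 'u_x4 + 'u_x5 + 'u_x6 + 'u_x7 = 1)%R.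
Proof. by rewrite -!uD -nE divff // pnatr_eq0 -lt0n. Qed.

Let u_ge0 x : (0 <= 'u_x)%R.
Proof. by rewrite divr_ge0 ?ler0n. Qed.

Let uM x y : ((x * y)%:R / n%:R ^+ 2 = 'u_x * 'u_y)%R.
Proof. by rewrite natrM mulf_div expr2. Qed.

Let u_le x y : x <= y -> ('u_x <= 'u_y)%R.
Proof. by move=> le; rewrite ler_pM2r ?ler_nat // invr_gt0 ltr0n. Qed.

Let u_half x : 2 * x < n -> ('u_x < 1 / 2)%R.
Proof.
move=> lt; have N0 : (0 < n%:R :> rat)%R by rewrite ltr0n.
rewrite (ltr_pdivrMr _ _ N0); move: lt N0; rewrite -(ltr_nat rat) natrM.
by move: (n%:R)%R (x%:R)%R => N y; lra.
Qed.

Let u_large : ('u_x1 + 'u_x5 >= 4 / 7)%R.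
Proof.
have N0 : (0 < n%:R :> rat)%R by rewrite ltr0n.
rewrite -uD (ler_pdivlMr _ _ N0).
by move: large N0; rewrite -(ler_nat rat) !natrM; move: (n%:R)%R (x1 + x5)%:R%R => N y; lra.
Qed.

Let scale p w q r : w + r = h -> n ^ 2 < 98 * (p + w * q) ->
  (1 / 98 < p%:R / n%:R ^+ 2 + (1 / 2 - 'u_r) * 'u_q :> rat)%R.
Proof. by move=> eqh; apply: density_scale => //; rewrite eqh; lia. Qed.

Let far3 : x3 + x4 + x5 + x6 <= h ->
  (1 / 98 < 0%:R / n%:R ^+ 2 + (1 / 2 - 'u_(x0 + x1 + x7)) * 'u_x7)%R.
Proof. by move=> le; have [w] := far3_nat le; apply: scale. Qed.

Let far4 : x0 + x1 + x2 + x3 <= h ->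
  (1 / 98 < 0%:R / n%:R ^+ 2 + (1 / 2 - 'u_(x5 + x6 + x7)) * 'u_x7)%R.
Proof. by move=> le; have [w] := far4_nat le; apply: scale. Qed.

Let far5 : x0 + x1 + x2 + x3 <= h ->
  (1 / 98 < (x0 * x3)%:R / n%:R ^+ 2 + (1 / 2 - 'u_(x0 + x1 + x2 + x3)) * 'u_(x2 + x3))%R.
Proof. by move=> le; have [w] := far5_nat le; apply: scale. Qed.

Let far6 : x0 + x1 + x2 + x3 <= h -> x3 + x4 + x5 + x6 <= h ->
  (1 / 98 < (x6 * x3)%:R / n%:R ^+ 2 + (1 / 2 - 'u_(x3 + x4 + x5 + x6)) * 'u_(x4 + x3))%R.
Proof. by move=> le le'; have [w] := far6_nat le le'; apply: scale. Qed.

Let near6 : h < x3 + x4 + x5 + x6 ->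
  (1 / 98 < 0%:R / n%:R ^+ 2 + (1 / 2 - 'u_(x4 + x5 + x6)) * 'u_x6)%R.
Proof. by move=> le; have [w] := near6_nat le; apply: scale. Qed.

Let near4 : h < x3 + x4 + x5 + x6 ->
  (1 / 98 < 0%:R / n%:R ^+ 2 + (1 / 2 - 'u_(x4 + x5 + x6)) * 'u_x4)%R.
Proof. by move=> le; have [w] := near4_nat le; apply: scale. Qed.

Let u_le_half x : x <= h -> ('u_x <= 1 / 2)%R.
Proof.
move=> le; have lt : 2 * x <= n by lia.
have N0 : (0 < n%:R :> rat)%R by rewrite ltr0n.
rewrite (ler_pdivrMr _ _ N0); move: lt N0; rewrite -(ler_nat rat) natrM.
by move: (n%:R)%R (x%:R)%R => N y; lra.
Qed.

Lemma classes_far : x0 + x1 + x2 + x3 <= h -> x3 + x4 + x5 + x6 <= h -> False.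
Proof.
move=> le1 le5; have [h3 h4 h5 h6] := And4 (far3 le5) (far4 le1) (far5 le1) (far6 le1 le5).
have g1 := u_le_half le1; have g5 := u_le_half le5; have su := sum_u; have lu := u_large.
rewrite mul0r add0r !uD in h3; rewrite mul0r add0r !uD in h4.
rewrite uM !uD in h5; rewrite uM !uD in h6; rewrite !uD in g1; rewrite !uD in g5.
have p0 := u_ge0 x0; have p6 := u_ge0 x6; have p3 := u_ge0 x3.
move: ('u_x0) ('u_x1) ('u_x2) ('u_x3) ('u_x4) ('u_x5) ('u_x6) ('u_x7)
  su lu h3 h4 h5 h6 g1 g5 p0 p6 p3.
move=> u0 u1 u2 u3 u4 u5 u6 u7 su lu h3 h4 h5 h6 g1 g5 p0 p6 p3.
exact: (far_classes su lu p0 p3 p6 g1 g5 h3 h4 h5 h6).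
Qed.

Lemma classes_near : h < x3 + x4 + x5 + x6 -> False.
Proof.
move=> gt; have le1 : x0 + x1 + x2 + x3 <= h by lia.
have [h6 h4 h5] := And3 (near6 gt) (near4 gt) (far5 le1).
have g3 : ('u_(x4 + x5 + x6) <= 1 / 2)%R by apply: u_le_half; apply: ltnW.
have g4 : ('u_(x0 + x1 + x2 + x7) < 1 / 2)%R by apply: u_half; lia.
have g37 := u_le le37; have su := sum_u; have lu := u_large.
rewrite mul0r add0r !uD in h6; rewrite mul0r add0r !uD in h4.
rewrite uM !uD in h5; rewrite !uD in g3; rewrite !uD in g4.
have p0 := u_ge0 x0; have p2 := u_ge0 x2.
move: ('u_x0) ('u_x1) ('u_x2) ('u_x3) ('u_x4) ('u_x5) ('u_x6) ('u_x7)
  su lu h4 h5 h6 g3 g4 g37 p0 p2.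
move=> u0 u1 u2 u3 u4 u5 u6 u7 su lu h4 h5 h6 g3 g4 g37 p0 p2.
exact: (near_classes su lu p0 p2 g3 g4 g37 h4 h6 h5).
Qed.

End Classes.

Lemma no_dense_classes x0 x1 x2 x3 x4 x5 x6 x7 : half_dense x0 x1 x2 x3 x4 x5 x6 x7 ->
  4 * (x0 + x1 + x2 + x3 + x4 + x5 + x6 + x7) <= 7 * (x1 + x5) -> False.
Proof.
wlog le37 : x0 x1 x2 x3 x4 x5 x6 x7 / x3 <= x7 => [main H le|H le].
  have [le37|/ltnW le73] := leqP x3 x7; first exact: main le37 H le.
  by apply: (main _ _ _ _ _ _ _ _ le73 (half_dense_flip2 H)); lia.
set n := x0 + _ + _ + _ + _ + _ + _ + _ in le.
have hn : 2 * n./2 <= n <= 2 * n./2 + 1 by lia.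
have [le1|gt1] := leqP (x0 + x1 + x2 + x3) n./2; last first.
  have nE : n = x6 + x5 + x4 + x3 + x2 + x1 + x0 + x7 by rewrite /n; lia.
  apply: (@classes_near x6 x5 x4 x3 x2 x1 x0 x7 n n./2) => //; last 2 first.
  - by rewrite addnC.
  - by move: gt1; lia.
  by rewrite nE; apply: half_dense_flip6.
have [le5|gt5] := leqP (x3 + x4 + x5 + x6) n./2; last first.
  exact: (@classes_near x0 x1 x2 x3 x4 x5 x6 x7 n n./2).
exact: (@classes_far x0 x1 x2 x3 x4 x5 x6 x7 n n./2).
Qed.

Definition far8 (i j : nat) := 3 <= (j + 8 - i) %% 8 <= 5.

(** * From class sizes to vertex sets *)

Section ClassCost.
Variables (T : finType) (e : rel T) (cls : T -> 'I_8).
Hypothesis cls_far : forall x y, e x y -> far8 (cls x) (cls y).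
Hypothesis half_cost : forall A : {set T}, #|A| = #|T|./2 -> #|T| ^ 2 < 49 * cost e A.

Definition class i := [set x | cls x == i].

Lemma big_class (A : {set T}) (g : 'I_8 -> nat) :
  \sum_(x in A) g (cls x) = \sum_i #|A :&: class i| * g i.
Proof.
rewrite (partition_big cls xpredT) //=; apply: eq_bigr => i _.
rewrite (eq_bigr (fun _ => g i)) => [|x /andP[_ /eqP->] //].
by rewrite sum_nat_cond_const; congr (_ * _); apply: eq_card => x; rewrite !inE.
Qed.

Lemma card_class (A : {set T}) : #|A| = \sum_i #|A :&: class i|.
Proof.
by rewrite -sum1_card (@big_class A (fun _ => 1)); apply: eq_bigr => i _; rewrite muln1.
Qed.

Lemma cost_class (A : {set T}) :
  cost e A <= \sum_i #|A :&: class i| * \sum_j #|A :&: class j| * far8 i j.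
Proof.
rewrite -(@big_class A (fun i => \sum_j #|A :&: class j| * far8 i j)).
apply: leq_sum => x _; rewrite -(@big_class A (fun j => far8 (cls x) j)).
by apply: leq_sum => y _; case: (boolP (e x y)) => // /cls_far->.
Qed.

Lemma class_choice (w : 'I_8 -> nat) : (forall i, w i <= #|class i|) ->
  exists A : {set T}, forall i, #|A :&: class i| = w i.
Proof.
move=> le; pose S i := [set x in take (w i) (enum (class i))].
exists [set x | x \in S (cls x)] => i.
have -> : [set x | x \in S (cls x)] :&: class i = S i.
  apply/setP => x; rewrite !inE; apply/andP/idP => [[+ /eqP <-] //|xi].
  have /eqP -> : cls x == i.
    by have := mem_take xi; rewrite mem_enum inE.
  by [].
rewrite cardsE; have /card_uniqP -> : uniq (take (w i) (enum (class i))).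
  by rewrite take_uniq // enum_uniq.
by rewrite size_takel // -cardE.
Qed.

Lemma half_dense_classes :
  let X i := #|class (inord i)| in half_dense (X 0) (X 1) (X 2) (X 3) (X 4) (X 5) (X 6) (X 7).
Proof.
move=> X n w0 w1 w2 w3 w4 w5 w6 w7 l0 l1 l2 l3 l4 l5 l6 l7 eqh.
pose w (i : 'I_8) := nth 0 [:: w0; w1; w2; w3; w4; w5; w6; w7] i.
have sum8 (g : 'I_8 -> nat) : \sum_i g i = g (inord 0) + g (inord 1) + g (inord 2) +
    g (inord 3) + g (inord 4) + g (inord 5) + g (inord 6) + g (inord 7).
  do 8!rewrite big_ord_recl; rewrite big_ord0 addn0 !addnA.
  by do !congr (_ + _); congr g; apply: val_inj; rewrite /= inordK.
have nE : #|T| = n by rewrite -cardsT card_class sum8 /n /X; do !rewrite setTI.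
have [|A wA] := @class_choice w.
  move=> i; rewrite -[i]inord_val /w; case: i => -[|[|[|[|[|[|[|[|i]]]]]]]] //= lt;
  by rewrite inordK.
have wE k : k < 8 -> #|A :&: class (inord k)| = nth 0 [:: w0; w1; w2; w3; w4; w5; w6; w7] k.
  by move=> lt; rewrite wA /w inordK.
have cardA : #|A| = #|T|./2.
  by rewrite card_class sum8 !wE //= nE.
have lt := half_cost cardA; rewrite nE in lt; apply: leq_trans lt _.
have le := cost_class A; rewrite (leq_trans (leq_mul (leqnn 49) le)) //.
rewrite sum8 !(sum8 (fun j => _ * _)) !wE //= !inordK // /class_edges /far8 /=.
lia.
Qed.

End ClassCost.

Section Edge.
Variables (T : finType) (e : rel T).
Hypothesis G : dense_c3c5_free e.
Hypothesis half_cost : forall A : {set T}, #|A| = #|T|./2 -> #|T| ^ 2 < 49 * cost e A.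
Variables u v : T.
Hypothesis uv : e u v.
Hypothesis large : 4 * #|T| <= 7 * (degree e u + degree e v).

Let eC := adjC G.
Local Notation D := (walk2 e).

(** Since [v] lies in block 2, [N v] lies in blocks 0 and 4, whose remaining vertices form classes 4
    and 6. Blocks 1 and 3 are split by having a common neighbour with [v], into classes 2 and 3, and
    0 and 7. *)
Lemma edge_classes : exists cls : T -> 'I_8, [/\ forall x y, e x y -> far8 (cls x) (cls y),
  class cls (inord 1) = nb e u & class cls (inord 5) = nb e v].
Proof.
have [a [b [w1 [w3 [z1 [z3 F]]]]]] := frame_exists G u.
pose blk := block e u a b w1.
pose c x := if e u x then 1 else if e v x then 5 else
  if blk x == 1 then (if D v x then 2 else 3) else if blk x == 3 then (if D v x then 0 else 7)
  else if blk x == 0 then 4 else 6.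
have c8 x : c x < 8 by rewrite /c; do !case: ifP => _.
have cK x : (inord (c x) : 'I_8) = c x :> nat by rewrite inordK.
have nuv x : e v x -> ~~ e u x by move=> vx; apply/negP; apply: (no_triangle G uv vx).
have far_sym i j : i < 8 -> j < 8 -> far8 i j -> far8 j i.
  by rewrite /far8 => li lj; lia.
have vR x : rest e u a b x -> ~~ e v x.
  by move=> Rx; apply: contra (rest_no2 F Rx) => vx; apply: walk2I uv vx.
have [[ua ub _] _ _ _ _] := F.
have nua x : e a x -> ~~ e u x by move=> ax; apply/negP; apply: (no_triangle G ua ax).
have nub x : e b x -> ~~ e u x by move=> bx; apply/negP; apply: (no_triangle G ub bx).
have D_adj x y : D v x -> e x y -> walk3 e v y.
  by move=> /existsP[t /andP[vt tx]] xy; apply: walk3I vt tx xy.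
exists (fun x => inord (c x)); split.
- move=> x y xy; rewrite !cK.
  suff main x' y' : e x' y' -> blk y' = (blk x' + 2) %% 5 -> far8 (c x') (c y').
    have [eb|eb] := block_adj G F xy; first exact: main.
    by apply: far_sym => //; apply: main => //; rewrite eC.
  move: x' y' => {}x {}y {}xy; rewrite /c /blk.
  case: (blockP G F x) => [bx nax|Rx w1x w3x|ux|Rx w3x w1x|ax];
    case: (blockP G F y) => [b_y nay|Ry w1y w3y|uy|Ry w3y w1y|ay] // _ /=.
  + by rewrite (negbTE (nub _ bx)) uy; case: (e v x).
  + have [ux _ _] := and3P Rx; have [uy _ _] := and3P Ry.
    rewrite (negbTE ux) (negbTE uy) (negbTE (vR _ Rx)) (negbTE (vR _ Ry)).
    case: (boolP (D v x)) => // vx; case: (boolP (D v y)) => // vy; exfalso.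
    (* Between blocks 1 and 3 only classes 2 and 0 are too close, and an edge joining them would
       close a walk of length 5 through [v]. *)
    by apply: (no_c5_23 G vy); apply: D_adj vx xy.
  + by rewrite ux (negbTE (nua _ ay)); case: (e v y).
  + have [ux _ _] := and3P Rx.
    rewrite (negbTE ux) (negbTE (vR _ Rx)) (negbTE (nub _ b_y)).
    case: (boolP (e v y)) => [vy|_]; last by case: (D v x).
    by rewrite (walk2I vy) // eC.
  + have [uy _ _] := and3P Ry.
    rewrite (negbTE uy) (negbTE (vR _ Ry)) (negbTE (nua _ ax)).
    case: (boolP (e v x)) => [vx|_]; last by case: (D v y).
    by rewrite (walk2I vx).
- by apply/setP => x; rewrite !inE -val_eqE /= cK inordK // /c; do !case: ifP.
- apply/setP => x; rewrite !inE -val_eqE /= cK inordK // /c.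
  have := nuv x; case: (e v x) => [/(_ isT)/negbTE->|_] //.
  by do !case: ifP.
Qed.

Lemma no_large_edge : False.
Proof.
have [cls [cls_far e1 e5]] := edge_classes.
have hd := half_dense_classes cls_far half_cost.
apply: (no_dense_classes hd); move: large; rewrite /degree -/(nb e u) -/(nb e v) -e1 -e5.
apply: leq_trans.
rewrite leq_mul2l /=; apply: eq_leq; rewrite -[RHS]cardsT [RHS](card_class cls).
do 8!rewrite big_ord_recl; rewrite big_ord0 addn0 !addnA.
by do !congr (_ + _); rewrite setTI; congr #|class _ _|; apply: val_inj; rewrite /= inordK.
Qed.

End Edge.

(** * Edge-maximal extensions and the theorem *)

Section Maximal.
Variables (T : finType) (e : rel T).
Hypothesis eC : symmetric e.
Hypothesis c5_free : forall x y, e x y -> ~~ walk4 e x y.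
Hypothesis deg_gt : forall x, #|T| < 5 * #|nb e x|.

(** Relations are represented by sets of ordered pairs, a finite type on which cardinality can be
    maximised. *)
Definition pair_rel (E : {set T * T}) : rel T := fun x y => (x, y) \in E.

Definition good_pairs (E : {set T * T}) :=
  [forall x, forall y, [&& pair_rel E x y == pair_rel E y x, e x y ==> pair_rel E x y &
    pair_rel E x y ==> ~~ walk4 (pair_rel E) x y]].

Lemma good_pairsP E : reflect
  [/\ symmetric (pair_rel E), subrel e (pair_rel E) &
      forall x y, pair_rel E x y -> ~~ walk4 (pair_rel E) x y] (good_pairs E).
Proof.
apply: (iffP forallP) => [H|[sym sub free] x].
  by split=> x y; have /forallP/(_ y)/and3P[/eqP ? /implyP ? /implyP ?] := H x.
apply/forallP => y; rewrite [X in X == _]sym eqxx /=.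
apply/andP; split; apply/implyP; first exact: sub.
exact: free.
Qed.

(* A closed walk of length five in [r + xy] becomes, after removing the traversals of the
   edge [xy], an even walk of length at most four from [x] to [y] or a shorter odd closed
   walk. *)
Lemma walk4_add_edge (r : rel T) x y : symmetric r -> (forall z, exists t, r z t) ->
  (forall z t, r z t -> ~~ walk4 r z t) -> x != y -> ~~ r x y -> ~~ walk4 r x y ->
  let r' z t := [|| r z t, (z == x) && (t == y) | (z == y) && (t == x)] in
  forall z t, r' z t -> ~~ walk4 r' z t.
Proof.
move=> rC r_nb free xy nxy n4 r'.
have nyx : ~~ r y x by rewrite rC.
have irr z : ~~ r z z.
  by apply/negP => zz; have /negP := free _ _ zz; apply; exact: (walk4I zz zz zz zz).
have n3 a b c : r a b -> r b c -> r c a -> False.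
  move=> ab bc ca; have /negP := free _ _ ab; apply; rewrite rC in ca.
  by rewrite rC in bc; apply: (walk4I ca _ ca bc); rewrite rC.
have n2 a : r x a -> r a y -> False.
  by move=> xa ay; case/negP: n4; apply: (walk4I xa _ xa ay); rewrite rC.
have step z t : r' z t -> [\/ r z t, z = x /\ t = y | z = y /\ t = x].
  by case/or3P => [|/andP[/eqP-> /eqP->]|/andP[/eqP-> /eqP->]];
    [constructor 1|constructor 2|constructor 3].
have r'C : symmetric r'.
  move=> z t; rewrite /r' rC; congr (_ || _).
  by rewrite orbC; congr (_ || _); apply: andbC.
have main b c d : r' x b -> r' b c -> r' c d -> r' d y -> False.
  move=> /step[xb|[_ eb]|[exy _]]; last by rewrite exy eqxx in xy.
    move=> /step[bc|[eb _]|[eb _]]; subst; last 2 first.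
    - by rewrite (negbTE (irr _)) in xb.
    - by rewrite xb in nxy.
    move=> /step[cd|[ec ed]|[ec ed]]; subst.
    - move=> /step[dy|[ed _]|[_ eyx]]; subst.
      + by case/negP: n4; apply: walk4I xb bc cd dy.
      + exact: n3 xb bc cd.
      + by rewrite eqxx in xy.
    - move=> /step[dy|[eyx _]|[_ eyx]]; subst; rewrite ?eqxx // in xy.
      by rewrite (negbTE (irr _)) in dy.
    - by move=> _; apply: n2 xb bc.
  subst; move=> /step[yc|[eyx _]|[_ ec]]; subst; first 2 [by rewrite eqxx in xy].
  - move=> /step[cd|[ec _]|[ec _]]; subst.
    + move=> /step[dy|[ed _]|[_ eyx]]; subst; [exact: n3 yc cd dy| |by rewrite eqxx in xy].
      by apply: n2; rewrite rC; [exact: cd|exact: yc].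
    + by rewrite yc in nyx.
    + by rewrite (negbTE (irr _)) in yc.
  - move=> /step[xd|[_ ed]|[eyx _]]; subst; last by rewrite eqxx in xy.
    + move=> /step[dy|[ed _]|[_ eyx]]; subst; [exact: n2 xd dy| |by rewrite eqxx in xy].
      by rewrite (negbTE (irr _)) in xd.
    + move=> /step[dy|[eyx _]|[_ eyx]]; subst; rewrite ?eqxx // in xy.
      by rewrite (negbTE (irr _)) in dy.
have main' p q b c d : [\/ r p q, p = x /\ q = y | p = y /\ q = x] ->
    r' p b -> r' b c -> r' c d -> r' d q -> ~~ r p q -> False.
  case=> [->//|[-> ->]|[-> ->]] pb bc cd dq _; first exact: main pb bc cd dq.
  rewrite r'C in pb; rewrite r'C in bc; rewrite r'C in cd; rewrite r'C in dq.
  exact: main dq cd bc pb.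
(* The closed walk is rotated so that an added edge, if it uses one, comes first and [main']
   applies. *)
move=> z t zt; apply/negP => /(walk4P r')[a [b [c [za ab bc ct]]]].
have [rzt|nzt] := boolP (r z t); last exact: main' (step _ _ zt) za ab bc ct nzt.
have tz : r' t z by rewrite r'C.
have [rza|nza] := boolP (r z a); last first.
  by apply: main' (step _ _ za) _ _ _ _ nza; rewrite r'C; [exact: tz|exact: ct|exact: bc|exact: ab].
have [rab|nab] := boolP (r a b); last first.
  by apply: main' (step _ _ ab) _ _ _ _ nab; rewrite r'C; [exact: za|exact: tz|exact: ct|exact: bc].
have [rbc|nbc] := boolP (r b c); last first.
  by apply: main' (step _ _ bc) _ _ _ _ nbc; rewrite r'C; [exact: ab|exact: za|exact: tz|exact: ct].
have [rct|nct] := boolP (r c t); last first.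
  by apply: main' (step _ _ ct) _ _ _ _ nct; rewrite r'C; [exact: bc|exact: ab|exact: za|exact: tz].
by have /negP := free _ _ rzt; apply; apply: walk4I rza rab rbc rct.
Qed.

Lemma maximal_extension : exists2 r : rel T, dense_c3c5_free r & subrel e r.
Proof.
pose E0 := [set q : T * T | e q.1 q.2].
have E0e : pair_rel E0 =2 e by move=> x y; rewrite /pair_rel inE.
have walk4_ext (r1 r2 : rel T) x y : subrel r1 r2 -> walk4 r1 x y -> walk4 r2 x y.
  by move=> sub /walk4P[a [b [c [h1 h2 h3 h4]]]]; apply: walk4I; apply: sub; eassumption.
have good0 : good_pairs E0.
  apply/good_pairsP; split=> x y; rewrite !E0e // => xy; apply: contra (c5_free xy).
  by apply: walk4_ext => z t; rewrite E0e.
have [E goodE maxE] := @arg_maxnP _ E0 good_pairs (fun E : {set T * T} => #|E|) good0.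
have [sym sub free] := good_pairsP _ goodE.
have r_nb z : exists t, pair_rel E z t.
  have := deg_gt z; case: (set_0Vmem (nb e z)) => [->|[t]]; first by rewrite cards0.
  by rewrite inE => /sub; exists t.
exists (pair_rel E) => //; split=> //.
- move=> x y xy /existsP[z /andP[xz zy]]; have /negP := free _ _ xy; apply.
  by apply: (walk4I xz _ xz zy); rewrite sym.
- by move=> x y /free/negP.
- move=> x y nxy; apply: contraT => n4.
  (* Nonadjacent pairs include [x = y], where going to a neighbour and back twice is the walk. *)
  have [exy|xy] := eqVneq x y.
    have [t xt] := r_nb x; case/negP: n4; rewrite -exy.
    by apply: (walk4I xt _ xt); rewrite sym.
  pose E' := (x, y) |: ((y, x) |: E).
  have E'e z t : pair_rel E' z t =
      [|| pair_rel E z t, (z == x) && (t == y) | (z == y) && (t == x)].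
    by rewrite /pair_rel !inE !xpair_eqE orbC -orbA orbCA orbA [RHS]orbA orbAC.
  have := walk4_add_edge sym r_nb free xy nxy n4 => free'.
  have good' : good_pairs E'.
    apply/good_pairsP; split=> z t; rewrite !E'e.
    - by rewrite sym; congr (_ || _); rewrite orbC; congr (_ || _); apply: andbC.
    - by move=> /sub->.
    - move=> /free'; apply: contra; apply: walk4_ext => p q; by rewrite E'e.
  have : #|E| < #|E'|; last by move=> lt; have : #|E'| <= #|E| := maxE _ good'; rewrite leqNgt lt.
  apply: proper_card; apply/properP; split; first by rewrite /E' setUA subsetUr.
  by exists (x, y); rewrite ?inE ?eqxx.
- move=> x; apply: leq_trans (deg_gt x) _; rewrite leq_mul2l subset_leq_card //.
  by apply/subsetP => y; rewrite !inE; apply: sub.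
Qed.

End Maximal.

(** * Sparse halves of the given graph *)

Lemma no_half_dense (T : finType) (e : rel T) : symmetric e -> 0 < #|T| ->
  (forall x y, e x y -> ~~ walk4 e x y) -> (forall x, #|T| < 5 * #|nb e x|) ->
  exists2 A : {set T}, #|A| = #|T|./2 & 49 * cost e A <= #|T| ^ 2.
Proof.
move=> eC /card_gt0P[x0 _] free deg_e.
have [r G sub] := maximal_extension eC free deg_e.
suff /exists_inP[A /eqP cardA le] :
    [exists (A : {set T} | #|A| == #|T|./2), 49 * cost r A <= #|T| ^ 2].
  exists A => //; apply: leq_trans le; rewrite leq_mul2l /=.
  apply: leq_sum => x _; apply: leq_sum => y _.
  by case: (boolP (e x y)) => // /sub->.
apply: contraT; rewrite negb_exists_in => /forall_inP big; exfalso.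
have half (A : {set T}) : #|A| = #|T|./2 -> #|T| ^ 2 < 49 * cost r A.
  by move=> /eqP/big; rewrite -ltnNge.
have rI : irreflexive r by move=> x; apply/negP => xx; apply: (no_triangle G xx xx xx).
have [blk [kap O]] := cyclic_order_exists G.
have C := circle_circular (adjC G) O x0.
have [u [v [uv le]]] := dense_edge (adjC G) rI C half.
by have := no_large_edge G half uv le.
Qed.

Lemma edges_in_cost (T : finType) (e : rel T) (A : {set T}) : symmetric e -> irreflexive e ->
  2 * #|edges_in e A| <= cost e A.
Proof.
move=> eC eI; pose f (q : T * T) := [set q.1; q.2].
pose P := [set q : T * T | [&& q.1 \in A, q.2 \in A & e q.1 q.2]].
have -> : cost e A = #|P|.
  rewrite /cost pair_big_dep /= -sum1_card [RHS]big_mkcond [LHS]big_mkcond /=.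
  by apply: eq_bigr => q _; rewrite inE; case: (q.1 \in A); case: (q.2 \in A); case: (e _ _).
have fP q : q \in P -> f q \in edges_in e A.
  rewrite !inE => /and3P[q1 q2 eq]; apply/andP; split; last first.
    by apply/subsetP => z; rewrite !inE => /orP[]/eqP->.
  by apply/imset2P; exists q.1 q.2; rewrite ?inE.
rewrite -[#|P|]sum1_card (partition_big f (mem (edges_in e A)) fP) /= mulnC -sum_nat_const.
apply: leq_sum => E; rewrite inE => /andP[/imset2P[x y _]]; rewrite inE /= => exy -> sub.
have [xA yA] : x \in A /\ y \in A.
  by split; apply: (subsetP sub); rewrite !inE eqxx ?orbT.
have xy : x != y by apply: contraL exy => /eqP->; rewrite eI.
rewrite (bigD1 (x, y)) /= ?inE ?xA ?yA ?exy /f /= ?eqxx //.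
rewrite (bigD1 (y, x)) //= !inE /= xA yA eC exy /= setUC eqxx /=.
by apply: contra xy => /eqP[->].
Qed.

Lemma min_degree_le (T : finType) (e : rel T) x : min_degree e <= degree e x.
Proof.
rewrite /min_degree; have := mem_index_enum x; elim: (index_enum T) => // y s IH.
rewrite inE big_cons => /orP[/eqP<-|/IH le]; first exact: geq_minl.
exact: leq_trans (geq_minr _ _) le.
Qed.

(** A closed walk of length 5 is a 5-cycle, or a coincidence among its vertices leaves a
    triangle. *)
Lemma odd_girth7_walk4 (T : finType) (e : rel T) : simple_graph e -> odd_girth_at_least e 7 ->
  forall x y, e x y -> ~~ walk4 e x y.
Proof.
move=> [eC eI] girth.
have ne x y : e x y -> x != y by apply: contraTN => /eqP->; rewrite eI.
have no3 x y z : e x y -> e y z -> e z x -> False.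
  move=> xy yz zx; apply: girth; exists [:: x; y; z]; split=> //; split=> //=.
  rewrite /ucycle /= xy yz zx /= !inE !negb_or (ne _ _ xy) (ne _ _ yz) /=.
  by rewrite eq_sym (ne _ _ zx).
move=> x y xy; apply/negP => /(walk4P e)[a [b [c [xa ab bc cy]]]].
have yx : e y x by rewrite eC.
have [exb|xb] := eqVneq x b; first by apply: (no3 x c y) => //; rewrite exb.
have [exc|xc] := eqVneq x c; first by apply: (no3 x a b) => //; rewrite exc.
have [eac|ac] := eqVneq a c; first by apply: (no3 x a y) => //; rewrite eac.
have [eay|ay] := eqVneq a y; first by apply: (no3 a b c) => //; rewrite eay.
have [eby|b_y] := eqVneq b y; first by apply: (no3 x a y) => //; rewrite -eby.
apply: girth; exists [:: x; a; b; c; y]; split=> //; split=> //.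
rewrite /ucycle /= xa ab bc cy yx /= !inE !negb_or xb xc ac ay b_y.
by rewrite (ne _ _ xa) (ne _ _ xy) (ne _ _ ab) (ne _ _ bc) (ne _ _ cy).
Qed.

Local Open Scope ring_scope.

Theorem corollary1p5 (R : archiRealFieldType) (T : finType) (e : rel T)
    (n : nat) (e_simple : simple_graph e) (card_T : #|T| = n)
    (girth_e : odd_girth_at_least e 7)
    (deg_e : n%:R / 5%:R < (min_degree e)%:R :> R) :
  ~ dense_graph e (1 / 2%:R : R) (1 / 98%:R : R).
Proof.
move=> dense; have [eC eI] := e_simple.
have deg x : (#|T| < 5 * #|nb e x|)%N.
  rewrite card_T; apply: (@leq_trans (5 * min_degree e)); last first.
    by rewrite leq_mul2l min_degree_le.
  by move: deg_e; rewrite ltr_pdivrMr ?ltr0n // -natrM ltr_nat mulnC.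
have T0 : (0 < #|T|)%N.
  (* Without vertices the default value makes the minimum degree 0, which does not exceed 0. *)
  rewrite lt0n; apply/eqP => T0; move: deg_e; rewrite -card_T T0 mul0r ltr0n /min_degree.
  by rewrite big_pred0 => [|x]; [rewrite T0|have := card0_eq T0 x].
have [A cardA le] := no_half_dense eC T0 (odd_girth7_walk4 e_simple girth_e) deg.
have floor_half : Num.floor (1 / 2%:R * #|T|%:R : R) = #|T|./2%:Z.
  apply: floor_def; rewrite addrC -intS -!pmulrn.
  have lo : (2 * #|T|./2 <= #|T|)%N by lia.
  have hi : (#|T| < 2 * #|T|./2.+1)%N by lia.
  by move: lo hi; rewrite -(ler_nat R) -(ltr_nat R) !natrM => lo hi; apply/andP; split; lra.
have := dense A; rewrite cardA floor_half => /(_ erefl).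
have le2 : (98 * #|edges_in e A| <= #|T| ^ 2)%N.
  by have := edges_in_cost A eC eI; lia.
rewrite mulrC mulrA mulr1 ltr_pdivrMr ?ltr0n // -natrX -natrM ltr_nat.
by rewrite mulnC ltnNge le2.
Qed.
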